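(* Let $a\in\mathcal H$ be a real-valued $1$-form such that $\sup_{|w|=m}4^m\bigl\|(a-a_m)\mathbf 1_w\bigr\|_{\mathcal H}\to0$ as $m\to\infty$. If $f\in\operatorname{dom}(\mathcal M^a)$, then $4^m\mathcal M^{a_m}_mf$ converges uniformly to $\mathcal M^af$ on $V_*\setminus V_0$ (that is, $\sup_{x\in V_m\setminus V_0}|4^m\mathcal M^{a_m}_mf(x)-\mathcal M^af(x)|\to0$ as $m\to\infty$).
   Context: Diamond lattice fractal. Fix $0<s\le 1/8$ and for $j=1,2,3,4$ let $F_j:\mathbb R^2\to\mathbb R^2$, $F_j(x_1,x_2)=\bigl(\tfrac12x_1,\ \tfrac12((-1)^jx_1+4s\,x_2)\bigr)+\tfrac1{\sqrt2}\bigl(\cos((2j-1)\pi/4),\sin((2j-1)\pi/4)\bigr)$. $X\subset\mathbb R^2$ is the unique non-empty compact set with $X=\bigcup_{j=1}^4F_j(X)$. Put $V_0=\{(-1,0),(1,0)\}$, $V_m=\bigcup_jF_j(V_{m-1})$, $V_*=\bigcup_mV_m$. For a word $w=w_1\cdots w_m\in\{1,2,3,4\}^m$ write $|w|=m$, $F_w=F_{w_1}\circ\cdots\circ F_{w_m}$; $F_w(X)$ is an $m$-cell with indicator function $\mathbf 1_w$. Write $x\sim_my$ if $\{x,y\}=F_w(V_0)$ for some $|w|=m$, and $\deg_m(x)$ for the number of $y$ with $y\sim_mx$. $\mu$ is Hausdorff measure on $X$ scaled so that $\mu(X)=2$. Dirichlet form. $\mathcal E_m(f)=\frac12\sum_{x\in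 V_m}\sum_{y\sim_mx}|f(x)-f(y)|^2$ is non-decreasing in $m$; when the limit is finite write $f\in\mathcal F$ and $\mathcal E(f)=\lim_m\mathcal E_m(f)$; $\mathcal F_0=\{f\in\mathcal F:f|_{V_0}=0\}$. It is taken as known that $\mathcal E$ is an irreducible local regular Dirichlet form on $L^2(X,\mu)$ with domain $\mathcal F$, and that functions in $\mathcal F$ can be approximated uniformly by functions $h$ harmonic at some finite scale $m$ (i.e. $\mathcal E_n(h)=\mathcal E_m(h)$ for all $n\ge m$). $1$-forms. $\mathcal H$ is the Hilbert space of $1$-forms of $\mathcal E$: the completion (modulo null vectors) of the span of $f\otimes g$, $f\in\mathcal F$, $g$ bounded Borel, with $\langle f\otimes g,f'\otimes g'\rangle_{\mathcal H}=\int g\overline{g'}\,d\Gamma(f,f')$, where $\Gamma$ is the energy measure normalized by $\Gamma(f,f)(X)=\mathcal E(f)$. The derivation $\partial:\mathcal F\to\mathcal H$ is $\partial f=f\otimes\mathbf 1$; multiplication (by functions in $\mathcal F$ and by indicators of cells) is $h(f\otimes g)=f\otimes(hg)$. A $1$-form is real-valued if it lies in the closure of the real span of $f\otimes g$ with $f,g$ real-valued. Projections. $\mathcal H_m\subset\mathcal H$ is the (finite-dimensional) span of the elements $(\partial A)\mathbf 1_w$ with $|w|=m$ and $A$ harmonic at scale $m$; $a_m$ is the orthogonal projection of $a$ onto $\mathcal H_m$. For real $a$, $a_m=\sum_{|w|=m}(\partial A_w)\mathbf 1_w$ with $A_w$ real-valued, harmonic at scale $m$, unique modulo constants on $F_w(X)$.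 For $x\sim_my$ with $\{x,y\}=F_w(V_0)$, $|w|=m$, put $a_m(e_{xy})=A_w(y)-A_w(x)$. Magnetic operators. $\mathcal E^a(f)=\|(\partial+ia)f\|_{\mathcal H}^2$, with $\mathcal E^a(f,g)$ by polarization. The (Dirichlet) magnetic operator $\mathcal M^a$: $f\in\operatorname{dom}(\mathcal M^a)$ and $\mathcal M^af=u$ if $f\in\mathcal F$ and $u$ is a continuous function on $X$ with $\mathcal E^a(f,g)=\langle -u,g\rangle_{L^2(\mu)}$ for all $g\in\mathcal F_0$. The graph magnetic operator is $\mathcal M^{a_m}_mf(x)=\frac{-1}{\deg_m(x)}\sum_{y\sim_mx}\bigl(f(x)-f(y)e^{ia_m(e_{xy})}\bigr)$ for $x\in V_m\setminus V_0$.
   Formalization: Since literal Hausdorff measure on X cannot be scaled to mass 2 (it vanishes in the critical dimension), μ is taken as the self-similar measure with μ(X)=2 and μ(F_j(B))=μ(B)/4; F is taken as the continuous functions on X with finite limiting energy. *)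

(* Defs.v *)
(* MathComp-Analysis, with R[i] from mathcomp-real-closed for the complex
   numbers. *)
From HB Require Import structures.
From mathcomp Require Import all_boot all_order all_algebra.
From mathcomp Require Import all_classical all_reals all_analysis.
From mathcomp Require Import finmap.
From mathcomp Require Export complex.

Set Implicit Arguments.
Unset Strict Implicit.
Unset Printing Implicit Defensive.

Import Order.TTheory GRing.Theory Num.Theory.
Import numFieldNormedType.Exports.

Local Open Scope classical_set_scope.
Local Open Scope ring_scope.
Local Open Scope complex_scope.

Section Lattice.
Context {R : realType}.
Variable s : R.

(* 'I_4 = {0, 1, 2, 3} stands for {1, 2, 3, 4}. *)
Definition diamond_map (j : 'I_4) (x : R * R) : R * R :=
  let k := j.+1 in
  let t := (2 * k%:R - 1) * pi / 4 in
  (2^-1 * x.1 + (Num.sqrt 2)^-1 * cos t,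
   2^-1 * ((-1) ^+ k * x.1 + 4 * s * x.2) + (Num.sqrt 2)^-1 * sin t).

Definition word_map (w : seq 'I_4) : R * R -> R * R :=
  foldr (fun j g => diamond_map j \o g) id w.

Definition is_diamond_fractal (X : set (R * R)) : Prop :=
  [/\ X !=set0, compact X & X = \bigcup_(j in [set: 'I_4]) (diamond_map j @` X)].

Fixpoint vertices (m : nat) : set (R * R) :=
  if m is n.+1 then \bigcup_(j in [set: 'I_4]) (diamond_map j @` vertices n)
  else [set (-1, 0); (1, 0)].

Definition is_edge m (w : m.-tuple 'I_4) (x y : R * R) : Prop :=
  [set x; y] = word_map w @` vertices 0.

Definition adj (m : nat) (x y : R * R) : Prop :=
  exists w : m.-tuple 'I_4, is_edge w x y.

Definition degree (m : nat) (x : R * R) : nat :=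
  #|` fset_set [set y | adj m x y]|.

(* The word of an edge is unique, since distinct cells of the same level have
   distinct pairs of boundary points. *)
Definition edge_word (m : nat) (x y : R * R) : m.-tuple 'I_4 :=
  xget [tuple ord0 | _ < m] [set w | is_edge w x y].

End Lattice.

(* A function on X is represented by a function on the whole plane; only its
   values on X matter below. *)
Notation cfun R := (R * R -> R[i]).

Definition polarize {R : realType} (Q : cfun R -> R[i]) (f g : cfun R) : R[i] :=
  4^-1 * \sum_(k < 4) (0 +i* 1) ^+ k * Q (fun x => f x + (0 +i* 1) ^+ k * g x).

Definition cintegral {R : realType} (nu : {measure set (R * R) -> \bar R})
    (D : set (R * R)) (f : cfun R) : R[i] :=
  (\int[nu]_(x in D) complex.Re (f x)) +i* (\int[nu]_(x in D) complex.Im (f x)).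

(* The library's norm over R[i] takes its (real) values in R[i]. *)
Definition rnorm {R : realType} {V : normedZmodType R[i]} (v : V) : R :=
  complex.Re `|v|.

Definition cembed {R : realType} (f : R * R -> R) : cfun R := fun x => (f x)%:C.

Section Fractal.
Context {R : realType}.
Variables (s : R) (X : set (R * R)).
Implicit Types (f g h A phi u : cfun R) (m n : nat).

Definition cell (w : seq 'I_4) : set (R * R) := word_map s w @` X.

(* Hausdorff measure is understood intrinsically, as the self-similar measure
   with equal weights: 1/4 is the factor of two-dimensional Hausdorff measure
   under a map that halves distances.  With the total mass, this law determines
   mu, and every m-cell has mass 2 / 4 ^ m.  Hausdorff measures for the Euclidean
   metric of the plane do not obey it: the maps are not similitudes there. *)
Definition is_fractal_measure (mu : {measure set (R * R) -> \bar R}) : Prop :=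
  [/\ mu X = 2%:E, mu (~` X) = 0%E &
      forall (j : 'I_4) (B : set (R * R)), measurable B -> B `<=` X ->
        mu (diamond_map s j @` B) = (4^-1%:E * mu B)%E].

Definition continuous_on f : Prop :=
  {within X, continuous (f : R * R -> R[i]^o)}.

Definition graph_energy m f : R :=
  2^-1 * \sum_(x \in vertices s m) \sum_(y \in [set y | adj s m x y])
    rnorm (f x - f y) ^+ 2.

(* The domain consists of continuous functions: they are the uniform limits on X
   of functions that are harmonic at some finite scale. *)
Definition in_domain f : Prop :=
  continuous_on f /\ cvgn (fun m => graph_energy m f).

Definition energy f : R := limn (fun m => graph_energy m f).

Definition energy_form : cfun R -> cfun R -> R[i] :=
  polarize (fun h => (energy h)%:C).

Definition in_domain0 f : Prop :=
  in_domain f /\ forall x, vertices s 0 x -> f x = 0.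

Definition real_on f : Prop := forall x, X x -> complex.Im (f x) = 0.

Definition harmonic_at m A : Prop :=
  in_domain A /\ forall n, (m <= n)%N -> graph_energy n A = graph_energy m A.

Definition bounded_borel g : Prop :=
  [/\ measurable_fun X (fun x => complex.Re (g x)),
      measurable_fun X (fun x => complex.Im (g x)) &
      exists M : R, forall x, X x -> rnorm (g x) <= M].

(* For phi real, the integral of phi against Gamma(f, f) is
   Re E(phi f, f) - E(|f|^2, phi) / 2. *)
Definition is_energy_measure f (nu : {measure set (R * R) -> \bar R}) : Prop :=
  [/\ nu X = (energy f)%:E, nu (~` X) = 0%E &
      forall phi : R * R -> R, in_domain (cembed phi) ->
        \int[nu]_(x in X) phi x =
          complex.Re (energy_form (fun x => (phi x)%:C * f x) f)
          - 2^-1 * complex.Re (energy_form (fun x => f x * conjc (f x)) (cembed phi))].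

Definition cell_indicator (w : seq 'I_4) : cfun R := \1_(cell w).

End Fractal.

Section OneForms.
Context {R : realType}.
Variables (s : R) (X : set (R * R)).

(* f |-> Gamma f is the quadratic form f |-> Gamma(f, f). *)
Definition is_energy_measures
    (Gamma : cfun R -> {measure set (R * R) -> \bar R}) : Prop :=
  forall f, in_domain s X f -> is_energy_measure s X f (Gamma f).

Variable Gamma : cfun R -> {measure set (R * R) -> \bar R}.

Definition tensor_sums (H : zmodType) (tensor : cfun R -> cfun R -> H)
    (P : cfun R -> Prop) : set H :=
  [set a | exists (n : nat) (f g : 'I_n -> cfun R),
    (forall i, [/\ in_domain s X (f i), bounded_borel X (g i), P (f i) & P (g i)])
    /\ a = \sum_(i < n) tensor (f i) (g i)].

(* The completion, given up to isometry by its inner product on the dense span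
   of the f (x) g.  The multiplication is the continuous extension of
   h (f (x) g) = f (x) (h g). *)
Record one_forms := OneForms {
  form_space :> completeNormedModType R[i];
  form_dot : {dot form_space for @conjc R};
  form_norm_dot : forall a : form_space, `|a| ^+ 2 = form_dot a a;
  tensor : cfun R -> cfun R -> form_space;
  form_dot_tensor : forall f g f' g',
    in_domain s X f -> bounded_borel X g ->
    in_domain s X f' -> bounded_borel X g' ->
    form_dot (tensor f g) (tensor f' g') =
      polarize (fun h => cintegral (Gamma h) X (fun x => g x * conjc (g' x))) f f';
  tensor_dense : closure (tensor_sums tensor (fun _ => True)) = setT;
  form_mul : cfun R -> {linear form_space -> form_space};
  form_mul_continuous : forall h, bounded_borel X h -> continuous (form_mul h);
  form_mul_tensor : forall h f g,
    bounded_borel X h -> in_domain s X f -> bounded_borel X g ->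
    form_mul h (tensor f g) = tensor f (fun x => h x * g x)
}.

Variable H : one_forms.

Definition deriv (f : cfun R) : H := tensor H f (fun _ => 1).

Definition real_form (a : H) : Prop :=
  closure (tensor_sums (tensor H) (real_on X)) a.

Definition scale_forms (m : nat) : set H :=
  [set a | exists (n : nat) (A : 'I_n -> cfun R) (w : 'I_n -> m.-tuple 'I_4),
    (forall i, harmonic_at s X m (A i)) /\
    a = \sum_(i < n) form_mul H (cell_indicator s X (w i)) (deriv (A i))].

Definition form_proj (m : nat) (a : H) : H :=
  xget 0 [set b | scale_forms m b /\
                  forall c, scale_forms m c -> form_dot H (a - b) c = 0].

Definition potential (m : nat) (b : H) : m.-tuple 'I_4 -> R * R -> R :=
  xget (fun _ _ => 0)
    [set A | (forall w, harmonic_at s X m (cembed (A w))) /\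
             b = \sum_(w : m.-tuple 'I_4)
                   form_mul H (cell_indicator s X w) (deriv (cembed (A w)))].

Definition edge_value (m : nat) (a : H) (x y : R * R) : R :=
  let A := potential (form_proj m a) (edge_word s m x y) in A y - A x.

Definition magnetic_energy (a : H) (f : cfun R) : R[i] :=
  `|deriv f + (0 +i* 1) *: form_mul H f a| ^+ 2.

Definition magnetic_form (a : H) : cfun R -> cfun R -> R[i] :=
  polarize (magnetic_energy a).

(* f is in the domain of the magnetic operator and u is its image. *)
Definition magnetic_op (mu : {measure set (R * R) -> \bar R}) (a : H)
    (f u : cfun R) : Prop :=
  [/\ in_domain s X f, continuous_on X u &
      forall g, in_domain0 s X g ->
        magnetic_form a f g = cintegral mu X (fun x => - u x * conjc (g x))].

Definition graph_magnetic_op (m : nat) (a : H) (f : cfun R) (x : R * R) : R[i] :=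
  -1 / (degree s m x)%:R *
    \sum_(y \in [set y | adj s m x y])
      (f x - f y * (cos (edge_value m a x y) +i* sin (edge_value m a x y))).

End OneForms.

(* Main.v *)
(* On an m-cell, functions harmonic at scale m are affine in the first
   coordinate x1, so on the cell F_w(X) the projection a_m equals c_w dx1.  There
   it is exact: with E_w(z) = exp(i c_w (z_1 - x_1)) one has
   d + i a_m = E_w^-1 d E_w.  This uses the Leibniz and chain rules for 1-forms,
   which follow from the convergence of discrete energies because both rules hold
   for increments up to terms that are cubic in the increments.

   For x in V_m \ V_0 the identity defining M^a f is tested against the function
   g that, on each m-cell at x, is E_w^-1 times the function affine in x1 with
   value 1 at x and 0 at the other end y, and that vanishes on the other cells.
   By the gauge identity the cells contribute exactly f(x) - f(y) exp(i a_m(e_xy))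
   to E^{a_m}(f, g), and 4^m times their contribution to E^a(f, g) differs from
   that by O(4^m ||(a - a_m) 1_w||), which tends to 0 uniformly.  On the other
   side, the affine function has mean 1/2 over a cell of mass 2 / 4^m, u is
   uniformly continuous, and c_w 2^-m tends to 0 uniformly; hence
   4^m <u, g> / deg_m(x) - u(x) tends to 0 uniformly. *)
Require Import Defs.
From HB Require Import structures.
From mathcomp Require Import all_boot all_order all_algebra.
From mathcomp Require Import all_classical all_reals all_analysis.
From mathcomp Require Import finmap ring lra measurable_realfun.
Import Order.TTheory GRing.Theory Num.Theory.
Import numFieldNormedType.Exports.
Local Open Scope classical_set_scope.
Local Open Scope ring_scope.
Local Open Scope complex_scope.
Set Implicit Arguments.
Unset Strict Implicit.
Unset Printing Implicit Defensive.

(** The data fix a 1-form only through its inner products, and an energy measure only through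
    integrals of continuous functions of finite energy. Identities between 1-forms are therefore
    proved by testing, and the tests reduce to sums of increments over edges, in which an integrand
    enters as the average of its values at the two ends of an edge. The obstacle is the cell
    indicator, which is not continuous. Cutting at a cell needs energy measures without atoms at the
    vertices. This is drawn from the first coordinate, on which every map has slope 1/2: at fine
    levels the increments are close to those of harmonic interpolation, and few edges meet a thin
    vertical strip. The bound [s <= 1/8] confines X to a region with two pointed ends; this is why
    cells of one level meet only in end points. The decay of c_w 2^-m is obtained from two scales: a
    - a_n is small on n-cells for one fixed large n, while a_n has finitely many coefficients and
    contributes O(2^-m) on an m-cell. *)

Local Notation Re := complex.Re.
Local Notation Im := complex.Im.
Local Notation ii := (0 +i* 1).

(** * Norms and limits in R[i] *)

Section ComplexNorm.
Context {R : realType}.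
Implicit Types (z u v : R[i]) (r : R).

Lemma complexP z v : Re z = Re v -> Im z = Im v -> z = v.
Proof. by case: z v => [a b] [c d] /= -> ->. Qed.

Lemma ReD z v : Re (z + v) = Re z + Re v. Proof. by case: z v => [? ?] []. Qed.
Lemma ImD z v : Im (z + v) = Im z + Im v. Proof. by case: z v => [? ?] []. Qed.
Lemma ReN z : Re (- z) = - Re z. Proof. by case: z. Qed.
Lemma ImN z : Im (- z) = - Im z. Proof. by case: z. Qed.
Lemma ReM z v : Re (z * v) = Re z * Re v - Im z * Im v.
Proof. by case: z v => [? ?] []. Qed.
Lemma ImM z v : Im (z * v) = Re z * Im v + Im z * Re v.
Proof. by case: z v => [? ?] []. Qed.
Lemma ReJ z : Re (conjc z) = Re z. Proof. by case: z. Qed.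
Lemma ImJ z : Im (conjc z) = - Im z. Proof. by case: z. Qed.

Definition complex_simp := (ReD, ImD, ReN, ImN, ReM, ImM, ReJ, ImJ).

Lemma Re_sum (I : Type) (s : seq I) (P : pred I) (F : I -> R[i]) :
  Re (\sum_(i <- s | P i) F i) = \sum_(i <- s | P i) Re (F i).
Proof. by elim/big_rec2: _ => // i x y _ <-; rewrite ReD. Qed.

Lemma rnormE (V : normedZmodType R[i]) (v : V) : `|v| = (rnorm v)%:C.
Proof. by have := normr_ge0 v; rewrite /rnorm; case: `|v| => a b /= /andP[/eqP-> _]. Qed.

Lemma rnorm_ge0 (V : normedZmodType R[i]) (v : V) : 0 <= rnorm v.
Proof. by rewrite -ler0c -rnormE. Qed.

Lemma rnormD (V : normedZmodType R[i]) (v w : V) : rnorm (v + w) <= rnorm v + rnorm w.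
Proof. by rewrite -lecR rmorphD /= -!rnormE ler_normD. Qed.

Lemma rnormN (V : normedZmodType R[i]) (v : V) : rnorm (- v) = rnorm v.
Proof. by rewrite /rnorm normrN. Qed.

Lemma rnorm0 (V : normedZmodType R[i]) : rnorm (0 : V) = 0.
Proof. by rewrite /rnorm normr0. Qed.

Lemma rnorm0_eq0 (V : normedZmodType R[i]) (v : V) : rnorm v = 0 -> v = 0.
Proof. by move=> v0; apply/eqP; rewrite -normr_eq0 rnormE v0. Qed.

Lemma rdistC (V : normedZmodType R[i]) (v w : V) : rnorm (v - w) = rnorm (w - v).
Proof. by rewrite /rnorm distrC. Qed.

Lemma rnormB (V : normedZmodType R[i]) (v w : V) : rnorm (v - w) <= rnorm v + rnorm w.
Proof. by rewrite (le_trans (rnormD _ _))// rnormN. Qed.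

Lemma rnorm_sum (V : normedZmodType R[i]) (I : Type) (s : seq I) (P : pred I) (F : I -> V) :
  rnorm (\sum_(i <- s | P i) F i) <= \sum_(i <- s | P i) rnorm (F i).
Proof.
elim/big_rec2: _ => [|i x y _ h]; first by rewrite rnorm0.
by rewrite (le_trans (rnormD _ _))// lerD.
Qed.

Lemma rnormZ (V : normedModType R[i]) (c : R[i]) (v : V) :
  rnorm (c *: v) = rnorm c * rnorm v.
Proof. by apply: complexI; rewrite rmorphM /= -!rnormE normrZ. Qed.

Lemma rnormM z v : rnorm (z * v) = rnorm z * rnorm v.
Proof. by apply: complexI; rewrite rmorphM /= -!rnormE normrM. Qed.

Lemma rnormV z : rnorm z^-1 = (rnorm z)^-1.
Proof. by apply: complexI; rewrite -rnormE normfV rnormE -fmorphV. Qed.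

Lemma rnormJ z : rnorm (conjc z) = rnorm z.
Proof. by rewrite /rnorm normcJ. Qed.

Lemma rnorm_sqr z : rnorm z ^+ 2 = Re z ^+ 2 + Im z ^+ 2.
Proof.
by rewrite /rnorm normc_def /= sqr_sqrtr// addr_ge0// sqr_ge0.
Qed.

Lemma rnorm_sqrE z : (rnorm z ^+ 2)%:C = z * conjc z.
Proof. by rewrite rmorphXn /= -rnormE sqr_normc. Qed.

Lemma rnorm_real r : rnorm r%:C = `|r|.
Proof. by rewrite /rnorm normc_def /= expr0n addr0 sqrtr_sqr. Qed.

Lemma rnorm_nat n : rnorm (n%:R : R[i]) = n%:R.
Proof. by rewrite -(rmorph_nat (real_complex R)) rnorm_real ger0_norm. Qed.

Lemma normRe_le z : `|Re z| <= rnorm z.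
Proof.
rewrite -[_ <= _]ler_sqr ?nnegrE ?rnorm_ge0//.
by rewrite rnorm_sqr -normrX ger0_norm ?sqr_ge0// lerDl sqr_ge0.
Qed.

Lemma normIm_le z : `|Im z| <= rnorm z.
Proof.
rewrite -[_ <= _]ler_sqr ?nnegrE ?rnorm_ge0//.
by rewrite rnorm_sqr -normrX ger0_norm ?sqr_ge0// lerDr sqr_ge0.
Qed.

Lemma rnorm_le_ReIm z : rnorm z <= `|Re z| + `|Im z|.
Proof.
have -> : z = (Re z)%:C + ii * (Im z)%:C by apply: complexP; rewrite !complex_simp /=; ring.
rewrite !complex_simp /=; rewrite (le_trans (rnormD _ _))// rnormM !rnorm_real.
have -> : rnorm (ii : R[i]) = 1 by rewrite /rnorm normc_def /= expr0n add0r expr1n sqrtr1.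
by rewrite !(mul0r, mul1r, mulr0, oppr0, subr0, addr0, add0r).
Qed.

Lemma rnorm_ii : rnorm (ii : R[i]) = 1.
Proof. by rewrite /rnorm normc_def /= expr0n add0r expr1n sqrtr1. Qed.

Lemma le_rnormD_sqr z v : rnorm (z + v) ^+ 2 <= 2 * rnorm z ^+ 2 + 2 * rnorm v ^+ 2.
Proof.
rewrite !rnorm_sqr !complex_simp.
have := sqr_ge0 (Re z - Re v); have := sqr_ge0 (Im z - Im v); lra.
Qed.

End ComplexNorm.

Section ComplexLimits.
Context {R : realType}.
Implicit Types (u v : nat -> R[i]) (l : R[i]).

(** Convergence is componentwise, so that limit theorems over [R] and uniqueness of real limits
    apply directly. *)
Definition ccvg u l : Prop :=
  (Re (u n) @[n --> \oo] --> Re l) /\ (Im (u n) @[n --> \oo] --> Im l).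

Lemma ccvg_unique u l l' : ccvg u l -> ccvg u l' -> l = l'.
Proof.
move=> [a b] [c d]; apply: complexP.
  by rewrite -(cvg_lim _ a) -?(cvg_lim _ c).
by rewrite -(cvg_lim _ b) -?(cvg_lim _ d).
Qed.

Lemma ccvg_cst l : ccvg (fun=> l) l.
Proof. by split; exact: cvg_cst. Qed.

Lemma ccvgD u v l l' : ccvg u l -> ccvg v l' -> ccvg (fun n => u n + v n) (l + l').
Proof.
move=> [a b] [c d]; split.
  by rewrite ReD; under eq_fun do rewrite ReD; exact: cvgD.
by rewrite ImD; under eq_fun do rewrite ImD; exact: cvgD.
Qed.

Lemma ccvgM u v l l' : ccvg u l -> ccvg v l' -> ccvg (fun n => u n * v n) (l * l').
Proof.
move=> [a b] [c d]; split.
  rewrite ReM; under eq_fun do rewrite ReM.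
  by apply: cvgB; exact: cvgM.
rewrite ImM; under eq_fun do rewrite ImM.
by apply: cvgD; exact: cvgM.
Qed.

Lemma ccvgMl k u l : ccvg u l -> ccvg (fun n => k * u n) (k * l).
Proof. by move=> ul; apply: ccvgM => //; exact: ccvg_cst. Qed.

Lemma ccvg_sum (I : Type) (s : seq I) (P : pred I) (U : I -> nat -> R[i]) (L : I -> R[i]) :
  (forall i, P i -> ccvg (U i) (L i)) ->
  ccvg (fun n => \sum_(i <- s | P i) U i n) (\sum_(i <- s | P i) L i).
Proof.
move=> UL; elim: s => [|i s ih].
  by rewrite big_nil; under [X in ccvg X]eq_fun do rewrite big_nil; exact: ccvg_cst.
rewrite big_cons; under [X in ccvg X]eq_fun do rewrite big_cons.
by case: ifPn => // Pi; apply: ccvgD => //; exact: UL.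
Qed.

Lemma ccvg_real (u : nat -> R) (l : R) : u @ \oo --> l -> ccvg (fun n => (u n)%:C) l%:C.
Proof. by move=> ul; split => //=; exact: cvg_cst. Qed.

Lemma ccvg_squeeze u v l (e : nat -> R) :
  ccvg u l -> (\forall n \near \oo, rnorm (v n - u n) <= e n) -> e @ \oo --> (0 : R) ->
  ccvg v l.
Proof.
move=> [ul1 ul2] uv e0.
have key (f : R[i] -> R) : (forall z, `|f z| <= rnorm z) -> (forall z w, f (z - w) = f z - f w) ->
    f (u n) @[n --> \oo] --> f l -> f (v n) @[n --> \oo] --> f l.
  move=> fle fB ul.
  have : (f (v n) - f (u n)) @[n --> \oo] --> (0 : R).
    apply/norm_cvg0P; apply: (squeeze_cvgr _ (cvg_cst 0) e0).
    by near=> n; rewrite normr_ge0/= -fB (le_trans (fle _))//; near: n.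
  move=> /cvgD /(_ ul); rewrite add0r; apply: cvg_trans; apply: near_eq_cvg.
  by near=> n; rewrite /= subrK.
split; [apply: (key (@complex.Re R))|apply: (key (@complex.Im R))] => // [z|z w|z|z w]; rewrite ?normRe_le ?normIm_le//.
- by rewrite ReD ReN.
- by rewrite ImD ImN.
Unshelve. all: by end_near. Qed.

End ComplexLimits.

(** * Sums over subdivided words *)

Section DyadicLimits.
Context {R : realType}.

Lemma half_expn_cvg0 (M : R) : (M * 2^-1 ^+ n) @[n --> \oo] --> 0.
Proof.
have h : `|2^-1 : R| < 1 by rewrite ger0_norm ?invr_ge0// invf_lt1 ?ltr1n.
exact: (cvg_geometric M h).
Qed.

Lemma half_expn_small (M e : R) : 0 < e -> exists n, M * 2^-1 ^+ n < e.
Proof.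
move=> e0; have := half_expn_cvg0 M => /cvgr0Pnorm_lt /(_ e e0) [N _ /(_ N (leqnn N)) h].
by exists N; rewrite (le_lt_trans (ler_norm _) h).
Qed.

Lemma ler_half_expn (x y M : R) : (forall n, x <= y + M * 2^-1 ^+ n) -> x <= y.
Proof.
move=> h; apply/ler_addgt0Pr => e /(half_expn_small M)[n hn].
by rewrite (le_trans (h n))// lerD2l ltW.
Qed.

End DyadicLimits.

Section WordSums.
Variable V : nmodType.
Implicit Types (G : seq 'I_4 -> V) (w : seq 'I_4).

(** Letters are appended on the right, so the sum runs over the subcells of level [size w + n]
    inside the cell of [w]; refinement ([wsumD]) and telescoping ([wsum_incr]) become short
    inductions. *)
Fixpoint wsum n G w : V :=
  if n is n'.+1 then \sum_(j < 4) wsum n' G (rcons w j) else G w.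

Lemma wsumD n k G w : wsum (n + k) G w = wsum n (wsum k G) w.
Proof. by elim: n w => [//|n ih] w; rewrite addSn /=; apply: eq_bigr => j _; exact: ih. Qed.

Lemma eq_wsum_pre n G G' w :
  (forall v, size v = n -> G (w ++ v) = G' (w ++ v)) -> wsum n G w = wsum n G' w.
Proof.
elim: n w => [|n ih] w h /=; first by have := h [::] erefl; rewrite cats0.
by apply: eq_bigr => j _; apply: ih => v sv; rewrite cat_rcons; apply: h; rewrite /= sv.
Qed.

Lemma eq_wsum n G G' w : G =1 G' -> wsum n G w = wsum n G' w.
Proof. by move=> h; apply: eq_wsum_pre. Qed.

Lemma wsum_add n G G' w : wsum n (fun v => G v + G' v) w = wsum n G w + wsum n G' w.
Proof. by elim: n w => [//|n ih] w /=; rewrite -big_split; apply: eq_bigr => j _; exact: ih. Qed.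

Lemma wsum_sum (I : Type) (r : seq I) (P : pred I) n (G : I -> seq 'I_4 -> V) w :
  wsum n (fun v => \sum_(i <- r | P i) G i v) w = \sum_(i <- r | P i) wsum n (G i) w.
Proof.
elim: n w => [//|n ih] w /=; under eq_bigr do rewrite ih.
by rewrite exchange_big.
Qed.

Lemma wsum_tuple m G w : wsum m G w = \sum_(v : m.-tuple 'I_4) G (w ++ v).
Proof.
elim: m w => [|m ih] w /=.
  rewrite (big_pred1 [tuple]) ?cats0// => v; exact/esym/eqP/tuple0.
under eq_bigr do rewrite ih.
rewrite pair_big /= (reindex (fun v : m.+1.-tuple 'I_4 => (thead v, behead_tuple v))) /=.
  by apply: eq_bigr => v _; rewrite cat_rcons; case: (tupleP v) => x t /=; rewrite theadE.
exists (fun p => cons_tuple p.1 p.2) => [v|[j v]] _ /=.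
  by rewrite [RHS]tuple_eta; apply: val_inj.
by rewrite theadE; congr pair; apply: val_inj.
Qed.

Lemma wsum_nil m G : wsum m G [::] = \sum_(v : m.-tuple 'I_4) G v.
Proof. exact: wsum_tuple. Qed.

Lemma wsum_cst n c w : wsum n (fun=> c) w = c *+ (4 ^ n).
Proof. by rewrite wsum_tuple sumr_const card_tuple card_ord. Qed.

Lemma wsum0 n w : wsum n (fun=> 0) w = 0.
Proof. by rewrite wsum_cst mul0rn. Qed.

End WordSums.

Lemma wsum_morph (V V' : nmodType) (f : V -> V') n (G : seq 'I_4 -> V) w : {morph f : x y / x + y} -> f 0 = 0 ->
  f (wsum n G w) = wsum n (fun v => f (G v)) w.
Proof. by move=> fD f0; rewrite !wsum_tuple (big_morph f fD f0). Qed.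

Section WordSumsRing.
Variable A : pzRingType.
Implicit Types (G : seq 'I_4 -> A) (w : seq 'I_4).

Lemma wsum_mull n (c : A) G w : wsum n (fun v => c * G v) w = c * wsum n G w.
Proof. by rewrite !wsum_tuple mulr_sumr. Qed.

Lemma wsum_mulr n (c : A) G w : wsum n (fun v => G v * c) w = wsum n G w * c.
Proof. by rewrite !wsum_tuple mulr_suml. Qed.

Lemma wsumN n G w : wsum n (fun v => - G v) w = - wsum n G w.
Proof. by rewrite !wsum_tuple sumrN. Qed.

Lemma wsumB n G G' w : wsum n (fun v => G v - G' v) w = wsum n G w - wsum n G' w.
Proof. by rewrite wsum_add wsumN. Qed.

End WordSumsRing.

Section WordSumsOrder.
Context {R : realType}.
Implicit Types (G : seq 'I_4 -> R) (w : seq 'I_4).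

Lemma le_wsum_pre n G G' w :
  (forall v, size v = n -> G (w ++ v) <= G' (w ++ v)) -> wsum n G w <= wsum n G' w.
Proof. by move=> h; rewrite !wsum_tuple; apply: ler_sum => v _; rewrite h// size_tuple. Qed.

Lemma le_wsum n G G' w : (forall v, G v <= G' v) -> wsum n G w <= wsum n G' w.
Proof. by move=> h; exact: le_wsum_pre. Qed.

Lemma wsum_ge0 n G w : (forall v, 0 <= G v) -> 0 <= wsum n G w.
Proof. by move=> h; rewrite wsum_tuple; apply: sumr_ge0. Qed.

Lemma wsum_le_total m n G w : size w = m -> (forall v, 0 <= G v) ->
  wsum n G w <= wsum (m + n) G [::].
Proof.
move=> <- G0; rewrite wsumD wsum_nil (bigD1 (in_tuple w))//= lerDl.
by apply: sumr_ge0 => i _; exact: wsum_ge0.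
Qed.

Lemma rnorm_wsum (V : normedZmodType R[i]) n (G : seq 'I_4 -> V) w :
  rnorm (wsum n G w) <= wsum n (fun v => rnorm (G v)) w.
Proof. by rewrite !wsum_tuple; exact: rnorm_sum. Qed.

Lemma wsum_scale_real n G w : (wsum n G w)%:C = wsum n (fun v => (G v)%:C) w.
Proof. by apply: wsum_morph => // x y; rewrite rmorphD. Qed.

End WordSumsOrder.

(** * Geometry of the cells *)

Section DiamondMaps.
Context {R : realType}.
Variable s : R.
Implicit Types (j : 'I_4) (x z : R * R) (w v : seq 'I_4).

(** The sign of the cosine (for [vsign], of the sine) of the translation angle: right or left half,
    upper or lower half. The factor (-1)^k of the map is minus the product of the two signs. *)
Definition hsign j : R := if (j == ord0) || (j == ord_max) then 1 else -1.
Definition vsign j : R := if (j < 2)%N then 1 else -1.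

Lemma hsign_cases j : hsign j = 1 \/ hsign j = -1.
Proof. by rewrite /hsign; case: ifP => _; [left|right]. Qed.

Lemma vsign_cases j : vsign j = 1 \/ vsign j = -1.
Proof. by rewrite /vsign; case: ifP => _; [left|right]. Qed.

Lemma sign_inj j k : hsign j = hsign k -> vsign j = vsign k -> j = k.
Proof.
move: j k => [[|[|[|[|//]]]] ?] [[|[|[|[|//]]]] ?]; rewrite /hsign /vsign /=;
  by [move=> *; apply: val_inj | move=> *; exfalso; lra].
Qed.

Lemma cos_piquarter : cos (pi / 4 : R) / Num.sqrt 2 = 2^-1.
Proof.
have pi0 := pi_gt0 R.
have c0 : 0 < cos (pi / 4 : R) by apply: cos_gt0_pihalf; apply/andP; split; lra.
have c1 := cos2Dsin2 (pi / 4 : R).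
have sc : sin (pi / 4 : R) = cos (pi / 4).
  have := tan_piquarter R; rewrite /tan => /(congr1 (fun x : R => x * cos (pi / 4))).
  by rewrite divfK ?gt_eqF// mul1r.
have q0 : 0 < Num.sqrt (2 : R) by rewrite sqrtr_gt0.
have q2 : Num.sqrt (2 : R) ^+ 2 = 2 by rewrite sqr_sqrtr.
have -> : cos (pi / 4 : R) = (Num.sqrt 2) / 2.
  apply/eqP; rewrite -(eqrXn2 (n := 2)) ?ltW ?divr_gt0//.
  by rewrite exprMn q2; apply/eqP; move: c1; rewrite sc; lra.
by rewrite mulrAC divff ?mul1r// gt_eqF.
Qed.

Lemma sin_piquarter : sin (pi / 4 : R) / Num.sqrt 2 = 2^-1.
Proof.
rewrite -cos_piquarter; have := tan_piquarter R; rewrite /tan.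
move=> /(congr1 (fun x : R => x * cos (pi / 4))).
have pi0 := pi_gt0 R.
rewrite divfK ?mul1r => [->//|].
by rewrite gt_eqF//; apply: cos_gt0_pihalf; apply/andP; split; lra.
Qed.

Lemma diamond_mapE j x : diamond_map s j x =
  ((x.1 + hsign j) / 2, vsign j * (1 - hsign j * x.1) / 2 + 2 * s * x.2).
Proof.
have c := cos_piquarter; have d := sin_piquarter.
case: j => [[|[|[|[|//]]]] ?]; rewrite /diamond_map /hsign /vsign /=; congr pair.
- have -> : (2 * 1 - 1) * pi / 4 = pi / 4 :> R by field.
  by rewrite [X in _ + X]mulrC c; field.
- have -> : (2 * 1 - 1) * pi / 4 = pi / 4 :> R by field.
  by rewrite [X in _ + X]mulrC d; field.
- have -> : (2 * 2 - 1) * pi / 4 = pi / 4 + pi / 2 :> R by field.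
  by rewrite cosDpihalf [X in _ + X]mulrC mulNr d; field.
- have -> : (2 * 2 - 1) * pi / 4 = pi / 4 + pi / 2 :> R by field.
  by rewrite sinDpihalf [X in _ + X]mulrC c; field.
- have -> : (2 * 3 - 1) * pi / 4 = pi / 4 + pi :> R by field.
  by rewrite cosDpi [X in _ + X]mulrC mulNr c; field.
- have -> : (2 * 3 - 1) * pi / 4 = pi / 4 + pi :> R by field.
  by rewrite sinDpi [X in _ + X]mulrC mulNr d; field.
- have -> : (2 * 4 - 1) * pi / 4 = (pi / 4 + pi / 2) + pi :> R by field.
  by rewrite cosDpi cosDpihalf opprK [X in _ + X]mulrC d; field.
- have -> : (2 * 4 - 1) * pi / 4 = (pi / 4 + pi / 2) + pi :> R by field.
  by rewrite sinDpi sinDpihalf [X in _ + X]mulrC mulNr c; field.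
Qed.

Lemma word_map_cat w v x : word_map s (w ++ v) x = word_map s w (word_map s v x).
Proof. by elim: w => [//|j w ih] /=; rewrite ih. Qed.

Lemma word_map_cons j w x : word_map s (j :: w) x = diamond_map s j (word_map s w x).
Proof. by []. Qed.

Lemma word_map_rcons w j x : word_map s (rcons w j) x = word_map s w (diamond_map s j x).
Proof. by rewrite -cats1 word_map_cat. Qed.

Definition lpt w := word_map s w (-1, 0).
Definition rpt w := word_map s w (1, 0).

(** The second coordinate never enters the first one, on which each map has slope 1/2. Hence an
    exact contraction, by which cells are measured throughout. *)
Lemma word_map_fst w x z :
  (word_map s w x).1 - (word_map s w z).1 = (x.1 - z.1) * 2^-1 ^+ size w.
Proof.
elim: w => [|j w ih]; first by rewrite mulr1.
rewrite !word_map_cons !diamond_mapE /= exprS mulrCA -ih; by field.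
Qed.

Lemma rpt_sub_lpt w : (rpt w).1 - (lpt w).1 = 2 * 2^-1 ^+ size w.
Proof. by rewrite word_map_fst /=; congr (_ * _); lra. Qed.

Lemma lpt_neq_rpt w : lpt w <> rpt w.
Proof.
move=> e; have := rpt_sub_lpt w; rewrite e subrr => /esym/eqP.
by rewrite mulf_eq0 expf_eq0 invr_eq0 pnatr_eq0 !andbF.
Qed.

Section Increment.
Variable V : zmodType.
Definition incr (h : R * R -> V) w := h (lpt w) - h (rpt w).

(** The four subcells form two paths from the left to the right end of the cell, through the images
    of (0, 1) and of (0, -1), with every edge oriented from left to right. Each path telescopes to
    the full increment. *)
Lemma incr_sum h w : \sum_(j < 4) incr h (rcons w j) = incr h w *+ 2.
Proof.
rewrite /incr /lpt /rpt !big_ord_recl big_ord0 !word_map_rcons !diamond_mapE /hsign /vsign /=.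
have -> : ((-1 + 1) / 2, 1 * (1 - 1 * -1) / 2 + 2 * s * 0) = (0, 1) :> R * R
  by congr pair; field.
have -> : ((1 + 1) / 2, 1 * (1 - 1 * 1) / 2 + 2 * s * 0) = (1, 0) :> R * R
  by congr pair; field.
have -> : ((-1 - 1) / 2, 1 * (1 - -1 * -1) / 2 + 2 * s * 0) = (-1, 0) :> R * R
  by congr pair; field.
have -> : ((1 - 1) / 2, 1 * (1 - -1 * 1) / 2 + 2 * s * 0) = (0, 1) :> R * R
  by congr pair; field.
have -> : ((-1 - 1) / 2, -1 * (1 - -1 * -1) / 2 + 2 * s * 0) = (-1, 0) :> R * R
  by congr pair; field.
have -> : ((1 - 1) / 2, -1 * (1 - -1 * 1) / 2 + 2 * s * 0) = (0, -1) :> R * R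
  by congr pair; field.
have -> : ((-1 + 1) / 2, -1 * (1 - 1 * -1) / 2 + 2 * s * 0) = (0, -1) :> R * R
  by congr pair; field.
have -> : ((1 + 1) / 2, -1 * (1 - 1 * 1) / 2 + 2 * s * 0) = (1, 0) :> R * R
  by congr pair; field.
set a := h _; set b := h _; set c := h _; set d := h _.
rewrite addr0 mulr2n [X in _ = X + _](_ : _ = (a - b) + (c - a)); last first.
  by rewrite [RHS]addrC addrA subrK.
have -> : c - b = (c - d) + (d - b) by rewrite addrA subrK.
by rewrite !addrA.
Qed.

Lemma wsum_incr n h w : wsum n (incr h) w = incr h w *+ 2 ^ n.
Proof.
elim: n w => [//|n ih] w /=; under eq_bigr do rewrite ih.
by rewrite sumrMnl incr_sum -mulrnA expnS.
Qed.
End Increment.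

Definition fstf (z : R * R) : R := z.1.

Lemma incr_fst w : incr fstf w = - (2 * 2^-1 ^+ size w).
Proof. by rewrite /incr /fstf -rpt_sub_lpt opprB. Qed.

(* The region is mapped into itself because s <= 1/8. *)
Definition lens : set (R * R) := [set x | `|x.1| <= 1 /\ `|x.2| <= 1 - x.1 ^+ 2].

Hypothesis hs : 0 < s <= 8^-1.

(** Over the image of [x], the parabola lies above the tilted segment of height
    [(1 - hsign j * x.1) / 2] by exactly (1 - x1^2)/4. The bound [s <= 1/8] makes 2s(1 - x1^2) fit
    into this slack. The factor 2s on the right is kept because its iteration pushes X into
    [lens]. *)
Lemma diamond_map_excess j x : `|x.1| <= 1 ->
  `|(diamond_map s j x).2| - (1 - (diamond_map s j x).1 ^+ 2) <=
     2 * s * (`|x.2| - (1 - x.1 ^+ 2)).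
Proof.
case/andP: hs => s0 s8 x1; rewrite diamond_mapE /=.
have h : `|vsign j * (1 - hsign j * x.1) / 2 + 2 * s * x.2| <=
    (1 - hsign j * x.1) / 2 + 2 * s * `|x.2|.
  rewrite (le_trans (ler_normD _ _))// lerD//; last first.
    by rewrite normrM ger0_norm//; lra.
  move: x1; rewrite ler_norml => /andP[x1 x2].
  by rewrite ler_norml; case: (vsign_cases j) (hsign_cases j) => -> [] ->; apply/andP; split; lra.
have k : (1 - 4 * (2 * s)) * (1 - x.1 ^+ 2) >= 0.
  move: x1; rewrite ler_norml => /andP[x1 x2]; rewrite mulr_ge0//; first by lra.
  nra.
by case: (hsign_cases j) h => ->; lra.
Qed.

Lemma lens_diamond_map j x : lens x -> lens (diamond_map s j x).
Proof.
move=> [x1 x2]; split.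
  rewrite diamond_mapE /=; move: x1; rewrite !ler_norml => /andP[? ?].
  by case: (hsign_cases j) => ->; apply/andP; split; lra.
have := diamond_map_excess j x1; case/andP: hs => s0 _.
rewrite lerBlDr => /le_trans; apply; nra.
Qed.

Lemma lens_word_map w x : lens x -> lens (word_map s w x).
Proof. by elim: w => [//|j w ih] /= /ih; exact: lens_diamond_map. Qed.

Lemma lens_left x : lens x -> x.1 = -1 -> x = (-1, 0).
Proof.
case: x => a b [/= _ h] e; move: h; rewrite e sqrrN expr1n subrr.
by rewrite normr_le0 => /eqP ->.
Qed.

Lemma lens_right x : lens x -> x.1 = 1 -> x = (1, 0).
Proof.
by case: x => a b [/= _ h] e; move: h; rewrite e expr1n subrr normr_le0 => /eqP ->.
Qed.

Lemma lens_l : lens (-1, 0).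
Proof. by split; rewrite /= ?normrN ?normr1 ?normr0 ?sqrrN ?expr1n ?subrr. Qed.

Lemma lens_r : lens (1, 0).
Proof. by split; rewrite /= ?normrN ?normr1 ?normr0 ?sqrrN ?expr1n ?subrr. Qed.

Lemma diamond_map_inj j : injective (diamond_map s j).
Proof.
case/andP: hs => s0 _ [a b] [c d]; rewrite !diamond_mapE /= => -[e1 e2].
have ac : a = c by lra.
move: e2; rewrite ac => /addrI /(@mulfI _ (2 * s)) -> //.
by rewrite mulf_neq0// ?gt_eqF.
Qed.

(** For two maps on the same horizontal side, the segments carrying the images are 1 - h x1 apart (h
    the common [hsign]), while the images have joint thickness at most (1 - x1^2)/2; a common point
    gives (1 - h x1)^2 <= 0. On opposite sides the first coordinates can agree only at extreme
    values. *)
Lemma diamond_map_meet j k x y : j != k -> lens x -> lens y ->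
  diamond_map s j x = diamond_map s k y -> x = (-1, 0) \/ x = (1, 0).
Proof.
case/andP: hs => s0 s8 jk lx ly; rewrite !diamond_mapE => -[e1 e2].
have [[x1 x2] [y1 y2]] := (lx, ly).
move: (x1) (y1); rewrite !ler_norml => /andP[x3 x4] /andP[y3 y4].
have [hjk|hjk] := eqVneq (hsign j) (hsign k).
  have vjk : vsign j = - vsign k.
    have : vsign j <> vsign k by move=> vjk; move/eqP: jk; apply; exact: sign_inj.
    by case: (vsign_cases j) (vsign_cases k) => -> [] -> // _; rewrite opprK.
  have xy : x.1 = y.1 by move: e1; rewrite hjk; lra.
  have x2' : `|x.2| <= 1 - x.1 ^+ 2 by [].
  have y2' : `|y.2| <= 1 - x.1 ^+ 2 by rewrite xy.
  have t0 : 0 <= 1 - hsign k * x.1 by case: (hsign_cases k) => ->; lra.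
  have : (1 - hsign k * x.1) <= 2 * s * (`|x.2| + `|y.2|).
    have := ler_norm x.2; have := ler_norm y.2.
    have := ler_norm (- x.2); have := ler_norm (- y.2); rewrite !normrN.
    move: e2; rewrite vjk hjk -xy => e2 *.
    by case: (vsign_cases k) e2 => ->; nra.
  move=> h; have h2 : (1 - hsign k * x.1) <= 2^-1 * (1 - x.1 ^+ 2).
    apply: (le_trans h); have p0 := normr_ge0 x.2; have q0 := normr_ge0 y.2.
    have : 2 * s * (`|x.2| + `|y.2|) <= 4^-1 * (`|x.2| + `|y.2|).
      by rewrite ler_wpM2r// ?addr_ge0//; lra.
    lra.
  case: (hsign_cases k) h2 => -> h2.
    right; apply: lens_right => //.
    have : (1 - x.1) ^+ 2 <= 0 by lra.
    by rewrite real_exprn_even_le0//= ?num_real// => /eqP; lra.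
  left; apply: lens_left => //.
  have : (1 + x.1) ^+ 2 <= 0 by lra.
  by rewrite real_exprn_even_le0//= ?num_real// => /eqP; lra.
have {}hjk : hsign k = - hsign j.
  by case: (hsign_cases j) (hsign_cases k) hjk => -> [] -> //; rewrite ?eqxx// opprK.
case: (hsign_cases j) hjk e1 => -> -> e1.
  by left; apply: lens_left => //; lra.
by right; apply: lens_right => //; lra.
Qed.

(** A first coordinate that is extreme after a map was extreme before it; the pointed ends of [lens]
    then determine the second coordinate. *)
Lemma word_map_end w x : lens x -> word_map s w x = (-1, 0) \/ word_map s w x = (1, 0) ->
  x = (-1, 0) \/ x = (1, 0).
Proof.
elim: w => [//|j w ih] lx /= e; apply: ih => //.
have ly := lens_word_map w lx; have [ly1 _] := ly; move: ly1; rewrite ler_norml => /andP[? ?].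
case: e; rewrite diamond_mapE => -[e _].
  by left; apply: lens_left => //; case: (hsign_cases j) e => ->; lra.
by right; apply: lens_right => //; case: (hsign_cases j) e => ->; lra.
Qed.

(** A common prefix is removed by injectivity. At the first differing letter [diamond_map_meet]
    applies, and [word_map_end] carries the end point back through the remaining letters. *)
Lemma word_map_meet w v x y : size w = size v -> w != v -> lens x -> lens y ->
  word_map s w x = word_map s v y -> x = (-1, 0) \/ x = (1, 0).
Proof.
elim: w v => [|j w ih] [|k v]//= [] wv jk lx ly e.
have [jk'|jk'] := eqVneq j k.
  subst k; apply: (ih v) => //; first by move: jk; rewrite eqseq_cons eqxx.
  exact: diamond_map_inj e.
by apply: (@word_map_end w) => //; apply: (diamond_map_meet jk' _ _ e); exact: lens_word_map.
Qed.

Lemma lens_endpoints w : lens (lpt w) /\ lens (rpt w).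
Proof. by split; apply: lens_word_map; [exact: lens_l|exact: lens_r]. Qed.

(** If the first letters differed, the end points left after removing them would have to be (-1, 0)
    and (1, 0) for both words, and comparing the images of these two points recovers both signs.
    This makes the word of an edge unique. *)
Lemma endpoints_inj w v : size w = size v -> lpt w = lpt v -> rpt w = rpt v -> w = v.
Proof.
elim: w v => [|j w ih] [|k v]//= [] wv; rewrite /lpt /rpt /= => e1 e2.
have [jk|jk] := eqVneq j k.
  subst k; congr cons; apply: ih => //; apply: diamond_map_inj; [exact: e1|exact: e2].
have [lw rw] := lens_endpoints w; have [lv rv] := lens_endpoints v.
have a := diamond_map_meet jk lw lv e1.
have b := diamond_map_meet jk rw rv e2.
have jk' : k != j by rewrite eq_sym.
have c := diamond_map_meet jk' lv lw (esym e1).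
have d := diamond_map_meet jk' rv rw (esym e2).
have q1 := rpt_sub_lpt w; have q2 := rpt_sub_lpt v.
have p1 : 0 < (2^-1 : R) ^+ size w by rewrite exprn_gt0.
have p2 : 0 < (2^-1 : R) ^+ size v by rewrite exprn_gt0.
have {a b} [lw' rw'] : lpt w = (-1, 0) /\ rpt w = (1, 0).
  case: a b q1 => -> [] -> /= q1; by [split | exfalso; clear -q1 p1; lra].
have {c d} [lv' rv'] : lpt v = (-1, 0) /\ rpt v = (1, 0).
  case: c d q2 => -> [] -> /= q2; by [split | exfalso; clear -q2 p2; lra].
move: e1 e2; rewrite -/(lpt _) -/(lpt v) -/(rpt _) -/(rpt v) lw' lv' rw' rv' !diamond_mapE /=.
move=> [e1 e1'] [e2 e2']; exfalso; move/eqP: jk; apply; apply: sign_inj; first by clear -e1; lra.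
have hjk : hsign j = hsign k by clear -e1; lra.
by move: e1' e2'; rewrite hjk; case: (hsign_cases k) => ->; clear; lra.
Qed.

(** A map leaves a second difference of at most half the first plus a quarter of the second. As 2/2
    + 4/4 = 4/2, bounds in the ratio 2 to 4 are both halved at each letter. *)
Lemma word_map_close w x y (r : R) : `|x.1 - y.1| <= 2 * r -> `|x.2 - y.2| <= 4 * r ->
  `|(word_map s w x).1 - (word_map s w y).1| <= 2 * r * 2^-1 ^+ size w /\
  `|(word_map s w x).2 - (word_map s w y).2| <= 4 * r * 2^-1 ^+ size w.
Proof.
case/andP: hs => s0 s8 h1 h2; elim: w => [|j w [ih1 ih2]]; first by rewrite !mulr1.
set p := word_map s w x in ih1 ih2 *; set q := word_map s w y in ih1 ih2 *.
rewrite !word_map_cons -/p -/q !diamond_mapE [size _]/= exprS; set e := 2^-1 ^+ _ in ih1 ih2 *.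
split.
  have -> : (p.1 + hsign j) / 2 - (q.1 + hsign j) / 2 = (p.1 - q.1) / 2 by field.
  by rewrite normrM [ `|2^-1|]ger0_norm//; lra.
set d := (X in `|X| <= _).
have -> : d = - (vsign j * hsign j) / 2 * (p.1 - q.1) + 2 * s * (p.2 - q.2).
  by rewrite /d /=; field.
rewrite (le_trans (ler_normD _ _))// !normrM normrN !normrM.
have -> : `|vsign j| = 1 by case: (vsign_cases j) => ->; rewrite ?normrN normr1.
have -> : `|hsign j| = 1 by case: (hsign_cases j) => ->; rewrite ?normrN normr1.
rewrite [ `|2^-1|]ger0_norm// [ `|2|]ger0_norm// (gtr0_norm s0).
have : 2 * s * `|p.2 - q.2| <= 4^-1 * `|p.2 - q.2| by rewrite ler_wpM2r//; lra.
lra.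
Qed.

Lemma lens_word_map_close w x y : lens x -> lens y ->
  `|(word_map s w x).1 - (word_map s w y).1| <= 4 * 2^-1 ^+ size w /\
  `|(word_map s w x).2 - (word_map s w y).2| <= 4 * 2^-1 ^+ size w.
Proof.
move=> [x1 x2] [y1 y2].
have e0 : 0 <= (2^-1 : R) ^+ size w by rewrite exprn_ge0.
have [||a b] := @word_map_close w x y 1.
- by rewrite (le_trans (ler_normB _ _))//; lra.
- rewrite (le_trans (ler_normB _ _))//; have := sqr_ge0 x.1; have := sqr_ge0 y.1; lra.
- by split; lra.
Qed.

End DiamondMaps.

(** * Compact subsets of the plane and continuity on them *)

Section CompactPlane.
Context {R : realType}.
Variable X : set (R * R).
Hypothesis cX : compact X.
Implicit Types (f g h : cfun R) (x y z : R * R) (d e M : R).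

Definition close d x y := `|x.1 - y.1| < d /\ `|x.2 - y.2| < d.

Lemma close_trans d e x y z : close d x y -> close e y z -> close (d + e) x z.
Proof.
move=> [a1 a2] [b1 b2]; split.
  by rewrite -(subrKA y.1) (le_lt_trans (ler_normD _ _))// ltrD.
by rewrite -(subrKA y.2) (le_lt_trans (ler_normD _ _))// ltrD.
Qed.

Lemma close_le d e x y : d <= e -> close d x y -> close e x y.
Proof. by move=> de [a b]; split; exact: lt_le_trans de. Qed.

Lemma nbhs_closeP x (P : set (R * R)) :
  nbhs x P <-> exists2 d : R, 0 < d & forall y, close d x y -> P y.
Proof.
split; first by move=> /nbhs_ballP[d d0 h]; exists d => // y [a b]; apply: h; split.
by move=> [d d0 h]; apply/nbhs_ballP; exists d => // y [a b]; apply: h; split.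
Qed.

Lemma compact_approx_mem x : (forall d, 0 < d -> exists2 y, X y & close d x y) -> X x.
Proof.
move=> h; have /closure_id -> := compact_closed (@norm_hausdorff _ _) cX.
move=> B /nbhs_closeP[d d0 dB]; have [y Xy xy] := h d d0.
by exists y; split => //; exact: dB.
Qed.

Lemma compact_bounded_above (phi : R * R -> R) :
  (forall x, X x -> exists d M, 0 < d /\ forall y, X y -> close d x y -> phi y <= M) ->
  exists2 M : R, 0 <= M & forall y, X y -> phi y <= M.
Proof.
move=> h.
have [] := (compact_near_coveringP X).1 cX nat \oo (fun n y => X y -> phi y <= n%:R) _ _.
  move=> x /h[d [M [d0 hM]]].
  exists ([set y | close d x y], [set n | M <= n%:R]); last first.
    by move=> [y n] /= [xy Mn] Xy; rewrite (le_trans (hM _ _ _)).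
  split; first by apply/nbhs_closeP; exists d.
  exists (Num.truncn M).+1 => // n /= nM; rewrite (le_trans (ltW (truncnS_gt _)))//.
  by rewrite ler_nat.
by move=> N _ /(_ N (leqnn N)) hN; exists N%:R => // y Xy; exact: hN.
Qed.

Lemma continuous_onP f : continuous_on X f <->
  (forall x, X x -> forall e, 0 < e -> exists2 d : R, 0 < d &
     forall y, X y -> close d x y -> rnorm (f y - f x) < e).
Proof.
rewrite /continuous_on; split.
  move=> /subspace_continuousP h x Xx e e0.
  have /cvgrPdist_lt/(_ e%:C) := h x Xx.
  rewrite ltcR => /(_ e0) /nbhs_closeP[d d0 hd].
  exists d => // y Xy xy; have := hd y xy Xy.
  by rewrite rnormE ltcR rdistC.
move=> h; apply/subspace_continuousP => x Xx; apply/cvgrPdist_lt => -[e1 e2] /=.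
rewrite ltcE /= => /andP[/eqP -> e0].
apply/nbhs_closeP; have [d d0 hd] := h x Xx _ e0.
exists d => // y xy Xy; rewrite rnormE (_ : e1 +i* 0 = e1%:C)// ltcR rdistC; exact: hd.
Qed.

Lemma uniformly_continuous f : continuous_on X f -> forall e, 0 < e ->
  exists2 d : R, 0 < d & forall x y, X x -> X y -> close d x y -> rnorm (f y - f x) < e.
Proof.
move=> /continuous_onP h e e0.
have [] := (compact_near_coveringP X).1 cX nat \oo
  (fun n x => X x -> forall y, X y -> close (2^-1 ^+ n) x y -> rnorm (f y - f x) < e) _ _.
  move=> x /h /(_ (e / 2) ltac:(by rewrite divr_gt0))[d d0 hd].
  have [N hN] := half_expn_small 1 (ltac:(by rewrite divr_gt0) : 0 < d / 2).
  exists ([set y | close (d / 2) x y], [set n | (N <= n)%N]); last first.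
    move=> [y n] /= [xy Nn] Xy z Xz yz.
    have yz' : close (d / 2) y z.
      apply: close_le yz; apply: ltW; apply: le_lt_trans hN; rewrite mul1r.
      by rewrite ler_wiXn2l// invf_le1// ler1n.
    have xz : close d x z by rewrite (splitr d); exact: close_trans xy yz'.
    have xy' : close d x y by apply: close_le xy; lra.
    have := hd _ Xz xz; have := hd _ Xy xy'; rewrite rdistC.
    have := rnormD (f z - f x) (f x - f y); rewrite addrA subrK; lra.
  split; first by apply/nbhs_closeP; exists (d / 2) => //; rewrite divr_gt0.
  by exists N.
move=> N _ /(_ N (leqnn N)) hN; exists (2^-1 ^+ N); first by rewrite exprn_gt0.
by move=> x y Xx Xy xy; exact: hN.
Qed.

Lemma continuous_on_bounded f : continuous_on X f ->
  exists2 M : R, 0 <= M & forall x, X x -> rnorm (f x) <= M.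
Proof.
move=> /continuous_onP h; apply: compact_bounded_above => x Xx.
have [d d0 hd] := h x Xx 1 ltr01; exists d, (1 + rnorm (f x)); split => // y Xy xy.
rewrite -(subrK (f x) (f y)) (le_trans (rnormD _ _))// lerD2r ltW//; exact: hd.
Qed.

Lemma continuous_on_lipschitz2 (phi : R[i] -> R[i] -> R[i]) f g :
  (forall M, 0 <= M -> exists2 L : R, 0 <= L & forall a b c d : R[i], rnorm a <= M -> rnorm b <= M ->
     rnorm c <= M -> rnorm d <= M ->
     rnorm (phi a b - phi c d) <= L * (rnorm (a - c) + rnorm (b - d))) ->
  continuous_on X f -> continuous_on X g -> continuous_on X (fun x => phi (f x) (g x)).
Proof.
move=> hphi cf cg.
have [M1 M10 hM1] := continuous_on_bounded cf.
have [M2 M20 hM2] := continuous_on_bounded cg.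
have [|L L0 hL] := hphi (M1 + M2); first by rewrite addr_ge0.
move: cf cg => /continuous_onP cf /continuous_onP cg.
apply/continuous_onP => x Xx e e0.
have L1 : 0 < L + 1 by rewrite ltr_wpDl.
have e1 : 0 < e / (L + 1) / 2 by rewrite !divr_gt0.
have [d1 d10 h1] := cf x Xx _ e1; have [d2 d20 h2] := cg x Xx _ e1.
exists (Num.min d1 d2); first by rewrite lt_min d10.
move=> y Xy xy.
have m1 : Num.min d1 d2 <= d1 by rewrite ge_min lexx.
have m2 : Num.min d1 d2 <= d2 by rewrite ge_min lexx orbT.
have a1 := h1 y Xy (close_le (m1 : _ <= d1) xy).
have a2 := h2 y Xy (close_le (m2 : _ <= d2) xy).
have Mf z : X z -> rnorm (f z) <= M1 + M2 by move=> /hM1 h; lra.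
have Mg z : X z -> rnorm (g z) <= M1 + M2 by move=> /hM2 h; lra.
rewrite (le_lt_trans (hL _ _ _ _ _ _ _ _)) ?Mf ?Mg//.
have k : rnorm (f y - f x) + rnorm (g y - g x) < e / (L + 1) by lra.
have -> : e = (L + 1) * (e / (L + 1)) by rewrite mulrCA divff ?mulr1// gt_eqF.
apply: (@le_lt_trans _ _ ((L + 1) * (rnorm (f y - f x) + rnorm (g y - g x)))).
  by rewrite ler_wpM2r ?addr_ge0 ?rnorm_ge0//; lra.
by rewrite ltr_pM2l.
Qed.

Lemma continuous_onM f g : continuous_on X f -> continuous_on X g ->
  continuous_on X (fun x => f x * g x).
Proof.
apply: continuous_on_lipschitz2 => M M0; exists M => // a b c d ha hb hc hd.
have -> : a * b - c * d = a * (b - d) + (a - c) * d by ring.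
rewrite (le_trans (rnormD _ _))// !rnormM.
have := ler_wpM2r (rnorm_ge0 (b - d)) ha; have := ler_wpM2l (rnorm_ge0 (a - c)) hd; lra.
Qed.

Lemma continuous_onD f g : continuous_on X f -> continuous_on X g ->
  continuous_on X (fun x => f x + g x).
Proof.
apply: continuous_on_lipschitz2 => M M0; exists 1 => // a b c d _ _ _ _.
by rewrite mul1r opprD addrACA rnormD.
Qed.

Lemma continuous_onJ f : continuous_on X f -> continuous_on X (fun x => conjc (f x)).
Proof.
move=> cf; apply: (@continuous_on_lipschitz2 (fun a _ => conjc a) f f) => // M M0.
exists 1 => // a b c d _ _ _ _.
by rewrite mul1r -rmorphB rnormJ lerDl rnorm_ge0.
Qed.

Lemma continuous_on_lipschitz (L : R) f :
  (forall x y, X x -> X y -> rnorm (f x - f y) <= L * (`|x.1 - y.1| + `|x.2 - y.2|)) ->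
  continuous_on X f.
Proof.
move=> h; apply/continuous_onP => x Xx e e0.
have L1 : 0 < `|L| + 1 by rewrite ltr_wpDl.
exists (e / (`|L| + 1) / 2); first by rewrite !divr_gt0.
move=> y Xy [a b]; rewrite (le_lt_trans (h y x Xy Xx))//.
rewrite (distrC y.1) (distrC y.2).
have -> : e = (`|L| + 1) * (e / (`|L| + 1)) by rewrite mulrCA divff ?mulr1// gt_eqF.
apply: (@le_lt_trans _ _ ((`|L| + 1) * (`|x.1 - y.1| + `|x.2 - y.2|))).
  by rewrite ler_wpM2r ?addr_ge0//; have := ler_norm L; lra.
by rewrite ltr_pM2l//; lra.
Qed.

End CompactPlane.

(** * Cells of the fractal and pasting of continuous functions *)

Section Fractal.
Context {R : realType}.
Variables (s : R) (X : set (R * R)).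
Hypotheses (hs : 0 < s <= 8^-1) (hX : is_diamond_fractal s X).
Implicit Types (f g h : cfun R) (x y z : R * R) (w v : seq 'I_4).

Let cX : compact X. Proof. by case: hX. Qed.

Lemma fractal_preimage x : X x -> exists2 j, X j.2 & x = diamond_map s j.1 j.2.
Proof. by case: hX => _ _ {1}-> [j _ [y Xy <-]]; exists (j, y). Qed.

Lemma fractal_diamond_map j x : X x -> X (diamond_map s j x).
Proof. by move=> Xx; case: hX => _ _ ->; exists j => //; exists x. Qed.

Lemma fractal_word_map w x : X x -> X (word_map s w x).
Proof. by elim: w => [//|j w ih] /ih; exact: fractal_diamond_map. Qed.

(** Every point of X has preimages of all orders in X, and compactness bounds them. Going forward,
    each map at least halves the excess over the bounds that define [lens], first for the first
    coordinate and then for the second, so the excess is at most a constant times 2^-n for all n. *)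
Lemma fractal_lens : X `<=` lens.
Proof.
have [M1 M10 hM1] : exists2 M : R, 0 <= M & forall y, X y -> `|y.1| <= M.
  apply: compact_bounded_above => // x _; exists 1, (1 + `|x.1|); split => // y _ [xy _].
  by have := ler_normD (y.1 - x.1) x.1; rewrite subrK (distrC y.1); lra.
have [M2 M20 hM2] : exists2 M : R, 0 <= M & forall y, X y -> `|y.2| <= M.
  apply: compact_bounded_above => // x _; exists 1, (1 + `|x.2|); split => // y _ [_ xy].
  by have := ler_normD (y.2 - x.2) x.2; rewrite subrK (distrC y.2); lra.
have k1 n y : X y -> `|y.1| <= 1 + M1 * 2^-1 ^+ n.
  elim: n y => [|n ih] y Xy; first by have := hM1 y Xy; lra.
  have [[j x] /= Xx ->] := fractal_preimage Xy; have := ih x Xx.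
  rewrite exprS diamond_mapE /=; set e := 2^-1 ^+ n; rewrite !ler_norml => /andP[? ?].
  by case: (@hsign_cases R j) => ->; apply/andP; split; lra.
have l1 y : X y -> `|y.1| <= 1 by move=> Xy; apply: ler_half_expn => n; exact: k1.
have k2 n y : X y -> `|y.2| - (1 - y.1 ^+ 2) <= M2 * 2^-1 ^+ n.
  elim: n y => [|n ih] y Xy.
    have := hM2 y Xy; have := l1 y Xy; rewrite ler_norml => /andP[? ?]; nra.
  have [[j x] /= Xx ->] := fractal_preimage Xy; have := ih x Xx.
  move=> h; apply: (le_trans (diamond_map_excess hs j (l1 x Xx))).
  case/andP: hs => s0 s8; rewrite (exprS _ n).
  have e0 : 0 <= M2 * 2^-1 ^+ n by rewrite mulr_ge0// exprn_ge0.
  apply: (@le_trans _ _ (2 * s * (M2 * 2^-1 ^+ n))).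
    by rewrite ler_wpM2l//; lra.
  have : 2 * s * (M2 * 2^-1 ^+ n) <= 2^-1 * (M2 * 2^-1 ^+ n) by rewrite ler_wpM2r//; lra.
  lra.
move=> y Xy; split; first exact: l1.
by apply: ler_half_expn => n; rewrite -lerBlDl; exact: k2.
Qed.

(** Iterating one map carries any point of X towards the fixed point of that map, and X is closed.
    This puts the two points of V_0 into X. *)
Lemma fractal_fixpoint j p : lens p -> diamond_map s j p = p -> X p.
Proof.
move=> lp fp; apply: (compact_approx_mem cX) => d d0.
have [x Xx] : X !=set0 by case: hX.
have [n hn] := half_expn_small 4 d0.
exists (word_map s (nseq n j) x); first exact: fractal_word_map.
have -> : p = word_map s (nseq n j) p by elim: n {hn} => [//|n /= <-].
have [a b] := lens_word_map_close hs (nseq n j) lp (fractal_lens Xx).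
by rewrite size_nseq in a b; split; exact: le_lt_trans hn.
Qed.

Lemma fractal_l : X (-1, 0).
Proof.
apply: (@fractal_fixpoint (Ordinal (isT : (1 < 4)%N))); first exact: lens_l.
by rewrite diamond_mapE /hsign /vsign /=; congr pair; field.
Qed.

Lemma fractal_r : X (1, 0).
Proof.
apply: (@fractal_fixpoint ord0); first exact: lens_r.
by rewrite diamond_mapE /hsign /vsign /=; congr pair; field.
Qed.

Lemma cell_lpt w : cell s X w (lpt s w).
Proof. by exists (-1, 0) => //; exact: fractal_l. Qed.

Lemma cell_rpt w : cell s X w (rpt s w).
Proof. by exists (1, 0) => //; exact: fractal_r. Qed.

Lemma cell_sub w : cell s X w `<=` X.
Proof. by move=> _ [x Xx <-]; exact: fractal_word_map. Qed.

Lemma fractal_lpt w : X (lpt s w). Proof. exact: cell_sub (cell_lpt w). Qed.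
Lemma fractal_rpt w : X (rpt s w). Proof. exact: cell_sub (cell_rpt w). Qed.

Lemma cell_cat_sub w v : cell s X (w ++ v) `<=` cell s X w.
Proof.
by move=> _ [x Xx <-]; rewrite word_map_cat; exists (word_map s v x) => //; exact: fractal_word_map.
Qed.

Lemma cell_cover m x : X x -> exists w : m.-tuple 'I_4, cell s X w x.
Proof.
elim: m x => [|m ih] x Xx; first by exists [tuple]; exists x.
have [[j y] /= Xy ->] := fractal_preimage Xx.
by have [w [z Xz <-]] := ih y Xy; exists [tuple of j :: w]; exists z.
Qed.

Lemma cell_meet w v x : size w = size v -> w != v -> cell s X w x -> cell s X v x ->
  x = lpt s w \/ x = rpt s w.
Proof.
move=> wv nwv [y Xy <-] [z Xz e].
by case: (word_map_meet hs wv nwv (fractal_lens Xy) (fractal_lens Xz) (esym e)) => ->; [left|right].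
Qed.

Lemma cell_close w x y : cell s X w x -> cell s X w y ->
  `|x.1 - y.1| <= 2 * 2^-1 ^+ size w /\ close (5 * 2^-1 ^+ size w) x y.
Proof.
move=> [a Xa <-] [b Xb <-].
have [la lb] := (fractal_lens Xa, fractal_lens Xb).
have [h1 h2] := lens_word_map_close hs w la lb.
have e0 : 0 < (2^-1 : R) ^+ size w by rewrite exprn_gt0.
(* The constant 5 instead of 4 gives the strict inequalities in [close]. *)
split; last by split; lra.
rewrite word_map_fst normrM (gtr0_norm e0) ler_pM2r//.
by case: la => a1 _; case: lb => b1 _; rewrite (le_trans (ler_normB _ _))//; lra.
Qed.

Lemma cell_fst_range w x : cell s X w x -> (lpt s w).1 <= x.1 <= (rpt s w).1.
Proof.
move=> [y /fractal_lens [y1 _] <-].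
have e0 : 0 <= (2^-1 : R) ^+ size w by rewrite exprn_ge0.
rewrite -subr_ge0 -[X in _ && X]subr_ge0 !word_map_fst /=.
by move: y1; rewrite ler_norml => /andP[? ?]; rewrite !mulr_ge0//; lra.
Qed.

Lemma closed_cell w : closed (cell s X w).
Proof.
elim: w => [|j w ih]; rewrite /cell.
  rewrite (_ : word_map s [::] = id)// image_id; exact: compact_closed (@norm_hausdorff _ _) cX.
apply: compact_closed; first exact: norm_hausdorff.
rewrite (_ : word_map s (j :: w) @` X = diamond_map s j @` (cell s X w)); last first.
  by rewrite /cell -image_comp.
apply: continuous_compact; last first.
  apply: (subclosed_compact ih cX); exact: cell_sub.
apply/continuous_subspaceT => x.
move=> B /nbhs_closeP[d d0 hd]; apply/nbhs_closeP; exists (d / 2); first by rewrite divr_gt0.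
move=> y [a b]; apply: hd.
have [||] := @word_map_close _ _ hs [:: j] x y (d / 4); rewrite /= ?expr1; [lra|lra|].
by move=> h1 h2; split; rewrite (le_lt_trans h1, le_lt_trans h2)//; lra.
Qed.

(** There are finitely many cells and each is closed. A cell that contains [x] supplies a radius by
    continuity of its own function; any other cell stays at a positive distance from [x]. *)
Lemma cell_paste_continuous m (G : m.-tuple 'I_4 -> cfun R) g :
  (forall w : m.-tuple 'I_4, continuous_on X (G w)) ->
  (forall (w : m.-tuple 'I_4) x, cell s X w x -> g x = G w x) ->
  continuous_on X g.
Proof.
move=> cG gG; apply/continuous_onP => x Xx e e0.
have far (w : m.-tuple 'I_4) : ~ cell s X w x ->
    exists2 d : R, 0 < d & forall y, close d x y -> ~ cell s X w y.
  move=> nw; apply/nbhs_closeP; have /closed_openC : closed (cell s X w) by exact: closed_cell.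
  by rewrite openE; exact.
have /choice[D hD] : forall w : m.-tuple 'I_4, exists d : R, 0 < d /\
    forall y, X y -> cell s X w y -> close d x y -> rnorm (g y - g x) < e.
  move=> w; have [wx|/far[d d0 hd]] := pselect (cell s X w x); last first.
    by exists d; split => // y _ wy /hd /(_ wy).
  have /continuous_onP/(_ x Xx e e0)[d d0 hd] := cG w.
  by exists d; split => // y Xy wy xy; rewrite !(gG w)//; exact: hd.
exists (\big[Num.min/1]_w D w).
  by apply: lt_bigmin => // w _; case: (hD w).
move=> y Xy xy; have [w wy] := cell_cover m Xy.
apply: (hD w).2 => //; apply: close_le xy; exact: bigmin_le_cond.
Qed.

End Fractal.

(** * Graph energies *)

Section Edges.
Context {R : realType}.
Variables (s : R) (hs : 0 < s <= 8^-1).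
Implicit Types (x y : R * R) (w v : seq 'I_4).

Lemma edgeP m (w : m.-tuple 'I_4) x y : is_edge s w x y <->
  (x = lpt s w /\ y = rpt s w) \/ (x = rpt s w /\ y = lpt s w).
Proof.
have e : word_map s w @` vertices s 0 = [set lpt s w; rpt s w].
  by rewrite /= image_setU !image_set1.
rewrite /is_edge e; split; last first.
  by move=> [[-> ->]|[-> ->]] //; rewrite setUC.
move=> xy; have ne := @lpt_neq_rpt _ s w.
have a : [set lpt s w; rpt s w] x by rewrite -xy; left.
have c : [set x; y] (lpt s w) by rewrite xy; left.
have d : [set x; y] (rpt s w) by rewrite xy; right.
case: a => xw; [left|right]; split => //.
  by case: d => d //; case: ne; rewrite d.
by case: c => c //; case: ne; rewrite c.
Qed.

Definition at_word x w := (x == lpt s w) || (x == rpt s w).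
Definition other_end x w := if x == lpt s w then rpt s w else lpt s w.

Lemma at_lpt w : at_word (lpt s w) w. Proof. by rewrite /at_word eqxx. Qed.
Lemma at_rpt w : at_word (rpt s w) w. Proof. by rewrite /at_word eqxx orbT. Qed.
Lemma other_lpt w : other_end (lpt s w) w = rpt s w. Proof. by rewrite /other_end eqxx. Qed.
Lemma other_rpt w : other_end (rpt s w) w = lpt s w.
Proof. by rewrite /other_end; case: eqP => // e; case: (@lpt_neq_rpt _ s w). Qed.

Lemma adjP m x y : adj s m x y <->
  exists w : m.-tuple 'I_4, at_word x w /\ y = other_end x w.
Proof.
split=> -[w]; last first.
  move=> [/orP[] /eqP -> ->]; exists w; apply/edgeP.
    by rewrite other_lpt; left.
  by rewrite other_rpt; right.
move/edgeP => [[-> ->]|[-> ->]]; exists w.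
  by rewrite at_lpt other_lpt.
by rewrite at_rpt other_rpt.
Qed.

(** A left end has its partner strictly to the right, so two cells sharing both end points share
    them with the same orientation, and [endpoints_inj] applies. Sums over neighbours of [x] thereby
    become sums over cells at [x]. *)
Lemma other_end_inj x w v : size w = size v -> at_word x w -> at_word x v ->
  other_end x w = other_end x v -> w = v.
Proof.
move=> wv; have := rpt_sub_lpt s w; have := rpt_sub_lpt s v; rewrite wv.
have e0 : 0 < (2^-1 : R) ^+ size v by rewrite exprn_gt0.
have ne (a b c d : R * R) : a = b -> c = d -> a.1 - c.1 = 2 * 2^-1 ^+ size v ->
    d.1 - b.1 = 2 * 2^-1 ^+ size v -> False by move=> -> ->; lra.
move=> h1 h2 /orP[] /eqP xw /orP[] /eqP xv; rewrite {1}xw {1}xv ?other_lpt ?other_rpt => e.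
- by apply: (endpoints_inj hs wv) => //; rewrite -xw.
- by case: (ne _ _ _ _ e (etrans (esym xw) xv)).
- by case: (ne _ _ _ _ (etrans (esym xw) xv) e).
- by apply: (endpoints_inj hs wv) => //; rewrite -xw.
Qed.

Lemma verticesP m x : vertices s m x <-> exists w : m.-tuple 'I_4, at_word x w.
Proof.
elim: m x => [|m ih] x.
  split=> [[->|->]|[w]].
  - by exists [tuple]; exact: (at_lpt [::]).
  - by exists [tuple]; exact: (at_rpt [::]).
  - by rewrite (tuple0 w) => /orP[/eqP ->|/eqP ->]; [left|right].
split.
  move=> [j _ [y /ih[w wy] <-]]; exists [tuple of j :: w].
  by move: wy => /orP[] /eqP ->; [exact: (at_lpt (j :: w))|exact: (at_rpt (j :: w))].
move=> [w]; case: (tupleP w) => j v /orP[] /eqP ->; exists j => //.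
  by exists (lpt s v) => //; apply/ih; exists v; exact: at_lpt.
by exists (rpt s v) => //; apply/ih; exists v; exact: at_rpt.
Qed.

Lemma finite_vertices m : finite_set (vertices s m).
Proof.
elim: m => [|m ih] /=; first by rewrite finite_setU.
by apply: bigcup_finite => [|j _]; [exact: finite_finset|exact: finite_image].
Qed.

Lemma adj_image m x : [set y | adj s m x y] =
  (fun w : m.-tuple 'I_4 => other_end x w) @` [set` [pred w : m.-tuple 'I_4 | at_word x w]].
Proof.
apply/seteqP; split=> y /=.
  by move=> /adjP[w [xw ->]]; exists w.
by move=> [w xw <-]; apply/adjP; exists w.
Qed.

Lemma adj_set_inj m x : set_inj [set` [pred w : m.-tuple 'I_4 | at_word x w]]
  (fun w : m.-tuple 'I_4 => other_end x w).
Proof.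
move=> w v /set_mem /= xw /set_mem /= xv /other_end_inj e; apply: val_inj; apply: e => //.
by rewrite !size_tuple.
Qed.

Lemma adj_sum (V : nmodType) m x (G : R * R -> V) :
  \sum_(y \in [set y | adj s m x y]) G y =
  \sum_(w : m.-tuple 'I_4 | at_word x w) G (other_end x w).
Proof.
rewrite adj_image fsbig_image; last exact: adj_set_inj.
by rewrite -(bigfs _ (index_enum_uniq _))// => w _; rewrite mem_index_enum.
Qed.

Lemma degreeE m x : degree s m x = (\sum_(w : m.-tuple 'I_4 | at_word x w) 1)%N.
Proof.
have fin : finite_set [set y | adj s m x y].
  by rewrite adj_image; apply: finite_image; exact: finite_finset.
rewrite /degree -sum1_size -fsbig_finite// adj_image fsbig_image; last exact: adj_set_inj.
by rewrite -(bigfs _ (index_enum_uniq _))// => w _; rewrite mem_index_enum.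
Qed.

Lemma edge_wordE m x (w : m.-tuple 'I_4) : at_word x w -> edge_word s m x (other_end x w) = w.
Proof.
move=> xw; have : is_edge s w x (other_end x w).
  by move: xw => /orP[] /eqP ->; apply/edgeP; rewrite ?other_lpt ?other_rpt; [left|right].
move=> wxy; rewrite /edge_word; case: xgetP => [v _ /edgeP vxy|/(_ w)//].
have : at_word x v /\ other_end x w = other_end x v.
  by case: vxy => -[-> ->]; rewrite ?at_lpt ?at_rpt ?other_lpt ?other_rpt.
move=> [xv e]; apply: val_inj; apply: (other_end_inj _ xv xw (esym e)).
by rewrite !size_tuple.
Qed.

(** After exchanging the sums, a cell is met exactly twice, once from each of its two distinct ends.
    This is the double counting that the factor 1/2 of the graph energy corrects. *)
Lemma sqrt_sum_other (V : nmodType) m (G : R * R -> R * R -> V) :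
  \sum_(x \in vertices s m) \sum_(y \in [set y | adj s m x y]) G x y =
  wsum m (fun w => G (lpt s w) (rpt s w) + G (rpt s w) (lpt s w)) [::].
Proof.
under eq_fsbigr do rewrite adj_sum.
rewrite (fsbig_finite _ _ (finite_vertices m)) wsum_nil.
under eq_bigr do rewrite big_mkcond.
rewrite exchange_big /=; apply: eq_bigr => w _.
have vl : vertices s m (lpt s w) by apply/verticesP; exists w; exact: at_lpt.
have vr : vertices s m (rpt s w) by apply/verticesP; exists w; exact: at_rpt.
have fl : lpt s w \in fset_set (vertices s m) by rewrite (in_fset_set (finite_vertices m)); exact/mem_set.
have fr : rpt s w \in fset_set (vertices s m) by rewrite (in_fset_set (finite_vertices m)); exact/mem_set.
rewrite (bigD1_seq _ fl (fset_uniq _)) at_lpt other_lpt; congr (_ + _).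
have rl : rpt s w != lpt s w by apply/eqP => e; exact: (@lpt_neq_rpt _ s w).
rewrite (big_rem _ fr) /= rl at_rpt other_rpt big_seq_cond big1 ?addr0// => x /andP[xr xl].
case: ifPn => // /orP[|/eqP e]; first by rewrite (negbTE xl).
by move: xr; rewrite e mem_rem_uniqF// fset_uniq.
Qed.

Definition sqincr (f : cfun R) w : R := rnorm (incr s f w) ^+ 2.

Lemma graph_energyE m f : graph_energy s m f = wsum m (sqincr f) [::].
Proof.
rewrite /graph_energy sqrt_sum_other -wsum_mull; apply: eq_wsum => w.
by rewrite [rnorm (f (rpt s w) - _)]rdistC /sqincr /incr; field.
Qed.

End Edges.

Section Energy.
Context {R : realType}.
Variables (s : R).
Implicit Types (f g h : cfun R) (w v : seq 'I_4).
Local Notation D := (incr s).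

Lemma sqincr_ge0 f w : 0 <= sqincr s f w. Proof. exact: sqr_ge0. Qed.

(* Harmonic interpolation divides the increment over w by 2^n. *)
Lemma wsum_residual n f w :
  wsum n (fun v => rnorm (D f v - (2^-1 ^+ n)%:C * D f w) ^+ 2) w =
  wsum n (sqincr s f) w - sqincr s f w.
Proof.
set t : R := 2^-1 ^+ n; set c := D f w.
have t2 : t * 2 ^+ n = 1 by rewrite /t -exprMn mulVf ?expr1n.
have e v : rnorm (D f v - t%:C * c) ^+ 2 =
    sqincr s f v + (- (2 * t * Re c) * Re (D f v) - 2 * t * Im c * Im (D f v)) + t ^+ 2 * sqincr s f w.
  by rewrite /sqincr !rnorm_sqr -/c !complex_simp /=; ring.
have qE : sqincr s f w = Re c ^+ 2 + Im c ^+ 2 by rewrite /sqincr rnorm_sqr.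
under [LHS]eq_wsum do rewrite e.
move: qE; set q := sqincr s f w; clearbody q => qE.
have sums (P : R[i] -> R) : {morph P : x y / x + y} -> P 0 = 0 ->
    wsum n (fun v => P (D f v)) w = 2 ^+ n * P c.
  move=> PD P0; rewrite -(wsum_morph _ _ _ PD P0) wsum_incr -/c.
  by rewrite -natrX mulr_natl; elim: (2 ^ n)%N => [|k ih]; rewrite ?mulr0n// !mulrS PD ih.
rewrite !wsum_add wsumN !wsum_mull sums; [|exact: ReD|by []].
rewrite sums; [|exact: ImD|by []].
rewrite wsum_cst -[q *+ _]mulr_natr natrX (_ : 4 ^+ n = 2 ^+ n * 2 ^+ n :> R); last first.
  by rewrite -exprMn; congr (_ ^+ _); ring.
rewrite qE.
have -> : t ^+ 2 * ((Re c ^+ 2 + Im c ^+ 2) * (2 ^+ n * 2 ^+ n)) =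
  (t * 2 ^+ n) ^+ 2 * (Re c ^+ 2 + Im c ^+ 2) by ring.
have -> : - (2 * t * Re c) * (2 ^+ n * Re c) = - 2 * (t * 2 ^+ n) * Re c ^+ 2 by ring.
have -> : 2 * t * Im c * (2 ^+ n * Im c) = 2 * (t * 2 ^+ n) * Im c ^+ 2 by ring.
rewrite t2; ring.
Qed.

(** The difference is the sum of squares in [wsum_residual]: the monotonicity of graph energies,
    localized to one cell. *)
Lemma sqincr_le_wsum n f w : sqincr s f w <= wsum n (sqincr s f) w.
Proof. by rewrite -subr_ge0 -wsum_residual; apply: wsum_ge0 => v; exact: sqr_ge0. Qed.

Lemma wsum_sqincr_mono m n f w : (m <= n)%N -> wsum m (sqincr s f) w <= wsum n (sqincr s f) w.
Proof. by move=> /subnKC <-; rewrite wsumD; apply: le_wsum => v; exact: sqincr_le_wsum. Qed.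

(** The scalar identity by which a form defined through [polarize] becomes, edge by edge, a product
    of increments. *)
Lemma polarization (a b : R[i]) :
  4^-1 * \sum_(k < 4) ii ^+ k * (rnorm (a + ii ^+ k * b) ^+ 2)%:C = a * conjc b.
Proof.
have JJ : ii * ii = -1 :> R[i] by apply: complexP; rewrite /= ; ring.
rewrite !big_ord_recl big_ord0 /bump /= !rnorm_sqrE expr0 expr1 !exprS expr0 mulr1 JJ.
rewrite !rmorphD !rmorphM !rmorphN !rmorph1.
have -> : (conjc : {rmorphism R[i] -> R[i]}) ii = - ii by apply: complexP; rewrite /= ?oppr0.
rewrite /=.
transitivity (4^-1 * (2 * (a * conjc b + b * conjc a) -
  2 * (ii * ii) * (a * conjc b - b * conjc a))); first by ring.
by rewrite JJ; field.
Qed.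

End Energy.

(** * The domain of the Dirichlet form *)

Section Domain.
Context {R : realType}.
Variables (s : R) (X : set (R * R)).
Hypotheses (hs : 0 < s <= 8^-1) (hX : is_diamond_fractal s X).
Implicit Types (f g h : cfun R) (phi : R * R -> R) (w v : seq 'I_4).
Local Notation D := (incr s).
Local Notation sq := (sqincr s).
Local Notation dom := (in_domain s X).

Let cX : compact X. Proof. by case: hX. Qed.

Lemma in_domainP f : dom f <->
  continuous_on X f /\ exists M : R, forall n, wsum n (sq f) [::] <= M.
Proof.
rewrite /in_domain (_ : (fun m => graph_energy s m f) = fun m => wsum m (sq f) [::]); last first.
  by apply: funext => m; rewrite (graph_energyE hs).
have nd : nondecreasing_seq (fun m => wsum m (sq f) [::]).
  by move=> m n mn; exact: wsum_sqincr_mono.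
split=> -[cf].
  by move=> cv; split=> //; exists (limn (fun m => wsum m (sq f) [::])) => n; exact: nondecreasing_cvgn_le.
move=> [M hM]; split=> //; apply: nondecreasing_is_cvgn => //.
by exists M => _ [n _ <-].
Qed.

Lemma energy_cvg f : dom f -> wsum n (sq f) [::] @[n --> \oo] --> energy s f.
Proof.
move=> [_]; rewrite /energy (_ : (fun m => graph_energy s m f) = fun m => wsum m (sq f) [::])//.
by apply: funext => m; rewrite (graph_energyE hs).
Qed.

Lemma le_energy f n : dom f -> wsum n (sq f) [::] <= energy s f.
Proof.
move=> df; have cv := energy_cvg df; rewrite -(cvg_lim _ cv)//; apply: nondecreasing_cvgn_le.
  by move=> i j ij; exact: wsum_sqincr_mono.
by apply/cvg_ex; exists (energy s f).
Qed.

Lemma energy_ge0 f : dom f -> 0 <= energy s f.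
Proof. by move=> df; apply: le_trans (le_energy 0 df); exact: sqincr_ge0. Qed.

Lemma dom_continuous f : dom f -> continuous_on X f. Proof. by case. Qed.

Lemma dom_bounded f : dom f -> exists2 M : R, 0 <= M & forall x, X x -> rnorm (f x) <= M.
Proof. by case=> cf _; exact: continuous_on_bounded. Qed.

Lemma incrD f g w : D (fun x => f x + g x) w = D f w + D g w.
Proof. by rewrite /incr opprD addrACA. Qed.

Lemma incrZ (c : R[i]) f w : D (fun x => c * f x) w = c * D f w.
Proof. by rewrite /incr mulrBr. Qed.

Lemma incrM f g w : D (fun x => f x * g x) w = f (lpt s w) * D g w + D f w * g (rpt s w).
Proof. by rewrite /incr; ring. Qed.

Lemma domD f g : dom f -> dom g -> dom (fun x => f x + g x).
Proof.
move=> /in_domainP[cf [M hM]] /in_domainP[cg [N hN]]; apply/in_domainP.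
split; first exact: continuous_onD.
exists (2 * M + 2 * N) => n; apply: (@le_trans _ _ (wsum n (fun v => 2 * sq f v + 2 * sq g v) [::])).
  by apply: le_wsum => v; rewrite /sqincr incrD; exact: le_rnormD_sqr.
by rewrite wsum_add !wsum_mull; have := hM n; have := hN n; lra.
Qed.

(** Increments are at most 8 |L| 2^-n, where 8 = 4 + 4 adds the bounds for the two coordinates, and
    there are 4^n edges: the squares add up to at most 64 L^2 at every level. *)
Lemma dom_lipschitz L f :
  (forall x y, X x -> X y -> rnorm (f x - f y) <= L * (`|x.1 - y.1| + `|x.2 - y.2|)) -> dom f.
Proof.
move=> h; apply/in_domainP; split; first exact: continuous_on_lipschitz h.
exists (64 * `|L| ^+ 2) => n.
apply: (@le_trans _ _ (wsum n (fun=> 64 * `|L| ^+ 2 * (2^-1 ^+ n) ^+ 2) [::])).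
  apply: le_wsum_pre => v sv; rewrite /sqincr /incr /=.
  have [a b] := lens_word_map_close hs v (@lens_l R) (@lens_r R).
  rewrite sv in a b.
  have k : rnorm (f (lpt s v) - f (rpt s v)) <= `|L| * (8 * 2^-1 ^+ n).
    apply: (le_trans (h _ _ (fractal_lpt hs hX v) (fractal_rpt hs hX v))).
    apply: (@le_trans _ _ (`|L| * (`|(lpt s v).1 - (rpt s v).1| + `|(lpt s v).2 - (rpt s v).2|))).
      by rewrite ler_wpM2r ?addr_ge0// ler_norm.
    by rewrite ler_wpM2l//; move: a b; rewrite -/(lpt s v) -/(rpt s v); lra.
  have := lerXn2r 2 _ _ k; rewrite !nnegrE rnorm_ge0 mulr_ge0 ?mulr_ge0 ?exprn_ge0// => /(_ isT isT).
  by move/le_trans; apply; rewrite le_eqVlt; apply/orP; left; apply/eqP; ring.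
rewrite wsum_cst -[_ *+ (4 ^ n)]mulr_natr natrX -exprM mulnC exprM -mulrA -exprMn.
by rewrite (_ : (2^-1 ^+ 2 * 4 : R) = 1) ?expr1n ?mulr1//; field.
Qed.

Lemma dom_cst c : dom (fun=> c).
Proof.
by apply: (@dom_lipschitz 0) => x y _ _; rewrite subrr rnorm0 mul0r.
Qed.

Lemma domM f g : dom f -> dom g -> dom (fun x => f x * g x).
Proof.
move=> df dg; have [Mf Mf0 hMf] := dom_bounded df; have [Mg Mg0 hMg] := dom_bounded dg.
move: df dg => /in_domainP[cf [M hM]] /in_domainP[cg [N hN]]; apply/in_domainP.
split; first exact: continuous_onM.
exists (2 * Mf ^+ 2 * N + 2 * Mg ^+ 2 * M) => n.
apply: (@le_trans _ _ (wsum n (fun v => 2 * Mf ^+ 2 * sq g v + 2 * Mg ^+ 2 * sq f v) [::])).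
  apply: le_wsum => v; rewrite /sqincr incrM (le_trans (le_rnormD_sqr _ _))// !rnormM !exprMn.
  have sqM (a b : R) : 0 <= a -> a <= b -> a ^+ 2 <= b ^+ 2.
    by move=> a0 ab; rewrite lerXn2r// nnegrE// (le_trans a0).
  have := ler_wpM2r (sqr_ge0 (rnorm (D g v))) (sqM _ _ (rnorm_ge0 _) (hMf _ (fractal_lpt hs hX v))).
  have := ler_wpM2r (sqr_ge0 (rnorm (D f v))) (sqM _ _ (rnorm_ge0 _) (hMg _ (fractal_rpt hs hX v))).
  lra.
rewrite wsum_add !wsum_mull lerD// ler_wpM2l ?hM ?hN// mulr_ge0// sqr_ge0//.
Qed.

Lemma domZ c f : dom f -> dom (fun x => c * f x).
Proof. by apply: domM; exact: dom_cst. Qed.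

Lemma domN f : dom f -> dom (fun x => - f x).
Proof.
by move=> /(domZ (-1)); congr (dom _); apply: funext => x; rewrite mulN1r.
Qed.

Lemma domB f g : dom f -> dom g -> dom (fun x => f x - g x).
Proof. by move=> df /domN dg; exact: domD. Qed.

Lemma domJ f : dom f -> dom (fun x => conjc (f x)).
Proof.
move=> /in_domainP[cf [M hM]]; apply/in_domainP; split; first exact: continuous_onJ.
exists M => n; apply: le_trans (hM n); apply: le_wsum => v.
by rewrite /sqincr /incr -rmorphB rnormJ.
Qed.

Lemma dom_Re f : dom f -> dom (fun x => (Re (f x))%:C).
Proof.
move=> df; have := domZ (2^-1) (domD df (domJ df)); congr (dom _).
by apply: funext => x; rewrite addcJ mulKf.
Qed.

Lemma dom_Im f : dom f -> dom (fun x => (Im (f x))%:C).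
Proof.
move=> df; have := dom_Re (domZ (- ii) df); congr (dom _).
by apply: funext => x; rewrite !complex_simp /=; congr (_%:C); ring.
Qed.

Lemma dom_fst : dom (cembed (@fstf R)).
Proof.
apply: (@dom_lipschitz 1) => x y _ _.
by rewrite /cembed -rmorphB /= rnorm_real mul1r lerDl.
Qed.

(** Edge sums above level [m] split over the m-cells, and inside a cell the pasted function has the
    increments of [G w]. The energies of the finitely many [G w] therefore bound every level. *)
Lemma dom_paste m (G : m.-tuple 'I_4 -> cfun R) g :
  (forall w : m.-tuple 'I_4, dom (G w)) ->
  (forall (w : m.-tuple 'I_4) x, cell s X w x -> g x = G w x) -> dom g.
Proof.
move=> dG gG; apply/in_domainP; split.
  by apply: (cell_paste_continuous hs hX _ gG) => w; exact: dom_continuous.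
exists (\sum_(w : m.-tuple 'I_4) energy s (G w)) => n.
apply: (@le_trans _ _ (wsum (m + n) (sq g) [::])); first by apply: wsum_sqincr_mono; exact: leq_addl.
rewrite wsumD wsum_nil; apply: ler_sum => w _.
apply: (@le_trans _ _ (wsum n (sq (G w)) w)); last first.
  apply: le_trans (le_energy (m + n) (dG w)); apply: wsum_le_total; first exact: size_tuple.
  by move=> v; exact: sqincr_ge0.
apply: le_wsum_pre => v _; rewrite /sqincr /incr !(gG w)//.
  by apply: (cell_cat_sub hX (v := v)); exact: cell_rpt.
by apply: (cell_cat_sub hX (v := v)); exact: cell_lpt.
Qed.

Lemma dom_paste_exists m (G : m.-tuple 'I_4 -> cfun R) :
  (forall w : m.-tuple 'I_4, dom (G w)) ->
  (forall (w v : m.-tuple 'I_4) x, cell s X w x -> cell s X v x -> G w x = G v x) ->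
  exists2 g, dom g & forall (w : m.-tuple 'I_4) x, cell s X w x -> g x = G w x.
Proof.
move=> dG GG.
pose g x := G (xget [tuple ord0 | _ < m] [set w : m.-tuple 'I_4 | cell s X w x]) x.
have gG (w : m.-tuple 'I_4) x : cell s X w x -> g x = G w x.
  by rewrite /g; case: xgetP => [v _ /= vx wx|/(_ w)//]; exact: GG.
by exists g => //; exact: dom_paste gG.
Qed.

(** Polarization is performed on each edge before the limit is taken. Linearity of the form and the
    energy measure formula are read off from these sums. *)
Lemma energy_form_cvg f g : dom f -> dom g ->
  ccvg (fun n => wsum n (fun v => D f v * conjc (D g v)) [::]) (energy_form s f g).
Proof.
move=> df dg; rewrite /energy_form /polarize.
under [X in ccvg X]eq_fun => n.
  under eq_wsum => v do rewrite -polarization.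
  rewrite wsum_mull wsum_sum.
  under eq_bigr => k _.
    rewrite wsum_mull.
    under eq_wsum => v do rewrite -incrZ -incrD -/(sqincr s _ v).
    rewrite -wsum_scale_real.
    over.
  over.
apply: ccvgMl; apply: ccvg_sum => k _; apply: ccvgMl; apply: ccvg_real.
by apply: energy_cvg; apply: domD => //; exact: domZ.
Qed.

End Domain.

(** * Integration of bounded Borel functions *)

Section PlaneMeasurability.
Context {R : realType}.

Lemma measurable_square (a b c d : R) :
  measurable [set z : R * R | (a < z.1 < b) && (c < z.2 < d)].
Proof.
rewrite (_ : [set _ | _] = `]a, b[%classic `*` `]c, d[%classic); last first.
  apply/seteqP; split=> z /=; rewrite !in_itv /=; first by move=> /andP[-> ->].
  by move=> [-> ->].
by apply: measurableX; exact: measurable_itv.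
Qed.

(** The measurable sets of the plane are those of the product structure, so an open set has to be
    written as a countable union of rectangles with rational corners. *)
Lemma open_measurable_plane (U : set (R * R)) : open U -> measurable U.
Proof.
rewrite openE => oU.
pose B (p q r t : rat) : set (R * R) :=
  [set z | (ratr p < z.1 < ratr q) && (ratr r < z.2 < ratr t)].
(* Rectangles not contained in [U] are replaced by the empty set, so that the union may range over
   all quadruples of rationals. *)
pose C p q r t := if `[< B p q r t `<=` U >] then B p q r t else set0.
rewrite (_ : U = \bigcup_p \bigcup_q \bigcup_r \bigcup_t C p q r t); last first.
  apply/seteqP; split=> z; last first.
    by move=> [p _ [q _ [r _ [t _]]]]; rewrite /C; case: ifPn => // /asboolP; exact.
  move=> /oU /nbhs_closeP[d d0 hd].
  have lt1 (x : R) : x - d < x by lra.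
  have lt2 (x : R) : x < x + d by lra.
  have [p] := rat_in_itvoo (lt1 z.1); have [q] := rat_in_itvoo (lt2 z.1).
  have [r] := rat_in_itvoo (lt1 z.2); have [t] := rat_in_itvoo (lt2 z.2).
  rewrite !in_itv /= => /andP[t1 t2] /andP[r1 r2] /andP[q1 q2] /andP[p1 p2].
  exists p => //; exists q => //; exists r => //; exists t => //; rewrite /C ifT.
    by rewrite /B /= p2 q1 r2 t1.
  apply/asboolP => y /andP[/andP[? ?] /andP[? ?]]; apply: hd.
  by split; rewrite distrC ltr_distl; apply/andP; split; lra.
do 4 (apply: bigcupT_measurable_rat => ?).
by rewrite /C; case: ifP => _; [exact: measurable_square|exact: measurable0].
Qed.

Lemma closed_measurable_plane (U : set (R * R)) : closed U -> measurable U.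
Proof.
by move=> cU; rewrite -(setCK U); apply: measurableC; apply: open_measurable_plane; exact: closed_openC.
Qed.

Lemma measurable_point (p : R * R) : measurable [set p].
Proof.
rewrite (_ : [set p] = [set p.1] `*` [set p.2]) .
  exact: measurableX.
apply/seteqP; split=> z /=; first by move=> ->.
by case: z p => [a b] [c d] /= [-> ->]. Qed.

Lemma measurable_continuous_on (X : set (R * R)) (phi : R * R -> R) :
  compact X -> continuous_on X (cembed phi) -> measurable_fun X phi.
Proof.
move=> cX /continuous_onP cphi mX; apply: (measurability _ (RGenOInfty.measurableE R)) => //.
move=> _ [_ [c ->] <-].
(* [U] is the union of the open boxes around points of X on which [phi] exceeds [c] along X; it is
   open in the plane and cuts X in the superlevel set. *)
pose U := [set z | exists x d, [/\ X x, 0 < d, close d x z & forall y, X y -> close d x y -> c < phi y]].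
rewrite (_ : X `&` _ = X `&` U).
  apply: measurableI => //; apply: open_measurable_plane; rewrite openE => z [x [d [Xx d0 [a b] hd]]].
  apply/nbhs_closeP; exists (Num.min (d - `|x.1 - z.1|) (d - `|x.2 - z.2|)).
    by rewrite lt_min !subr_gt0 a b.
  move=> y [a' b']; exists x, d; split => //.
  move: a' b'; rewrite !lt_min => /andP[a1 a2] /andP[b1 b2].
  split.
    by rewrite -(subrKA z.1) (le_lt_trans (ler_normD _ _))//; lra.
  by rewrite -(subrKA z.2) (le_lt_trans (ler_normD _ _))//; lra.
apply/seteqP; split=> z [Xz]; rewrite /= in_itv /= andbT.
  move=> cz; split => //.
  have [|d d0 hd] := cphi z Xz (phi z - c); first by rewrite subr_gt0.
  exists z, d; split => //; first by split; rewrite subrr normr0.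
  move=> y Xy /(hd y Xy); rewrite /cembed -rmorphB rnorm_real ltr_norml => /andP[]; lra.
by move=> [x [d [_ _ xz h]]]; split => //; exact: h.
Qed.

Lemma bounded_borel_continuous (X : set (R * R)) (f : cfun R) :
  compact X -> continuous_on X f -> bounded_borel X f.
Proof.
move=> cX cf; split.
- apply: (measurable_continuous_on cX).
  apply/continuous_onP => x Xx e e0; have /continuous_onP/(_ x Xx e e0)[d d0 hd] := cf.
  exists d => // y Xy xy; apply: le_lt_trans (hd y Xy xy).
  by rewrite /cembed -rmorphB rnorm_real -ReN -ReD normRe_le.
- apply: (measurable_continuous_on cX).
  apply/continuous_onP => x Xx e e0; have /continuous_onP/(_ x Xx e e0)[d d0 hd] := cf.
  exists d => // y Xy xy; apply: le_lt_trans (hd y Xy xy).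
  by rewrite /cembed -rmorphB rnorm_real -ImN -ImD normIm_le.
- by have [M M0 hM] := continuous_on_bounded cX cf; exists M.
Qed.

End PlaneMeasurability.

Section BoundedBorel.
Context {R : realType}.
Variable X : set (R * R).
Hypothesis mX : measurable X.
Implicit Types (f g h : cfun R) (phi psi : R * R -> R).

Definition rbounded phi := measurable_fun X phi /\ exists M : R, forall x, X x -> `|phi x| <= M.

Lemma bounded_borelP f : bounded_borel X f <->
  rbounded (fun x => Re (f x)) /\ rbounded (fun x => Im (f x)).
Proof.
split=> [[mr mi [M hM]]|[[mr [M hM]] [mi [N hN]]]].
  split; split=> //; exists M => x Xx; apply: le_trans (hM x Xx); [exact: normRe_le|exact: normIm_le].
split=> //; exists (M + N) => x Xx; apply: (le_trans (rnorm_le_ReIm _)).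
by rewrite lerD ?hM ?hN.
Qed.

Lemma rbounded_cst c : rbounded (fun=> c).
Proof. by split; [exact: measurable_cst|exists `|c|]. Qed.

Lemma rboundedD phi psi : rbounded phi -> rbounded psi -> rbounded (fun x => phi x + psi x).
Proof.
move=> [mf [M hM]] [mg [N hN]]; split; first exact: measurable_funD.
by exists (M + N) => x Xx; rewrite (le_trans (ler_normD _ _))// lerD ?hM ?hN.
Qed.

Lemma rboundedM phi psi : rbounded phi -> rbounded psi -> rbounded (fun x => phi x * psi x).
Proof.
move=> [mf [M hM]] [mg [N hN]]; split; first exact: measurable_funM.
by exists (M * N) => x Xx; rewrite normrM ler_pM ?hM ?hN.
Qed.

Lemma rboundedN phi : rbounded phi -> rbounded (fun x => - phi x).
Proof.
move=> [mf [M hM]]; split.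
  by under eq_fun do rewrite -sub0r; apply: measurable_funB => //; exact: measurable_cst.
by exists M => x Xx; rewrite normrN hM.
Qed.

Lemma rboundedB phi psi : rbounded phi -> rbounded psi -> rbounded (fun x => phi x - psi x).
Proof. by move=> h1 h2; apply: rboundedD => //; exact: rboundedN. Qed.

Lemma rbounded_indic A : measurable A -> rbounded \1_A.
Proof.
move=> mA; split; first exact: measurable_indic.
by exists 1 => x _; rewrite indicE; case: (x \in A); rewrite ?normr1 ?normr0.
Qed.

Lemma bborelD f g : bounded_borel X f -> bounded_borel X g -> bounded_borel X (fun x => f x + g x).
Proof.
move=> /bounded_borelP[f1 f2] /bounded_borelP[g1 g2]; apply/bounded_borelP; split.
  by under eq_fun do rewrite ReD; exact: rboundedD.
by under eq_fun do rewrite ImD; exact: rboundedD.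
Qed.

Lemma bborelM f g : bounded_borel X f -> bounded_borel X g -> bounded_borel X (fun x => f x * g x).
Proof.
move=> /bounded_borelP[f1 f2] /bounded_borelP[g1 g2]; apply/bounded_borelP; split.
  by under eq_fun do rewrite ReM; apply: rboundedB; exact: rboundedM.
by under eq_fun do rewrite ImM; apply: rboundedD; exact: rboundedM.
Qed.

Lemma bborelJ f : bounded_borel X f -> bounded_borel X (fun x => conjc (f x)).
Proof.
move=> /bounded_borelP[f1 f2]; apply/bounded_borelP; split.
  by under eq_fun do rewrite ReJ.
by under eq_fun do rewrite ImJ; exact: rboundedN.
Qed.

Lemma bborel_real phi : rbounded phi -> bounded_borel X (cembed phi).
Proof. by move=> h; apply/bounded_borelP; split => //=; exact: rbounded_cst. Qed.

Lemma bborel_cst c : bounded_borel X (fun=> c).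
Proof. by apply/bounded_borelP; split; exact: rbounded_cst. Qed.

Lemma bborelZ c f : bounded_borel X f -> bounded_borel X (fun x => c * f x).
Proof. by apply: bborelM; exact: bborel_cst. Qed.

Lemma bborel_sum (I : Type) (r : seq I) (P : pred I) (F : I -> cfun R) :
  (forall i, P i -> bounded_borel X (F i)) -> bounded_borel X (fun x => \sum_(i <- r | P i) F i x).
Proof.
move=> hF; elim: r => [|i r ih].
  by under eq_fun do rewrite big_nil; exact: bborel_cst.
under eq_fun do rewrite big_cons.
  by case: (boolP (P i)) => Pi //; apply: bborelD => //; exact: hF.
Qed.

Lemma bborel_indic A : measurable A -> bounded_borel X (\1_A : cfun R).
Proof.
move=> mA; rewrite (_ : (\1_A : cfun R) = cembed \1_A); first exact/bborel_real/rbounded_indic.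
by apply: funext => x; rewrite /cembed !indicE; case: (x \in A).
Qed.

Section Integral.
Variable nu : {measure set (R * R) -> \bar R}.
Hypothesis finnu : (nu X < +oo)%E.

Lemma rbounded_integrable phi : rbounded phi -> nu.-integrable X (EFin \o phi).
Proof.
move=> [mphi [M hM]]; apply: measurable_bounded_integrable => //.
exists M; split; first exact: num_real.
by move=> N MN x Xx /=; rewrite (le_trans (hM x Xx))// ltW.
Qed.

Lemma cintegralD f g : bounded_borel X f -> bounded_borel X g ->
  cintegral nu X (fun x => f x + g x) = cintegral nu X f + cintegral nu X g.
Proof.
move=> /bounded_borelP[f1 f2] /bounded_borelP[g1 g2]; apply: complexP; rewrite complex_simp /=.
  by under eq_Rintegral do rewrite ReD; rewrite RintegralD//; exact: rbounded_integrable.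
by under eq_Rintegral do rewrite ImD; rewrite RintegralD//; exact: rbounded_integrable.
Qed.

Lemma cintegralZ c f : bounded_borel X f ->
  cintegral nu X (fun x => c * f x) = c * cintegral nu X f.
Proof.
move=> /bounded_borelP[f1 f2].
have h (k : R) phi : rbounded phi -> nu.-integrable X (EFin \o (fun x => k * phi x)).
  by move=> hphi; apply: rbounded_integrable; apply: rboundedM => //; exact: rbounded_cst.
apply: complexP; rewrite complex_simp /=.
  under eq_Rintegral do rewrite ReM.
  by rewrite RintegralB//; try exact: h; rewrite !RintegralZl//; exact: rbounded_integrable.
under eq_Rintegral do rewrite ImM.
by rewrite RintegralD//; try exact: h; rewrite !RintegralZl//; exact: rbounded_integrable.
Qed.

Lemma cintegralJ f : bounded_borel X f ->
  cintegral nu X (fun x => conjc (f x)) = conjc (cintegral nu X f).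
Proof.
move=> /bounded_borelP[f1 f2]; apply: complexP; rewrite complex_simp /=.
  by apply: eq_Rintegral => x _; rewrite ReJ.
under eq_Rintegral do rewrite ImJ -mulN1r.
by rewrite RintegralZl ?mulN1r//; exact: rbounded_integrable.
Qed.

Lemma eq_cintegral f g : (forall x, X x -> f x = g x) -> cintegral nu X f = cintegral nu X g.
Proof.
move=> fg; rewrite /cintegral; congr (_ +i* _); apply: eq_Rintegral => x /set_mem Xx;
  by rewrite fg.
Qed.

Lemma cintegral0 : cintegral nu X (fun=> 0) = 0.
Proof. by rewrite /cintegral /= Rintegral_cst// mul0r. Qed.

Lemma cintegral_cembed phi : cintegral nu X (cembed phi) = (\int[nu]_(x in X) phi x)%:C.
Proof. by rewrite /cintegral /= Rintegral_cst// mul0r. Qed.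

Lemma cintegral_sum (I : Type) (r : seq I) (P : pred I) (F : I -> cfun R) :
  (forall i, P i -> bounded_borel X (F i)) ->
  cintegral nu X (fun x => \sum_(i <- r | P i) F i x) = \sum_(i <- r | P i) cintegral nu X (F i).
Proof.
move=> hF; elim: r => [|i r ih].
  by rewrite big_nil -[RHS]cintegral0; apply: eq_cintegral => x _; rewrite big_nil.
rewrite big_cons; under [X in cintegral _ _ X]eq_fun do rewrite big_cons.
case: ifP => Pi //; rewrite cintegralD ?ih//; first exact: hF.
exact: bborel_sum.
Qed.

Lemma le_norm_Rintegral phi psi : rbounded phi -> rbounded psi ->
  (forall x, X x -> `|phi x| <= psi x) ->
  `|\int[nu]_(x in X) phi x| <= \int[nu]_(x in X) psi x.
Proof.
move=> h1 h2 h; apply: (le_trans (le_normr_Rintegral mX (rbounded_integrable h1))).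
apply: le_Rintegral => //; try exact: rbounded_integrable.
by have := integrable_abse (rbounded_integrable h1); apply: eq_integrable.
Qed.

Lemma Rintegral_null phi (N : set (R * R)) : measurable N -> nu N = 0%E -> rbounded phi ->
  (forall x, X x -> ~ N x -> phi x = 0) -> \int[nu]_(x in X) phi x = 0.
Proof.
move=> mN nN hphi h; rewrite /Rintegral (negligible_integral mN mX (rbounded_integrable hphi) nN).
rewrite (eq_integral (cst 0%E)) ?integral_cst ?mul0e//; first exact: measurableD.
by move=> x /set_mem [Xx Nx] /=; rewrite h.
Qed.

Lemma cintegral_null f (N : set (R * R)) : measurable N -> nu N = 0%E -> bounded_borel X f ->
  (forall x, X x -> ~ N x -> f x = 0) -> cintegral nu X f = 0.
Proof.
move=> mN nN /bounded_borelP[f1 f2] h; apply: complexP => /=;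
  by apply: (Rintegral_null mN nN) => // x Xx Nx; rewrite h.
Qed.

End Integral.
End BoundedBorel.

(** * Measures determined by integrals of Lipschitz functions *)

Section MeasureUniqueness.
Context {R : realType}.
Variable X : set (R * R).
Hypothesis mX : measurable X.
Hypothesis cX : compact X.

Definition quadrant (a b : R) : set (R * R) := [set z | z.1 < a /\ z.2 < b].

(** Lipschitz functions increasing to the indicator of t > 0. The limit is exact at t = 0 too, which
    matches the strict inequalities in [quadrant]. *)
Let ramp (k : nat) (t : R) : R := Num.min 1 (k%:R * Num.max 0 t).

Let ramp_ge0 k t : 0 <= ramp k t.
Proof. by rewrite /ramp le_min ler01 mulr_ge0// le_max lexx. Qed.

Let ramp_le1 k t : ramp k t <= 1.
Proof. by rewrite /ramp ge_min lexx. Qed.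

Let norm_max0 (a b : R) : `|Num.max 0 a - Num.max 0 b| <= `|a - b|.
Proof.
rewrite ler_norml; have := ler_norm (a - b); have := ler_norm (- (a - b)); rewrite normrN.
by rewrite /Num.max; case: (ltP 0 a) => h1; case: (ltP 0 b) => h2 h3 h4; apply/andP; split; lra.
Qed.

Let norm_min1 (a b : R) : `|Num.min 1 a - Num.min 1 b| <= `|a - b|.
Proof.
rewrite ler_norml; have := ler_norm (a - b); have := ler_norm (- (a - b)); rewrite normrN.
by rewrite /Num.min; case: (ltP 1 a) => h1; case: (ltP 1 b) => h2 h3 h4; apply/andP; split; lra.
Qed.

Let ramp_lip k (a b : R) : `|ramp k a - ramp k b| <= k%:R * `|a - b|.
Proof.
rewrite (le_trans (norm_min1 _ _))// -mulrBr normrM ger0_norm// ler_wpM2l//; exact: norm_max0.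
Qed.

Let ramp_cvg t : ramp k t @[k --> \oo] --> (if 0 < t then 1 else 0 : R).
Proof.
case: ltP => t0.
  apply: cvg_near_cst; exists (Num.truncn t^-1).+1 => // k /= hk.
  rewrite /ramp max_r ?(ltW t0)//; apply: min_l.
  rewrite -ler_pdivrMr// mul1r (le_trans (ltW (truncnS_gt _)))//.
  by rewrite ler_nat.
apply: cvg_near_cst; exists 0%N => // k _.
by rewrite /ramp max_l// mulr0 min_r.
Qed.

Let quad_fun k a b (z : R * R) : R := ramp k (a - z.1) * ramp k (b - z.2).

Let quad_fun_le1 k a b z : `|quad_fun k a b z| <= 1.
Proof.
by rewrite ger0_norm ?mulr_ge0// -[leRHS]mulr1 ler_pM.
Qed.

Let quad_fun_lip k a b x y :
  `|quad_fun k a b x - quad_fun k a b y| <= k%:R * (`|x.1 - y.1| + `|x.2 - y.2|).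
Proof.
rewrite /quad_fun; set p := ramp k (a - x.1); set q := ramp k (b - x.2).
set p' := ramp k (a - y.1); set q' := ramp k (b - y.2).
have -> : p * q - p' * q' = (p - p') * q + p' * (q - q') by ring.
have h1 := ramp_lip k (a - x.1) (a - y.1); have h2 := ramp_lip k (b - x.2) (b - y.2).
rewrite (le_trans (ler_normD _ _))// !normrM mulrDr lerD//.
  apply: (@le_trans _ _ (`|p - p'| * 1)).
    by rewrite ler_wpM2l// ger0_norm ?ramp_le1 ?ramp_ge0.
  by rewrite mulr1 (le_trans h1)// opprB addrC subrKA distrC.
apply: (@le_trans _ _ (1 * `|q - q'|)).
  by rewrite ler_wpM2r// ger0_norm ?ramp_le1 ?ramp_ge0.
by rewrite mul1r (le_trans h2)// opprB addrC subrKA distrC.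
Qed.

Lemma quadrant_measurable a b : measurable (quadrant a b).
Proof.
rewrite (_ : quadrant a b = `]-oo, a[%classic `*` `]-oo, b[%classic).
  by apply: measurableX; exact: measurable_itv.
by apply/seteqP; split=> z; rewrite /quadrant /= !in_itv /=.
Qed.

(** An open half-plane bounded by a coordinate line is a countable union of quadrants, so both
    coordinates are measurable for the sigma-algebra that the quadrants generate. *)
Lemma measurable_quadrants (B : set (R * R)) :
  measurable B -> <<s [set A | exists a b, A = quadrant a b] >> B.
Proof.
pose Q := [set A : set (R * R) | exists a b, A = quadrant a b].
rewrite -/Q => mB; suff: <<s Q >> (B : set (g_sigma_algebraType Q)) by [].
have m1 : measurable_fun [set: g_sigma_algebraType Q] (fst : R * R -> R).
  apply: (measurability _ (RGenInftyO.measurableE R)) => _ [_ [a ->] <-].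
  rewrite setTI (_ : _ @^-1` _ = \bigcup_n quadrant a n%:R).
    by apply: bigcupT_measurable => n; apply: sub_sigma_algebra; exists a, n%:R.
  apply/seteqP; split=> z; rewrite /= in_itv /=; last by move=> [n _ []].
  move=> za; exists (Num.truncn z.2).+1 => //; split => //; exact: truncnS_gt.
have m2 : measurable_fun [set: g_sigma_algebraType Q] (snd : R * R -> R).
  apply: (measurability _ (RGenInftyO.measurableE R)) => _ [_ [a ->] <-].
  rewrite setTI (_ : _ @^-1` _ = \bigcup_n quadrant n%:R a).
    by apply: bigcupT_measurable => n; apply: sub_sigma_algebra; exists n%:R, a.
  apply/seteqP; split=> z; rewrite /= in_itv /=; last by move=> [n _ []].
  move=> za; exists (Num.truncn z.1).+1 => //; split => //; exact: truncnS_gt.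
have := measurable_fun_pair m1 m2 measurableT mB.
rewrite setTI (_ : _ @^-1` B = B)//.
by apply/seteqP; split=> -[a b].
Qed.

(** Products of two ramps converge to the indicator of a quadrant, so dominated convergence gives
    equality there; quadrants are stable under intersection, exhaust the plane and generate.
    Lipschitz test functions suffice because they all have finite energy. *)
Lemma measure_eq_lipschitz (nu1 nu2 : {measure set (R * R) -> \bar R}) :
  nu1 (~` X) = 0%E -> nu2 (~` X) = 0%E -> (nu1 X < +oo)%E -> (nu2 X < +oo)%E ->
  (forall (phi : R * R -> R) L,
    (forall x y, `|phi x - phi y| <= L * (`|x.1 - y.1| + `|x.2 - y.2|)) ->
    \int[nu1]_(x in X) phi x = \int[nu2]_(x in X) phi x) ->
  forall B, measurable B -> nu1 B = nu2 B.
Proof.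
move=> n1 n2 f1 f2 eqi.
have restr (nu : {measure set (R * R) -> \bar R}) B : nu (~` X) = 0%E -> measurable B ->
    nu B = nu (B `&` X).
  move=> nX mB; rewrite -[in LHS](setIT B) -(setUv X) setIUr measureU; last first.
  - by apply/seteqP; split => // z [[_ Xz] [_]].
  - by apply: measurableI => //; exact: measurableC.
  - exact: measurableI.
  rewrite [X in (_ + X)%E](_ : _ = 0%E) ?adde0//; apply: (subset_measure0 _ _ _ nX) => //.
  - by apply: measurableI => //; exact: measurableC.
  - exact: measurableC.
have lim (nu : {measure set (R * R) -> \bar R}) a b : (nu X < +oo)%E ->
    (\int[nu]_(x in X) (quad_fun n a b x)%:E)%E @[n --> \oo] --> nu (quadrant a b `&` X).
  move=> fin; rewrite -(integral_indic nu mX (quadrant_measurable a b)).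
  have mq n : measurable_fun X (quad_fun n a b).
    apply: measurable_continuous_on => //; apply: (continuous_on_lipschitz (L := n%:R)) => x y _ _.
    by rewrite /cembed -rmorphB rnorm_real quad_fun_lip.
  apply: (dominated_cvg mX (g := cst 1%E)).
  - by move=> n; apply/measurable_EFinP; exact: mq.
  - move=> z Xz; apply: cvg_EFin; first by near=> n.
    rewrite indicE (_ : (z \in quadrant a b)%:R =
      (if 0 < a - z.1 then 1 else 0) * (if 0 < b - z.2 then 1 else 0)).
      by apply: cvgM; exact: ramp_cvg.
    rewrite !subr_gt0; case: ifP => h1; case: ifP => h2; rewrite ?(mul1r, mul0r, mulr0).
    + by rewrite mem_set.
    + by rewrite memNset// => -[_]; rewrite h2.
    + by rewrite memNset// => -[]; rewrite h1.
    + by rewrite memNset// => -[]; rewrite h1.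
  - by [].
  - exact: (rbounded_integrable mX fin (rbounded_cst X 1)).
  - by move=> n z _; rewrite lee_fin quad_fun_le1.
have eqQ a b : nu1 (quadrant a b) = nu2 (quadrant a b).
  rewrite (restr nu1)//; last exact: quadrant_measurable.
  rewrite (restr nu2)//; last exact: quadrant_measurable.
  apply: (cvg_unique _ (lim nu1 a b f1)) => //.
  rewrite (_ : (fun n => _) = (fun n => \int[nu2]_(x in X) (quad_fun n a b x)%:E)%E).
    exact: lim.
  apply: funext => n.
  have rb : rbounded X (quad_fun n a b).
    split; last by exists 1 => x _; exact: quad_fun_le1.
    apply: measurable_continuous_on => //; apply: (continuous_on_lipschitz (L := n%:R)) => x y _ _.
    by rewrite /cembed -rmorphB rnorm_real quad_fun_lip.
  have e : \int[nu1]_(x in X) quad_fun n a b x = \int[nu2]_(x in X) quad_fun n a b x.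
    exact: eqi (quad_fun_lip n a b).
  have i1 := integrable_fin_num mX (rbounded_integrable mX f1 rb).
  have i2 := integrable_fin_num mX (rbounded_integrable mX f2 rb).
  by rewrite -(fineK i1) -(fineK i2); congr EFin; exact: e.
move=> B mB.
have fin (nu : {measure set (R * R) -> \bar R}) A : nu (~` X) = 0%E -> (nu X < +oo)%E ->
    measurable A -> (nu A < +oo)%E.
  move=> nX fX mA; rewrite (restr nu)//; apply: le_lt_trans fX; apply: le_measure => //;
    rewrite ?in_setE//; exact: measurableI.
apply: (@g_sigma_algebra_measure_unique _ _ _ [set A | exists a b, A = quadrant a b] _
   (fun n => quadrant n%:R n%:R)) => //.
- by move=> _ [a [b ->]]; exact: quadrant_measurable.
- by move=> n; exists n%:R, n%:R.
- apply/seteqP; split=> // z _; exists (maxn (Num.truncn z.1).+1 (Num.truncn z.2).+1) => //.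
  split; apply: (lt_le_trans (truncnS_gt _)); rewrite ler_nat ?leq_maxl ?leq_maxr//.
- move=> _ _ [a [b ->]] [c [d ->]]; exists (Num.min a c), (Num.min b d).
  apply/seteqP; split=> z; rewrite /quadrant /=.
    by move=> [[? ?] [? ?]]; rewrite !lt_min; split; apply/andP.
  by rewrite !lt_min => -[/andP[? ?] /andP[? ?]].
- by move=> _ [a [b ->]].
- by move=> n; apply: fin => //; exact: quadrant_measurable.
- exact: measurable_quadrants.
Unshelve. all: by end_near. Qed.

End MeasureUniqueness.

(** * Energy measures *)

Section Shift.
Context {R : realType}.

Lemma cvg_shift_left (u : nat -> R) m (l : R) : u @ \oo --> l -> u (m + n)%N @[n --> \oo] --> l.
Proof. by rewrite -(cvg_shiftn m); under [X in X @ _ --> _]eq_fun do rewrite addnC. Qed.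

Lemma cvg_le_near (u : nat -> R) (l e : R) : u @ \oo --> l -> (\forall n \near \oo, u n <= e) -> l <= e.
Proof.
by move=> ul h; rewrite -(cvg_lim _ ul)//; apply: limr_le => //; apply/cvg_ex; exists l.
Qed.

Lemma Re_wsum n (G : seq 'I_4 -> R[i]) w : Re (wsum n G w) = wsum n (fun v => Re (G v)) w.
Proof. by rewrite !wsum_tuple Re_sum. Qed.

End Shift.

Section EnergyMeasures.
Context {R : realType}.
Variables (s : R) (X : set (R * R)).
Hypotheses (hs : 0 < s <= 8^-1) (hX : is_diamond_fractal s X).
Variable Gamma : cfun R -> {measure set (R * R) -> \bar R}.
Hypothesis hGamma : is_energy_measures s X Gamma.
Implicit Types (f g h : cfun R) (phi : R * R -> R) (w v : seq 'I_4).
Local Notation D := (incr s).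
Local Notation sq := (sqincr s).
Local Notation dom := (in_domain s X).

Let cX : compact X. Proof. by case: hX. Qed.

Lemma measurable_fractal : measurable X.
Proof. by apply: closed_measurable_plane; exact: compact_closed (@norm_hausdorff _ _) cX. Qed.

Let mX := measurable_fractal.

Lemma measurable_cell w : measurable (cell s X w).
Proof. by apply: closed_measurable_plane; exact: closed_cell. Qed.

Lemma dom_bborel f : dom f -> bounded_borel X f.
Proof. by move=> df; exact: bounded_borel_continuous cX (dom_continuous df). Qed.

Lemma dom_rbounded phi : dom (cembed phi) -> rbounded X phi.
Proof. by move=> /dom_bborel /bounded_borelP[]. Qed.

Lemma energy_measure_fin h : dom h -> (Gamma h X < +oo)%E.
Proof. by move=> dh; have [-> _ _] := hGamma dh; rewrite ltry. Qed.

Definition ravg phi w : R := (phi (lpt s w) + phi (rpt s w)) / 2.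

(** On one edge the combination of forms that defines the energy measure equals, without error, the
    squared increment of [h] times the average of [phi] over the two ends. *)
Lemma energy_measure_cvg h phi : dom h -> dom (cembed phi) ->
  wsum n (fun v => sq h v * ravg phi v) [::] @[n --> \oo] --> \int[Gamma h]_(x in X) phi x.
Proof.
move=> dh dphi; have [_ _ /(_ phi dphi) ->] := hGamma dh.
have [c1 _] := energy_form_cvg hs hX (domM hs hX dphi dh) dh.
have [c2 _] := energy_form_cvg hs hX (domM hs hX dh (domJ hs hX dh)) dphi.
under eq_fun => n.
  rewrite (_ : wsum n _ _ = Re (wsum n (fun v => D (fun x => cembed phi x * h x) v * conjc (D h v)) [::]) -
    2^-1 * Re (wsum n (fun v => D (fun x => h x * conjc (h x)) v * conjc (D (cembed phi) v)) [::])).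
    over.
  rewrite !Re_wsum -wsum_mull -wsumB; apply: eq_wsum => v.
  by rewrite /sqincr rnorm_sqr /ravg /incr /cembed !complex_simp /=; field.
by apply: cvgB => //; apply: cvgM => //; exact: cvg_cst.
Qed.

(** Supported in the vertical strip of half-width 2^-k around [t]; it replaces the indicator of a
    point or a line by a function of finite energy. *)
Definition tent t k (z : R * R) : R := Num.max 0 (1 - 2 ^+ k * `|z.1 - t|).

Lemma tent_ge0 t k z : 0 <= tent t k z.
Proof. by rewrite le_max lexx. Qed.

Lemma tent_le1 t k z : tent t k z <= 1.
Proof. by rewrite ge_max ler01 gerBl mulr_ge0// exprn_ge0. Qed.

Lemma tent_center k z : tent z.1 k z = 1.
Proof. by rewrite /tent subrr normr0 mulr0 subr0 max_r. Qed.

Lemma tent_dom t k : dom (cembed (tent t k)).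
Proof.
apply: (dom_lipschitz hs hX (L := 2 ^+ k)) => x y _ _.
rewrite /cembed -rmorphB rnorm_real mulrDr.
have p2 : (0 : R) < 2 ^+ k by rewrite exprn_gt0.
have h : `|2 ^+ k * `|x.1 - t| - 2 ^+ k * `|y.1 - t| | <= 2 ^+ k * `|x.1 - y.1|.
  rewrite -mulrBr normrM (gtr0_norm p2) ler_pM2l//.
  by rewrite (le_trans (ler_dist_dist _ _))// opprB addrA subrK.
have p3 : 0 <= 2 ^+ k * `|x.2 - y.2| by rewrite mulr_ge0// ltW.
move: h; rewrite /tent; set a := 2 ^+ k * `|x.1 - t|; set b := 2 ^+ k * `|y.1 - t|.
rewrite ler_norml => /andP[h1 h2].
rewrite ler_norml /Num.max; case: (ltP 0 (1 - a)) => h3; case: (ltP 0 (1 - b)) => h4;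
  by apply/andP; split; lra.
Qed.

(* Telescoping against a truncation of the first coordinate counts the edges
   that meet a thin vertical strip. *)
Lemma wsum_ravg_tent t k n : (k < n)%N ->
  wsum n (ravg (tent t k)) [::] <= 4 ^+ n * (2 * 2^-1 ^+ k).
Proof.
move=> kn; set r : R := 2 * 2^-1 ^+ k.
(* The level [r] is twice the half-width of the strip. As [d <= 2^-k], an edge with one end in the
   strip has both ends where [G] is not truncated, and there [G] grows by exactly [d]. On the other
   edges [G] does not decrease from left to right. *)
pose G (z : R * R) : R := Num.max (- r) (Num.min r (z.1 - t)).
have r0 : 0 < r by rewrite mulr_gt0// exprn_gt0.
pose d : R := 2 * 2^-1 ^+ n.
have d0 : 0 < d by rewrite mulr_gt0// exprn_gt0.
have dk : d <= 2^-1 ^+ k.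
  have -> : d = 2^-1 ^+ (n - k.+1) * 2^-1 ^+ k.
    by rewrite /d -{1}(subnK kn) exprD exprS; field.
  rewrite ger_pMl ?exprn_gt0//.
  by rewrite exprn_ile1// invf_le1// ler1n.
have edge v : size v = n -> ravg (tent t k) v * d <= - D G v.
  move=> sv; have := rpt_sub_lpt s v; rewrite sv -/d /ravg /incr /G /tent.
  set a := (lpt s v).1; set b := (rpt s v).1 => ab.
  have k0 : (0 : R) < 2 ^+ k by rewrite exprn_gt0.
  have kk : 2 ^+ k * 2^-1 ^+ k = 1 :> R by rewrite -exprMn divff// expr1n.
  have near (z : R) : 2^-1 ^+ k <= `|z - t| -> 1 - 2 ^+ k * `|z - t| <= 0.
    by rewrite -(ler_pM2l k0) kk subr_le0.
  have far (z : R) : `|z - t| < 2^-1 ^+ k -> 0 <= 1 - 2 ^+ k * `|z - t|.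
    by rewrite -(ltr_pM2l k0) kk subr_ge0 => /ltW.
  have le1 (z : R) : 1 - 2 ^+ k * `|z - t| <= 1 by rewrite gerBl mulr_ge0// ltW.
  have [ha|ha] := ltP `|a - t| (2^-1 ^+ k); have [hb|hb] := ltP `|b - t| (2^-1 ^+ k).
  - have fa := far _ ha; have fb := far _ hb; have la := le1 a; have lb := le1 b.
    rewrite !max_r//; last 2 first.
    + by rewrite le_min; move: ha; rewrite ltr_norml => /andP[? ?]; apply/andP; split; rewrite /r; lra.
    + by rewrite le_min; move: hb; rewrite ltr_norml => /andP[? ?]; apply/andP; split; rewrite /r; lra.
    rewrite !min_r; last 2 first.
    + by move: hb; rewrite ltr_norml => /andP[? ?]; rewrite /r; lra.
    + by move: ha; rewrite ltr_norml => /andP[? ?]; rewrite /r; lra.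
    have -> : - (a - t - (b - t)) = 1 * d by lra.
    by rewrite ler_wpM2r ?(ltW d0)//; lra.
  - have fa := far _ ha; have fb := near _ hb; have la := le1 a.
    move: ha; rewrite ltr_norml => /andP[a1 a2].
    have b1 : b - t <= r by rewrite /r; lra.
    have b2 : - r <= b - t by rewrite /r; lra.
    have a3 : a - t <= r by rewrite /r; lra.
    have a4 : - r <= a - t by rewrite /r; lra.
    rewrite (min_r a3) (min_r b1) (max_r a4) (max_r b2) (max_r fa) (max_l fb).
    have -> : - (a - t - (b - t)) = 1 * d by lra.
    by rewrite ler_wpM2r ?(ltW d0)//; lra.
  - have fa := near _ ha; have fb := far _ hb; have lb := le1 b.
    move: hb; rewrite ltr_norml => /andP[b1' b2'].
    have b1 : b - t <= r by rewrite /r; lra.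
    have b2 : - r <= b - t by rewrite /r; lra.
    have a3 : a - t <= r by rewrite /r; lra.
    have a4 : - r <= a - t by rewrite /r; lra.
    rewrite (min_r a3) (min_r b1) (max_r a4) (max_r b2) (max_l fa) (max_r fb).
    have -> : - (a - t - (b - t)) = 1 * d by lra.
    by rewrite ler_wpM2r ?(ltW d0)//; lra.
  - rewrite (max_l (near _ ha)) (max_l (near _ hb)) addr0 mul0r mul0r opprB subr_ge0.
    rewrite ge_max le_max lexx /= le_max; apply/orP; right.
    by rewrite le_min ge_min lexx /= ge_min; apply/orP; right; lra.
have h : wsum n (ravg (tent t k)) [::] * d <= 2 ^+ n * (2 * r).
  rewrite -wsum_mulr; apply: (@le_trans _ _ (wsum n (fun v => - D G v) [::])).
    by apply: le_wsum_pre => v; exact: edge.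
  rewrite wsumN wsum_incr -[_ *+ (2 ^ n)]mulr_natl natrX -mulrN ler_wpM2l ?exprn_ge0//.
  have Gr z : - r <= G z <= r.
    by rewrite /G ge_max le_max lexx /= ge_min lexx /=; apply/andP; split => //; lra.
  by rewrite /incr opprB; have := Gr (rpt s [::]); have := Gr (lpt s [::]) => /andP[? ?] /andP[? ?]; lra.
have k0 : (0 : R) < 2 ^+ n by rewrite exprn_gt0.
rewrite -(ler_pM2r d0) (le_trans h)// le_eqVlt; apply/orP; left; apply/eqP.
have n2 : 2 ^+ n * 2^-1 ^+ n = 1 :> R by rewrite -exprMn divff// expr1n.
rewrite /d (_ : 4 ^+ n = 2 ^+ n * 2 ^+ n :> R); last by rewrite -exprMn; congr (_ ^+ _); ring.
rewrite -[LHS]mulr1 -[X in _ * X = _]n2; ring.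
Qed.

(** No energy concentrates on vertical lines. Fix N such that all finer levels add less than e/4 to
    the energy. Below level N an increment is 2^-(n-N) times that of its N-cell plus a residual. The
    residuals cost at most e/2, and by the strip count the main parts cost at most 4 M 4^N 2^-k,
    which is small for large k independently of n. *)
Lemma energy_tent_small h t e : dom h -> 0 < e ->
  exists K, forall k, (K <= k)%N -> \int[Gamma h]_(x in X) tent t k x <= e.
Proof.
move=> dh e0.
have [N hN] : exists N, energy s h - wsum N (sq h) [::] < e / 4.
  have /cvgrPdist_lt /(_ (e / 4)) := energy_cvg hs dh.
  rewrite divr_gt0// => /(_ isT) [N _ /(_ N (leqnn N)) /=].
  by exists N; rewrite (le_lt_trans (ler_norm _)).
pose M := energy s h.
have M0 : 0 <= M := energy_ge0 hs dh.
have [K hK] := half_expn_small (4 * M * 4 ^+ N) (ltac:(by rewrite divr_gt0) : 0 < e / 2).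
exists K => k Kk.
apply: (cvg_le_near (energy_measure_cvg dh (tent_dom t k))).
exists (maxn N k.+1) => // n /=; rewrite geq_max => /andP[Nn kn].
have res : wsum N (fun w => wsum (n - N) (fun v => rnorm (D h v - (2^-1 ^+ (n - N))%:C * D h w) ^+ 2) w)
    [::] = wsum n (sq h) [::] - wsum N (sq h) [::].
  under eq_wsum do rewrite wsum_residual.
  by rewrite wsumB -wsumD subnKC.
have res_lt : wsum n (sq h) [::] - wsum N (sq h) [::] <= e / 4.
  by have := le_energy hs n dh; lra.
have sqM w : size w = N -> sq h w <= M.
  move=> sw; apply: le_trans (le_energy hs N dh).
  have := @wsum_le_total R N 0 (sq h) w sw (sqincr_ge0 s h); rewrite addn0; exact.
pose q : R := 2^-1 ^+ (n - N).
have step : wsum n (fun v => sq h v * ravg (tent t k) v) [::] <=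
    2 * (e / 4) + 2 * M * q ^+ 2 * wsum n (ravg (tent t k)) [::].
  rewrite -[n in X in X <= _](subnKC Nn) wsumD.
  apply: (@le_trans _ _ (wsum N (fun w => wsum (n - N) (fun v =>
      2 * rnorm (D h v - q%:C * D h w) ^+ 2 + 2 * M * q ^+ 2 * ravg (tent t k) v) w) [::])).
    apply: le_wsum_pre => w sw; apply: le_wsum => v /=.
    have t0 : 0 <= ravg (tent t k) v.
      by rewrite /ravg divr_ge0// addr_ge0// tent_ge0.
    have t1 : ravg (tent t k) v <= 1.
      have := tent_le1 t k (lpt s v); have := tent_le1 t k (rpt s v); rewrite /ravg; lra.
    have r0 : 0 <= rnorm (D h v - q%:C * D h w) ^+ 2 by exact: sqr_ge0.
    have := le_rnormD_sqr (D h v - q%:C * D h w) (q%:C * D h w); rewrite subrK.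
    rewrite rnormM rnorm_real ger0_norm ?exprn_ge0// exprMn -/(sq h w) -/(sq h v) => hv.
    have := sqM w sw => sM; have q0 : 0 <= q ^+ 2 by exact: sqr_ge0.
    have : sq h v <= 2 * rnorm (D h v - q%:C * D h w) ^+ 2 + 2 * (q ^+ 2 * M).
      by rewrite (le_trans hv)// lerD2l ler_pM2l// ler_wpM2l.
    move=> /(ler_wpM2r t0) /le_trans; apply.
    rewrite mulrDl lerD//; last by rewrite le_eqVlt; apply/orP; left; apply/eqP; ring.
    by apply: ler_piMr => //; rewrite mulr_ge0.
  under eq_wsum do rewrite wsum_add !wsum_mull.
  rewrite wsum_add !wsum_mull -wsumD subnKC// lerD2r ler_pM2l//.
  by rewrite res.
apply: (le_trans step).
have := ler_wpM2l (mulr_ge0 (mulr_ge0 (ler0n R 2) M0) (sqr_ge0 q)) (wsum_ravg_tent t kn).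
have : 2 * M * q ^+ 2 * (4 ^+ n * (2 * 2^-1 ^+ k)) <= e / 2; last by lra.
have -> : 4 ^+ n = 4 ^+ N * 4 ^+ (n - N) :> R by rewrite -exprD subnKC.
have q4 : q ^+ 2 * 4 ^+ (n - N) = 1.
  by rewrite /q -exprM mulnC exprM -exprMn (_ : _ * 4 = 1) ?expr1n//; field.
have -> : 2 * M * q ^+ 2 * (4 ^+ N * 4 ^+ (n - N) * (2 * 2^-1 ^+ k)) =
  (4 * M * 4 ^+ N * 2^-1 ^+ k) * (q ^+ 2 * 4 ^+ (n - N)) by ring.
rewrite q4 mulr1; apply: le_trans (ltW hK).
by rewrite ler_wpM2l ?mulr_ge0 ?exprn_ge0// ler_wiXn2l// invf_le1// ler1n.
Qed.

Lemma fin_measure_point0 (nu : {measure set (R * R) -> \bar R}) z : X z -> (nu X < +oo)%E ->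
  (forall e, 0 < e -> fine (nu [set z]) <= e) -> nu [set z] = 0%E.
Proof.
move=> Xz fX h.
have fz : nu [set z] \is a fin_num.
  rewrite ge0_fin_numE//; apply: le_lt_trans fX; apply: le_measure; rewrite ?in_setE//.
    exact: measurable_point.
  by move=> _ ->.
rewrite -(fineK fz); congr EFin; apply/eqP; rewrite eq_le fine_ge0// andbT.
by apply/ler_addgt0Pr => e e0; rewrite add0r h.
Qed.

(** The tent centred at the first coordinate of [z] equals 1 at [z] and has an arbitrarily small
    integral. *)
Lemma energy_measure_point0 h z : dom h -> X z -> Gamma h [set z] = 0%E.
Proof.
move=> dh Xz; have fX := energy_measure_fin dh.
apply: fin_measure_point0 => // e e0.
have [K /(_ K (leqnn K)) hK] := energy_tent_small z.1 dh e0.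
apply: le_trans hK.
have -> : [set z] = [set z] `&` X by apply/seteqP; split=> [y ->|y []].
rewrite -(integral_indic (Gamma h) mX (measurable_point z)).
apply: (le_Rintegral (f1 := \1_[set z])) => //.
- exact: (rbounded_integrable mX fX (rbounded_indic X (measurable_point z))).
- exact: (rbounded_integrable mX fX (dom_rbounded (tent_dom _ _))).
- move=> x Xx; rewrite indicE; case: (boolP (x \in _)) => [/set_mem ->|_]; last exact: tent_ge0.
  by rewrite tent_center.
Qed.

Lemma vertices_null (nu : {measure set (R * R) -> \bar R}) m :
  (forall z, X z -> nu [set z] = 0%E) -> nu (vertices s m) = 0%E /\ measurable (vertices s m).
Proof.
move=> nu0; have -> : vertices s m = \bigcup_(z in vertices s m) [set z].
  by apply/seteqP; split=> [z vz|z [y vy ->]//]; exists z.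
have fv := finite_vertices s m.
split; last by apply: fin_bigcup_measurable => // z _; exact: measurable_point.
rewrite measure_fin_bigcup//; last 2 first.
- by move=> a b _ _ [x [/= -> ->]].
- by move=> z _; exact: measurable_point.
rewrite fsbig1// => z /verticesP[w /orP[]/eqP ->]; apply: nu0.
  exact: fractal_lpt.
exact: fractal_rpt.
Qed.

Lemma cell_overlap_vertices m (w v : m.-tuple 'I_4) z : w != v -> cell s X w z -> cell s X v z ->
  vertices s m z.
Proof.
move=> wv wz vz; apply/verticesP; exists w.
have := cell_meet hs hX (ltac:(by rewrite !size_tuple) : size w = size v) wv wz vz.
by move=> [] ->; [exact: at_lpt|exact: at_rpt].
Qed.

(** [phi] times the cell indicator need not be continuous at the two ends of the cell. Multiplying
    [phi] by one minus a tent at each end makes it vanish there, so its extension by zero has finite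
    energy and the global limit applies. The error, both in the integral and in the sums, is
    controlled by the integrals of the two tents. *)
Lemma energy_measure_cell_cvg h phi w : dom h -> dom (cembed phi) ->
  wsum n (fun v => sq h v * ravg phi v) w @[n --> \oo] -->
  \int[Gamma h]_(x in X) (\1_(cell s X w) x * phi x).
Proof.
move=> dh dphi; have fX := energy_measure_fin dh.
set m := size w; pose W := in_tuple w.
have [M M0 hM] := dom_bounded hX dphi.
have rphi := dom_rbounded dphi.
pose P k := tent (lpt s w).1 k; pose Q k := tent (rpt s w).1 k.
pose phik k z := phi z * ((1 - P k z) * (1 - Q k z)).
have dphik k : dom (cembed (phik k)).
  have h1 t : dom (fun z => 1 - cembed (tent t k) z).
    by apply: domB => //; [exact: dom_cst|exact: tent_dom].
  have := domM hs hX dphi (domM hs hX (h1 (lpt s w).1) (h1 (rpt s w).1)).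
  by congr (dom _); apply: funext => z; rewrite /cembed /phik !rmorphM !rmorphB !rmorph1.
have phik_l k : phik k (lpt s w) = 0 by rewrite /phik /P tent_center subrr mul0r mulr0.
have phik_r k : phik k (rpt s w) = 0 by rewrite /phik /Q tent_center subrr !mulr0.
have diff k z : X z -> `|phi z - phik k z| <= M * (P k z + Q k z).
  move=> Xz; rewrite (_ : _ - _ = phi z * (P k z + Q k z - P k z * Q k z)); last by rewrite /phik; ring.
  rewrite normrM; have := hM z Xz; rewrite rnorm_real => hz.
  have := tent_ge0 (lpt s w).1 k z; have := tent_le1 (lpt s w).1 k z; rewrite -/(P k z) => P1 P0.
  have := tent_ge0 (rpt s w).1 k z; have := tent_le1 (rpt s w).1 k z; rewrite -/(Q k z) => Q1 Q0.
  have PQ : 0 <= P k z + Q k z - P k z * Q k z by nra.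
  rewrite (ger0_norm PQ) ler_pM//.
  by rewrite gerBl mulr_ge0.
have main k : wsum n (fun v => sq h v * ravg (phik k) v) w @[n --> \oo] -->
    \int[Gamma h]_(x in X) (\1_(cell s X w) x * phik k x).
  pose G (v : m.-tuple 'I_4) : cfun R := if v == W then cembed (phik k) else fun=> 0.
  have dG (v : m.-tuple 'I_4) : dom (G v) by rewrite /G; case: ifP => // _; exact: dom_cst.
  have GW (v : m.-tuple 'I_4) z : v != W -> cell s X v z -> cell s X w z -> cembed (phik k) z = 0.
    move=> vW vz wz; rewrite /cembed; have := @cell_meet _ _ _ hs hX w v z.
    rewrite size_tuple eq_sym => /(_ erefl vW wz vz)[] ->; rewrite ?phik_l ?phik_r//.
  have [v v' z vz v'z|g dg gG] := dom_paste_exists hs hX dG.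
    rewrite /G; case: eqP => [e|/eqP e]; case: eqP => [e'|/eqP e'] //.
      by apply: (GW v') => //; move: vz; rewrite e.
    by apply/esym; apply: (GW v) => //; move: v'z; rewrite e'.
  have g_in z : cell s X w z -> g z = cembed (phik k) z.
    by move=> wz; rewrite (gG W)// /G eqxx.
  have g_out (v : m.-tuple 'I_4) z : v != W -> cell s X v z -> g z = 0.
    by move=> vW vz; rewrite (gG v)// /G (negbTE vW).
  have -> : \int[Gamma h]_(x in X) (\1_(cell s X w) x * phik k x) =
      \int[Gamma h]_(x in X) Re (g x).
    apply: eq_Rintegral => x /set_mem Xx; rewrite indicE.
    case: (boolP (x \in _)) => [/set_mem wx|/negP nx]; first by rewrite mul1r g_in.
    have [v vx] := cell_cover hX m Xx; rewrite mul0r (g_out v)//.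
    by apply/eqP => e; apply: nx; apply/mem_set; move: vx; rewrite e.
  have := cvg_shift_left m (energy_measure_cvg dh (dom_Re hs hX dg)).
  apply: cvg_trans; apply: near_eq_cvg; apply: nearW => n /=.
  rewrite wsumD wsum_nil (bigD1 W)//= big1 ?addr0.
    apply: eq_wsum_pre => v _; rewrite /ravg !g_in//.
      by apply: (cell_cat_sub hX (v := v)); exact: cell_rpt.
    by apply: (cell_cat_sub hX (v := v)); exact: cell_lpt.
  move=> v vW; rewrite -[RHS](wsum0 _ n v); apply: eq_wsum_pre => u _.
  rewrite /ravg !(g_out v)//=; first by rewrite addr0 mul0r mulr0.
    by apply: (cell_cat_sub hX (v := u)); exact: cell_rpt.
  by apply: (cell_cat_sub hX (v := u)); exact: cell_lpt.
apply/cvgrPdist_le => e e0.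
(* Errors of e/8 for the cut-off limit, e/4 for the integrals and e/2 for the sums stay below e;
   [M + 1] avoids a division by zero. *)
have e1 : 0 < e / 8 / (M + 1) by rewrite !divr_gt0// ltr_wpDl.
have [K1 hK1] := energy_tent_small (lpt s w).1 dh e1.
have [K2 hK2] := energy_tent_small (rpt s w).1 dh e1.
pose k := maxn K1 K2.
have IP : \int[Gamma h]_(x in X) P k x <= e / 8 / (M + 1) by apply: hK1; exact: leq_maxl.
have IQ : \int[Gamma h]_(x in X) Q k x <= e / 8 / (M + 1) by apply: hK2; exact: leq_maxr.
have Me : M * (e / 8 / (M + 1)) <= e / 8.
  rewrite mulrCA ger_pMr ?divr_gt0// ler_pdivrMr ?ltr_wpDl// mul1r; lra.
have cP := energy_measure_cvg dh (tent_dom (lpt s w).1 k).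
have cQ := energy_measure_cvg dh (tent_dom (rpt s w).1 k).
have e2 : e / 8 / (M + 1) < e / 4 / (M + 1) by rewrite ltr_pM2r ?invr_gt0 ?ltr_wpDl//; lra.
have Me2 : M * (e / 4 / (M + 1)) <= e / 4.
  rewrite mulrCA ger_pMr ?divr_gt0// ler_pdivrMr ?ltr_wpDl// mul1r; lra.
have cP' := cvg_shift_left m cP; have cQ' := cvg_shift_left m cQ.
have := main k => /cvgrPdist_le /(_ (e / 8)).
rewrite divr_gt0// => /(_ isT) hmain.
near=> n.
have lP : wsum (m + n) (fun v => sq h v * ravg (P k) v) [::] <= e / 4 / (M + 1).
  by near: n; apply: (cvgr_le _ cP'); exact: le_lt_trans IP e2.
have lQ : wsum (m + n) (fun v => sq h v * ravg (Q k) v) [::] <= e / 4 / (M + 1).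
  by near: n; apply: (cvgr_le _ cQ'); exact: le_lt_trans IQ e2.
have lm : `|\int[Gamma h]_(x in X) (\1_(cell s X w) x * phik k x) -
    wsum n (fun v => sq h v * ravg (phik k) v) w| <= e / 8 by near: n.
have rP : rbounded X (P k) by apply: dom_rbounded; exact: tent_dom.
have rQ : rbounded X (Q k) by apply: dom_rbounded; exact: tent_dom.
have rk : rbounded X (phik k) by exact: dom_rbounded.
have r1 : rbounded X (\1_(cell s X w) : R * R -> R) by apply: rbounded_indic => //; exact: measurable_cell.
have d1 : `|\int[Gamma h]_(x in X) (\1_(cell s X w) x * phi x) -
    \int[Gamma h]_(x in X) (\1_(cell s X w) x * phik k x)| <= e / 4.
  rewrite -RintegralB//; try by apply: rbounded_integrable => //; exact: rboundedM.
  apply: (@le_trans _ _ (\int[Gamma h]_(x in X) (M * (P k x + Q k x)))).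
    apply: le_norm_Rintegral => //.
    - by apply: rboundedB => //; exact: rboundedM.
    - by apply: rboundedM => //; [exact: rbounded_cst|exact: rboundedD].
    - move=> x Xx; rewrite -mulrBr normrM indicE.
      case: (x \in _); rewrite ?normr1 ?mul1r ?diff// normr0 mul0r.
      by rewrite mulr_ge0// addr_ge0// tent_ge0.
  rewrite RintegralZl//; last by apply: rbounded_integrable => //; exact: rboundedD.
  rewrite RintegralD//; try exact: rbounded_integrable.
  have := ler_wpM2l M0 IP; have := ler_wpM2l M0 IQ; lra.
have d2 : `|wsum n (fun v => sq h v * ravg phi v) w - wsum n (fun v => sq h v * ravg (phik k) v) w|
    <= e / 2.
  rewrite -wsumB.
  apply: (@le_trans _ _ (wsum n (fun v => M * (sq h v * ravg (P k) v + sq h v * ravg (Q k) v)) w)).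
    rewrite wsum_tuple (le_trans (ler_norm_sum _ _ _))// wsum_tuple; apply: ler_sum => v _.
    rewrite -mulrBr normrM (ger0_norm (sqincr_ge0 _ _ _)).
    have -> : M * (sq h (w ++ v) * ravg (P k) (w ++ v) + sq h (w ++ v) * ravg (Q k) (w ++ v)) =
      sq h (w ++ v) * (M * (ravg (P k) (w ++ v) + ravg (Q k) (w ++ v))) by ring.
    rewrite ler_wpM2l ?sqincr_ge0// /ravg.
    have := diff k _ (fractal_lpt hs hX (w ++ v)); have := diff k _ (fractal_rpt hs hX (w ++ v)).
    by rewrite !ler_norml => /andP[? ?] /andP[? ?]; apply/andP; split; lra.
  rewrite wsum_mull wsum_add.
  have tot t : wsum n (fun v => sq h v * ravg (tent t k) v) w <=
      wsum (m + n) (fun v => sq h v * ravg (tent t k) v) [::].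
    apply: wsum_le_total => // v; rewrite mulr_ge0 ?sqincr_ge0// /ravg divr_ge0// addr_ge0// tent_ge0//.
  have lP' := le_trans (tot (lpt s w).1) lP; have lQ' := le_trans (tot (rpt s w).1) lQ.
  have := ler_wpM2l M0 lP'; have := ler_wpM2l M0 lQ'; rewrite /P /Q; lra.
move: lm d1 d2; rewrite !ler_norml => /andP[? ?] /andP[? ?] /andP[? ?]; apply/andP; split; lra.
Unshelve. all: by end_near. Qed.

(** The limits in [energy_measure_cvg] see a function only through its squared increments. This
    applies to a function and its conjugate. *)
Lemma energy_measure_eq h g B : dom h -> dom g -> (forall v, sq h v = sq g v) ->
  measurable B -> Gamma h B = Gamma g B.
Proof.
move=> dh dg hg mB.
have [_ z1 _] := hGamma dh; have [_ z2 _] := hGamma dg.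
apply: (measure_eq_lipschitz mX) => //; try exact: energy_measure_fin.
move=> phi L hphi.
have dphi : dom (cembed phi).
  by apply: (dom_lipschitz hs hX (L := L)) => x y _ _; rewrite /cembed -rmorphB rnorm_real hphi.
apply: (cvg_unique _ (energy_measure_cvg dh dphi)) => //.
rewrite (_ : (fun n => _) = fun n => wsum n (fun v => sq g v * ravg phi v) [::]).
  exact: energy_measure_cvg.
by apply: funext => n; apply: eq_wsum => v; rewrite hg.
Qed.

End EnergyMeasures.

(** * The Hilbert space of 1-forms *)

Section OneFormAlgebra.
Context {R : realType}.
Variables (s : R) (X : set (R * R)).
Hypotheses (hs : 0 < s <= 8^-1) (hX : is_diamond_fractal s X).
Variable Gamma : cfun R -> {measure set (R * R) -> \bar R}.
Hypothesis hGamma : is_energy_measures s X Gamma.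
Variable H : one_forms s X Gamma.
Implicit Types (f g h p q : cfun R) (w v : seq 'I_4) (a b c : H) (k : R[i]).
Local Notation dom := (in_domain s X).
Local Notation bb := (bounded_borel X).
Local Notation dot := (form_dot H).
Local Notation mul := (form_mul H).

Let mX : measurable X. Proof. exact: measurable_fractal hX. Qed.

Lemma dotDl a b c : dot (a + b) c = dot a c + dot b c. Proof. exact: linearDl. Qed.
Lemma dotDr a b c : dot a (b + c) = dot a b + dot a c. Proof. exact: linearDr. Qed.
Lemma dotBl a b c : dot (a - b) c = dot a c - dot b c. Proof. exact: linearBl. Qed.
Lemma dotBr a b c : dot a (b - c) = dot a b - dot a c. Proof. exact: linearBr. Qed.
Lemma dotZl k a b : dot (k *: a) b = k * dot a b. Proof. exact: linearZl_LR. Qed.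
Lemma dotZr k a b : dot a (k *: b) = conjc k * dot a b. Proof. exact: linearZr_LR. Qed.
Lemma dot0r a : dot a 0 = 0. Proof. exact: linear0r. Qed.
Lemma dot_suml (I : Type) (r : seq I) (P : pred I) (F : I -> H) b :
  dot (\sum_(i <- r | P i) F i) b = \sum_(i <- r | P i) dot (F i) b.
Proof. exact: linear_sumlz. Qed.
Lemma dot_sumr (I : Type) (r : seq I) (P : pred I) (F : I -> H) b :
  dot b (\sum_(i <- r | P i) F i) = \sum_(i <- r | P i) dot b (F i).
Proof. exact: linear_sumr. Qed.
Lemma dotC a b : dot a b = conjc (dot b a).
Proof. by rewrite hermC expr0 mul1r. Qed.
Lemma dot_norm a : dot a a = (rnorm a ^+ 2)%:C.
Proof. by rewrite -form_norm_dot rnormE rmorphXn. Qed.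

Lemma dot_self_eq0 a : dot a a = 0 -> a = 0.
Proof.
rewrite dot_norm => /(congr1 (@complex.Re R)) /= /eqP; rewrite sqrf_eq0 => /eqP.
exact: rnorm0_eq0.
Qed.

Lemma dot_CauchySchwarz a b : rnorm (dot a b) <= rnorm a * rnorm b.
Proof.
have [b0|b0] := eqVneq (rnorm b) 0.
  by rewrite (rnorm0_eq0 b0) dot0r rnorm0 rnorm0 mulr0.
have bp : 0 < rnorm b by rewrite lt_def b0 rnorm_ge0.
set n := rnorm b ^+ 2; have n0 : 0 < n by rewrite exprn_gt0.
have : 0 <= n * (n * rnorm a ^+ 2 - rnorm (dot a b) ^+ 2).
  have -> : n * (n * rnorm a ^+ 2 - rnorm (dot a b) ^+ 2) =
      rnorm (n%:C *: a - dot a b *: b) ^+ 2; last exact: sqr_ge0.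
    apply: complexI; rewrite -dot_norm !(dotBl, dotBr, dotZl, dotZr) !dot_norm -/n (dotC b a).
    have e (x y : R) : (n * (n * x - y))%:C = n%:C * (n%:C * x%:C - y%:C).
      by apply: complexP; rewrite !complex_simp /=; ring.
    rewrite e rnorm_sqrE conjc_real; ring.
rewrite pmulr_rge0// subr_ge0 => h.
rewrite -[leLHS]ger0_norm ?rnorm_ge0// -ler_sqr ?nnegrE ?mulr_ge0 ?rnorm_ge0//.
by rewrite exprMn mulrC ger0_norm ?rnorm_ge0.
Qed.

Definition ctn (phi : H -> R[i]) := forall a e, 0 < e ->
  exists2 d : R, 0 < d & forall b, rnorm (a - b) < d -> rnorm (phi a - phi b) < e.

Lemma tensor_sums_dense a (e : R) : 0 < e ->
  exists2 t : H, tensor_sums s X (tensor H) (fun _ => True) t & rnorm (a - t) < e.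
Proof.
move=> e0; have : closure (tensor_sums s X (tensor H) (fun=> True)) a by rewrite tensor_dense.
move=> /(_ (ball a e%:C)) []; first by apply: nbhsx_ballx; rewrite ltcR.
move=> t [ht]; rewrite -ball_normE /= rnormE ltcR => lt.
by exists t.
Qed.

Lemma ctn_eq0 phi : ctn phi ->
  (forall t, tensor_sums s X (tensor H) (fun _ => True) t -> phi t = 0) -> forall a, phi a = 0.
Proof.
move=> cphi h a; apply: rnorm0_eq0; apply/eqP; rewrite eq_le rnorm_ge0 andbT.
apply/ler_addgt0Pr => e e0; have [d d0 hd] := cphi a e e0.
have [t ht /hd] := tensor_sums_dense a d0.
by rewrite (h t ht) subr0 add0r => /ltW.
Qed.

Lemma mul_ctn h a (e : R) : bb h -> 0 < e ->
  exists2 d : R, 0 < d & forall b, rnorm (a - b) < d -> rnorm (mul h a - mul h b) < e.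
Proof.
move=> bh e0; have /cvgrPdist_lt /(_ e%:C) := @form_mul_continuous _ _ _ _ H h bh a.
rewrite ltcR => /(_ e0) /nbhs_ballP [[d1 d2]] /=.
rewrite ltcE /= => /andP[/eqP -> d0] hd; exists d1 => // b ab.
have := hd b; rewrite -ball_normE /= rnormE (_ : d1 +i* 0 = d1%:C)// ltcR => /(_ ab).
by rewrite rnormE ltcR.
Qed.

Lemma ctn_dotl (L : {linear H -> H}) c :
  (forall a (e : R), 0 < e ->
    exists2 d : R, 0 < d & forall b, rnorm (a - b) < d -> rnorm (L a - L b) < e) ->
  ctn (fun a => dot (L a) c).
Proof.
move=> cL a e e0; have c1 : 0 < rnorm c + 1 by rewrite ltr_wpDl ?rnorm_ge0.
have [d d0 hd] := cL a _ (ltac:(by rewrite divr_gt0) : 0 < e / (rnorm c + 1)).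
exists d => // b /hd; rewrite ltr_pdivlMr// => h.
rewrite -dotBl; apply: le_lt_trans (dot_CauchySchwarz _ _) _.
by apply: le_lt_trans h; rewrite ler_wpM2l ?rnorm_ge0// lerDl.
Qed.

Lemma ctn_idl c : ctn (fun a => dot a c).
Proof. by apply: (ctn_dotl (L := idfun)) => a e e0; exists e. Qed.

Lemma ctn_mull h c : bb h -> ctn (fun a => dot (mul h a) c).
Proof. by move=> bh; apply: ctn_dotl => a e e0; exact: mul_ctn. Qed.

Lemma ctn_conj phi : ctn phi -> ctn (fun a => conjc (phi a)).
Proof.
move=> cp a e e0; have [d d0 hd] := cp a e e0; exists d => // b /hd.
by rewrite -rmorphB rnormJ.
Qed.

Lemma ctnB phi psi : ctn phi -> ctn psi -> ctn (fun a => phi a - psi a).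
Proof.
move=> c1 c2 a e e0; have e2 : 0 < e / 2 by rewrite divr_gt0.
have [d d0 hd] := c1 a _ e2; have [d' d0' hd'] := c2 a _ e2.
exists (Num.min d d'); first by rewrite lt_min d0.
move=> b; rewrite lt_min => /andP[/hd h1 /hd' h2].
have -> : phi a - psi a - (phi b - psi b) = (phi a - phi b) - (psi a - psi b) by ring.
by rewrite (le_lt_trans (rnormB _ _))//; lra.
Qed.

(** Tensors span a dense subspace and the inner product is definite, so an identity between 1-forms
    only has to be tested on tensors. *)
Lemma eq_dot_dense a b :
  (forall p q, dom p -> bb q -> dot a (tensor H p q) = dot b (tensor H p q)) -> a = b.
Proof.
move=> h; apply/eqP; rewrite -subr_eq0; apply/eqP; apply: dot_self_eq0.
have key c : dot c (a - b) = 0.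
  apply: (ctn_eq0 (ctn_idl (a - b))) => _ [n [p [q [hpq ->]]]].
  rewrite dot_suml big1// => i _; have [dp bq _ _] := hpq i.
  by rewrite dotC dotBl h// subrr conjc0.
exact: key.
Qed.

(** The integral of [phi] against the complex measure Gamma(p, q), obtained by polarizing Gamma(h,
    h). *)
Definition cform (phi : cfun R) p q : R[i] :=
  polarize (fun h => cintegral (Gamma h) X phi) p q.

Lemma dot_tensor f g p q : dom f -> bb g -> dom p -> bb q ->
  dot (tensor H f g) (tensor H p q) = cform (fun x => g x * conjc (q x)) f p.
Proof. exact: form_dot_tensor. Qed.

Let dom_comb p q k : dom p -> dom q -> dom (fun x => p x + k * q x).
Proof. by move=> dp dq; apply: (domD hs hX) => //; exact: (domZ hs hX). Qed.

Lemma cformD phi psi p q : bb phi -> bb psi -> dom p -> dom q ->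
  cform (fun x => phi x + psi x) p q = cform phi p q + cform psi p q.
Proof.
move=> bp bq dp dq; rewrite /cform /polarize -mulrDr -big_split /=; congr (_ * _).
apply: eq_bigr => k _; rewrite -mulrDr cintegralD//.
by apply: (energy_measure_fin hGamma); exact: dom_comb.
Qed.

Lemma cformZ k phi p q : bb phi -> dom p -> dom q ->
  cform (fun x => k * phi x) p q = k * cform phi p q.
Proof.
move=> bp dp dq; rewrite /cform /polarize [RHS]mulrCA; congr (_ * _); rewrite mulr_sumr.
apply: eq_bigr => i _; rewrite cintegralZ//; first by rewrite mulrCA.
by apply: (energy_measure_fin hGamma); exact: dom_comb.
Qed.

(** Vertices are null for each of the four energy measures in the polarization. *)
Lemma cform_eq_off m phi psi p q : bb phi -> bb psi -> dom p -> dom q ->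
  (forall x, X x -> ~ vertices s m x -> phi x = psi x) -> cform phi p q = cform psi p q.
Proof.
move=> b1 b2 dp dq h; rewrite /cform /polarize; congr (_ * _).
apply: eq_bigr => i _; congr (_ * _); apply/eqP; rewrite -subr_eq0; apply/eqP.
set e := fun x => p x + _; have de : dom e by exact: dom_comb.
have fe := energy_measure_fin hGamma de.
rewrite -mulN1r -cintegralZ// -cintegralD//; last exact: bborelZ.
have [n0 mV] := vertices_null hs hX m (fun z Xz => energy_measure_point0 hs hX hGamma de Xz).
apply: (cintegral_null mX fe mV n0); first by apply: bborelD => //; exact: bborelZ.
by move=> x Xx Vx; rewrite h// mulN1r subrr.
Qed.

(** Only inner products of tensors are prescribed; linearity in the second argument is recovered by
    testing. *)
Lemma tensor_comb p q q' k : dom p -> bb q -> bb q' ->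
  tensor H p (fun x => q x + k * q' x) = tensor H p q + k *: tensor H p q'.
Proof.
move=> dp bq bq'; have bc : bb (fun x => q x + k * q' x) by apply: bborelD => //; exact: bborelZ.
apply: eq_dot_dense => r t dr bt; have bt' := bborelJ bt.
rewrite dotDl dotZl !dot_tensor// -cformZ//; last exact: bborelM.
rewrite -cformD//; [|exact: bborelM|by apply: bborelZ; exact: bborelM].
by congr (cform _ _ _); apply: funext => x; ring.
Qed.

Lemma tensor_eq_off m p q q' : dom p -> bb q -> bb q' ->
  (forall x, X x -> ~ vertices s m x -> q x = q' x) -> tensor H p q = tensor H p q'.
Proof.
move=> dp bq bq' h; apply: eq_dot_dense => r t dr bt.
rewrite !dot_tensor//; apply: (@cform_eq_off m) => //; try by apply: bborelM => //; exact: bborelJ.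
by move=> x Xx Vx; rewrite h.
Qed.

Lemma mul_adjoint_tensor h f g p q : bb h -> dom f -> bb g -> dom p -> bb q ->
  dot (mul h (tensor H f g)) (tensor H p q) =
  dot (tensor H f g) (mul (fun x => conjc (h x)) (tensor H p q)).
Proof.
move=> bh df bg dp bq; have bh' := bborelJ bh.
rewrite !form_mul_tensor// !dot_tensor//; try exact: bborelM.
by congr (cform _ _ _); apply: funext => x; rewrite rmorphM /= conjcK; ring.
Qed.

(** Clear on pairs of tensors. Continuity of multiplication extends it by density, first in the left
    argument with a tensor on the right, then in the right one. *)
Lemma mul_adjoint h a b : bb h -> dot (mul h a) b = dot a (mul (fun x => conjc (h x)) b).
Proof.
move=> bh; have bh' := bborelJ bh.
have step p q c : dom p -> bb q ->
    dot (mul h c) (tensor H p q) = dot c (mul (fun x => conjc (h x)) (tensor H p q)).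
  move=> dp bq; apply/eqP; rewrite -subr_eq0; apply/eqP.
  apply: (ctn_eq0 (ctnB (ctn_mull _ bh) (ctn_idl _))) => _ [n [f [g [hfg ->]]]].
  rewrite linear_sum !dot_suml -sumrB big1// => i _; have [df bg _ _] := hfg i.
  by rewrite mul_adjoint_tensor// subrr.
rewrite (dotC (mul h a)) (dotC a); congr conjc; apply/eqP; rewrite -subr_eq0; apply/eqP.
apply: (ctn_eq0 (ctnB (ctn_idl _) (ctn_mull _ bh'))) => _ [n [f [g [hfg ->]]]].
rewrite linear_sum !dot_suml -sumrB big1// => i _; have [df bg _ _] := hfg i.
by rewrite dotC step// -dotC subrr.
Qed.

Lemma mul_comb h h' k a : bb h -> bb h' ->
  mul (fun x => h x + k * h' x) a = mul h a + k *: mul h' a.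
Proof.
move=> bh bh'; apply: eq_dot_dense => p q dp bq.
have bc : bb (fun x => h x + k * h' x) by apply: bborelD => //; exact: bborelZ.
have b1 := bborelJ bh; have b2 := bborelJ bh'; have b3 := bborelJ bc.
rewrite dotDl dotZl !mul_adjoint// !form_mul_tensor//.
rewrite (_ : (fun x => _) = (fun x => conjc (h x) * q x + conjc k * (conjc (h' x) * q x))).
  by rewrite tensor_comb ?dotDr ?dotZr ?conjcK//; exact: bborelM.
by apply: funext => x; rewrite rmorphD rmorphM; ring.
Qed.

Lemma mul_eq_off m h h' a : bb h -> bb h' ->
  (forall x, X x -> ~ vertices s m x -> h x = h' x) -> mul h a = mul h' a.
Proof.
move=> bh bh' e; apply: eq_dot_dense => p q dp bq.
have b1 := bborelJ bh; have b2 := bborelJ bh'.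
rewrite !mul_adjoint// !form_mul_tensor//; congr (dot a _); apply: (@tensor_eq_off m) => //.
- exact: bborelM.
- exact: bborelM.
- by move=> x Xx Vx; rewrite e.
Qed.

Lemma eq_mul h h' a : bb h -> bb h' -> (forall x, X x -> h x = h' x) -> mul h a = mul h' a.
Proof. by move=> bh bh' e; apply: (@mul_eq_off 0) => // x Xx _; exact: e. Qed.

Lemma mul_mul h h' a : bb h -> bb h' -> mul h (mul h' a) = mul (fun x => h x * h' x) a.
Proof.
move=> bh bh'; apply: eq_dot_dense => p q dp bq; have bc := bborelM bh bh'.
have b1 := bborelJ bh; have b2 := bborelJ bh'; have b3 := bborelJ bc.
rewrite !mul_adjoint// !form_mul_tensor//; last exact: bborelM.
by congr (dot a (tensor H p _)); apply: funext => x; rewrite rmorphM; ring.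
Qed.

Lemma mul_cst k a : mul (fun=> k) a = k *: a.
Proof.
apply: eq_dot_dense => p q dp bq; have bk := bborel_cst X k; have bk' := bborelJ bk.
rewrite dotZl mul_adjoint// form_mul_tensor//.
have b0 := bborel_cst X (0 : R[i]).
rewrite (_ : (fun x => _) = (fun x => 0 + conjc k * q x)); last first.
  by apply: funext => x; rewrite add0r.
rewrite tensor_comb// dotDr dotZr conjcK.
suff -> : tensor H p (fun=> 0) = 0 by rewrite dot0r add0r.
apply: dot_self_eq0; rewrite dot_tensor//.
rewrite (_ : (fun x => _) = (fun x => 0 * 0)); last by apply: funext => x; rewrite !mul0r.
by rewrite cformZ// mul0r.
Qed.

Lemma mulZ k h a : bb h -> mul (fun x => k * h x) a = k *: mul h a.
Proof. by move=> bh; rewrite -[RHS]mul_cst mul_mul//; exact: bborel_cst. Qed.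

(** With k = sqrt(M^2 - |h|^2) the adjoint rule gives ||h a||^2 + ||k a||^2 = M^2 ||a||^2, and the
    second term is dropped. *)
Lemma le_rnorm_mul h M a : bb h -> 0 <= M -> (forall x, X x -> rnorm (h x) <= M) ->
  rnorm (mul h a) <= M * rnorm a.
Proof.
move=> bh M0 hM; pose kk (x : R * R) : R := Num.sqrt (M ^+ 2 - rnorm (h x) ^+ 2).
have rr : rbounded X (fun x => M ^+ 2 - rnorm (h x) ^+ 2).
  have /bounded_borelP[r1 r2] := bh; apply: rboundedB; first exact: rbounded_cst.
  under eq_fun do rewrite rnorm_sqr !expr2.
  by apply: rboundedD; exact: rboundedM.
have pos x : X x -> 0 <= M ^+ 2 - rnorm (h x) ^+ 2.
  by move=> Xx; rewrite subr_ge0 lerXn2r ?nnegrE ?rnorm_ge0 ?hM.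
have bk : bb (cembed kk).
  apply: bborel_real; split.
    by have [m _] := rr; apply: (measurableT_comp _ m); apply: continuous_measurable_fun; exact: sqrt_continuous.
  exists M => x Xx; rewrite /kk ger0_norm ?sqrtr_ge0// -[leRHS]ger0_norm// -sqrtr_sqr.
  by rewrite ler_sqrt ?sqr_ge0// gerBl sqr_ge0.
have bh' := bborelJ bh; have bk' := bborelJ bk.
have e : (rnorm (mul h a) ^+ 2)%:C + (rnorm (mul (cembed kk) a) ^+ 2)%:C = ((M * rnorm a) ^+ 2)%:C.
  rewrite -!dot_norm !mul_adjoint// !mul_mul// -dotDr.
  rewrite -[mul _ a in X in _ + X](scale1r) -mul_comb; [|exact: bborelM|exact: bborelM].
  rewrite (eq_mul (h' := fun=> (M ^+ 2)%:C)).
  - by rewrite mul_cst dotZr conjc_real dot_norm -rmorphM exprMn.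
  - apply: bborelD; first exact: bborelM.
    by apply: bborelZ; exact: bborelM.
  - exact: bborel_cst.
  - move=> x Xx; rewrite mul1r /cembed conjc_real -rmorphM -expr2 sqr_sqrtr ?pos//.
    by rewrite [conjc _ * _]mulrC -rnorm_sqrE -rmorphD addrC subrK.
have {}e : rnorm (mul h a) ^+ 2 <= (M * rnorm a) ^+ 2.
  move: e; rewrite -rmorphD => /complexI <-; rewrite lerDl sqr_ge0//.
by move: e; rewrite ler_sqr ?nnegrE ?mulr_ge0 ?rnorm_ge0.
Qed.

End OneFormAlgebra.

(** * The derivation, cell indicators and functions harmonic at scale m *)

Section Derivation.
Context {R : realType}.
Variables (s : R) (X : set (R * R)).
Hypotheses (hs : 0 < s <= 8^-1) (hX : is_diamond_fractal s X).
Variable Gamma : cfun R -> {measure set (R * R) -> \bar R}.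
Hypothesis hGamma : is_energy_measures s X Gamma.
Variable H : one_forms s X Gamma.
Implicit Types (f g h p q : cfun R) (w v : seq 'I_4) (a b c : H) (k : R[i]) (m n : nat).
Local Notation D := (incr s).
Local Notation sq := (sqincr s).
Local Notation dom := (in_domain s X).
Local Notation bb := (bounded_borel X).
Local Notation dot := (form_dot H).
Local Notation mul := (form_mul H).
Local Notation der := (Defs.deriv H).
Local Notation ind := (cell_indicator s X).
Local Notation x1 := (cembed (@fstf R)).

Let mX : measurable X. Proof. exact: measurable_fractal hX. Qed.
Let dx1 : dom x1. Proof. exact: dom_fst. Qed.
Let b1 : bb (fun=> 1). Proof. exact: bborel_cst. Qed.

Lemma energy_form_combl f g r k : dom f -> dom g -> dom r ->
  energy_form s (fun x => f x + k * g x) r = energy_form s f r + k * energy_form s g r.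
Proof.
move=> df dg dr; have dfg : dom (fun x => f x + k * g x).
  by apply: (domD hs hX) => //; exact: (domZ hs hX).
apply: (ccvg_unique (energy_form_cvg hs hX dfg dr)).
have := ccvgD (energy_form_cvg hs hX df dr) (ccvgMl k (energy_form_cvg hs hX dg dr)).
congr (ccvg _ _); apply: funext => n; rewrite -wsum_mull -wsum_add; apply: eq_wsum => v.
by rewrite incrD incrZ; ring.
Qed.

Lemma dot_deriv f g : dom f -> dom g -> dot (der f) (der g) = energy_form s f g.
Proof.
move=> df dg; rewrite /Defs.deriv (dot_tensor _ df b1 dg b1) /cform /energy_form /polarize.
congr (_ * _); apply: eq_bigr => k _; congr (_ * _).
set h := fun x => f x + _; have dh : dom h.
  by apply: (domD hs hX) => //; exact: (domZ hs hX).
rewrite (_ : (fun x => _) = cembed (fun=> 1)); last first.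
  by apply: funext => x; rewrite conjc1 mulr1.
rewrite cintegral_cembed// Rintegral_cst// mul1r; have [-> _ _] := hGamma dh.
by [].
Qed.

(** The difference of the two sides is a combination of derivations and is orthogonal to every
    derivation, because the energy form is linear; hence it is orthogonal to itself. *)
Lemma deriv_comb f g k : dom f -> dom g ->
  der (fun x => f x + k * g x) = der f + k *: der g.
Proof.
move=> df dg; have dfg : dom (fun x => f x + k * g x).
  by apply: (domD hs hX) => //; exact: (domZ hs hX).
apply/eqP; rewrite -subr_eq0; apply/eqP; set v := _ - _.
have v0 r : dom r -> dot v (der r) = 0.
  by move=> dr; rewrite /v dotBl dotDl dotZl !dot_deriv// energy_form_combl// subrr.
by apply: dot_self_eq0; rewrite {2}/v dotBr dotDr dotZr !v0//; ring.
Qed.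

Lemma derivZ f k : dom f -> der (fun x => k * f x) = k *: der f.
Proof.
move=> df; have d0 : der (fun=> 0) = 0.
  have := deriv_comb (-1) df df; rewrite scaleN1r subrr => <-.
  by congr (der _); apply: funext => x; rewrite mulN1r subrr.
have := deriv_comb k (dom_cst hs hX 0) df; rewrite d0 add0r => <-.
by congr (der _); apply: funext => x; rewrite add0r.
Qed.

Lemma indE w x : ind w x = (\1_(cell s X w) x : R)%:C.
Proof. by rewrite /cell_indicator !indicE; case: (x \in _). Qed.

Lemma ind_in w x : cell s X w x -> ind w x = 1.
Proof. by move=> wx; rewrite /cell_indicator indicE mem_set. Qed.

Lemma ind_out w x : ~ cell s X w x -> ind w x = 0.
Proof. by move=> wx; rewrite /cell_indicator indicE memNset. Qed.

Lemma ind_conj w x : conjc (ind w x) = ind w x.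
Proof. by rewrite indE conjc_real. Qed.

Lemma ind_bb w : bb (ind w).
Proof. by apply: bborel_indic; exact: measurable_cell. Qed.

Lemma ind_idem w x : ind w x * ind w x = ind w x.
Proof. by rewrite /cell_indicator indicE; case: (x \in _); rewrite ?mulr1 ?mulr0. Qed.

Lemma mul_ind_idem w a : mul (ind w) (mul (ind w) a) = mul (ind w) a.
Proof.
rewrite mul_mul//; try exact: ind_bb.
by congr (mul _ a); apply: funext => x; rewrite ind_idem.
Qed.

Lemma mul_ind_comm w h a : bb h -> mul (ind w) (mul h a) = mul h (mul (ind w) a).
Proof.
move=> bh; rewrite !mul_mul//; try exact: ind_bb.
by congr (mul _ a); apply: funext => x; rewrite mulrC.
Qed.

Lemma dot_ind w a b : dot (mul (ind w) a) b = dot a (mul (ind w) b).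
Proof.
rewrite mul_adjoint; last exact: ind_bb.
by congr (dot a (mul _ b)); apply: funext => x; rewrite ind_conj.
Qed.

Lemma dot_ind2 w a b : dot (mul (ind w) a) (mul (ind w) b) = dot (mul (ind w) a) b.
Proof. by rewrite -dot_ind mul_ind_idem. Qed.

Lemma rnorm_mul_ind w a : rnorm (mul (ind w) a) <= rnorm a.
Proof.
rewrite -[leRHS]mul1r; apply: (le_rnorm_mul hs hX hGamma) => //; first exact: ind_bb.
move=> x _; rewrite /cell_indicator indicE.
by case: (x \in _); rewrite ?rnorm0// -(rmorph1 (real_complex R)) rnorm_real normr1.
Qed.

Lemma ind_disjoint m (w v : m.-tuple 'I_4) x : w != v -> ~ vertices s m x -> ind w x * ind v x = 0.
Proof.
move=> wv nx; have [wx|wx] := pselect (cell s X w x); last by rewrite (ind_out wx) mul0r.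
have [vx|vx] := pselect (cell s X v x); last by rewrite (ind_out vx) mulr0.
by case: nx; exact: (cell_overlap_vertices hs hX wv wx vx).
Qed.

Lemma mul_ind_disjoint m (w v : m.-tuple 'I_4) a : w != v -> mul (ind w) (mul (ind v) a) = 0.
Proof.
move=> wv; rewrite mul_mul//; try exact: ind_bb.
rewrite (mul_eq_off hs hX hGamma (m := m) (h' := fun=> 0)).
- by rewrite (mul_cst hs hX hGamma) scale0r.
- by apply: bborelM; exact: ind_bb.
- exact: bborel_cst.
- by move=> x Xx nx; exact: ind_disjoint.
Qed.

Lemma mul_sum (I : Type) (r : seq I) (P : pred I) (F : I -> cfun R) a :
  (forall i, P i -> bb (F i)) ->
  mul (fun x => \sum_(i <- r | P i) F i x) a = \sum_(i <- r | P i) mul (F i) a.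
Proof.
move=> hF; elim: r => [|i r ih].
  rewrite big_nil -[RHS](scale0r a) -(mul_cst hs hX hGamma).
  by congr (mul _ a); apply: funext => x; rewrite big_nil.
rewrite big_cons; case: (boolP (P i)) => Pi; last first.
  by rewrite -ih; congr (mul _ a); apply: funext => x; rewrite big_cons (negbTE Pi).
rewrite -ih -[mul _ a in X in _ + X](scale1r) -(mul_comb hs hX hGamma).
- by congr (mul _ a); apply: funext => x; rewrite big_cons Pi mul1r.
- exact: hF.
- exact: bborel_sum.
Qed.

Lemma sum_ind_off m x : X x -> ~ vertices s m x -> \sum_(w : m.-tuple 'I_4) ind w x = 1.
Proof.
move=> Xx nx; have [w wx] := cell_cover hX m Xx.
rewrite (bigD1 w)//= big1 ?addr0 ?(ind_in wx)// => v vw.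
by have := ind_disjoint vw nx; rewrite (ind_in wx) mulr1.
Qed.

(** The indicators add up to 1 away from the vertices of level m, where cells overlap, and vertices
    do not affect a multiplier. *)
Lemma sum_mul_ind m a : \sum_(w : m.-tuple 'I_4) mul (ind w) a = a.
Proof.
rewrite -mul_sum; last by move=> w _; exact: ind_bb.
rewrite (mul_eq_off hs hX hGamma (m := m) (h' := fun=> 1)).
- by rewrite (mul_cst hs hX hGamma) scale1r.
- by apply: bborel_sum => w _; exact: ind_bb.
- exact: b1.
- by move=> x Xx nx; exact: sum_ind_off.
Qed.

Definition cavg (phi : cfun R) w : R[i] := (phi (lpt s w) + phi (rpt s w)) / 2.

Lemma cform_cell_real p q (phi : R * R -> R) w : dom p -> dom q -> dom (cembed phi) ->
  ccvg (fun n => wsum n (fun v => D p v * conjc (D q v) * cavg (cembed phi) v) w)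
    (cform X Gamma (fun x => ind w x * cembed phi x) p q).
Proof.
move=> dp dq dphi; rewrite /cform /polarize.
under [X in ccvg X]eq_fun => n.
  under eq_wsum => v do rewrite -polarization -mulrA mulr_suml.
  rewrite wsum_mull wsum_sum.
  under eq_bigr => k _.
    under eq_wsum => v.
      rewrite -mulrA -incrZ -incrD -/(sqincr s _ v).
      rewrite (_ : cavg _ v = (ravg s phi v)%:C); last first.
        by rewrite /cavg /ravg /cembed -rmorphD rmorphM fmorphV rmorph_nat.
      rewrite -rmorphM.
      over.
    rewrite wsum_mull -wsum_scale_real.
    over.
  over.
apply: ccvgMl; apply: ccvg_sum => k _; apply: ccvgMl.
set h := fun x => p x + _; have dh : dom h.
  by apply: (domD hs hX) => //; exact: (domZ hs hX).
rewrite (_ : (fun x => _) = cembed (fun x => \1_(cell s X w) x * phi x)); last first.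
  by apply: funext => x; rewrite indE /cembed rmorphM.
rewrite cintegral_cembed//; apply: ccvg_real; exact: (energy_measure_cell_cvg hs hX hGamma).
Qed.

Lemma cform_cell p q phi w : dom p -> dom q -> dom phi ->
  ccvg (fun n => wsum n (fun v => D p v * conjc (D q v) * cavg phi v) w)
    (cform X Gamma (fun x => ind w x * phi x) p q).
Proof.
move=> dp dq dphi; have dr := dom_Re hs hX dphi; have di := dom_Im hs hX dphi.
have br : bb (fun x => ind w x * (Re (phi x))%:C).
  by apply: bborelM; [exact: ind_bb|exact: (dom_bborel hX)].
have bi : bb (fun x => ind w x * (Im (phi x))%:C).
  by apply: bborelM; [exact: ind_bb|exact: (dom_bborel hX)].
have ReIm z : z = (Re z)%:C + ii * (Im z)%:C :> R[i].
  by apply: complexP; rewrite !complex_simp /=; ring.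
have -> : (fun x => ind w x * phi x) =
    (fun x => ind w x * (Re (phi x))%:C + ii * (ind w x * (Im (phi x))%:C)).
  by apply: funext => x; rewrite {1}(ReIm (phi x)); ring.
rewrite (cformD hs hX hGamma)//; last exact: bborelZ.
rewrite (cformZ hs hX hGamma)//.
have := ccvgD (cform_cell_real w dp dq dr) (ccvgMl ii (cform_cell_real w dp dq di)).
congr (ccvg _ _); apply: funext => n; rewrite -wsum_mull -wsum_add; apply: eq_wsum => v.
rewrite /cavg /cembed {3}(ReIm (phi (lpt s v))) {3}(ReIm (phi (rpt s v))); ring.
Qed.

(** The bridge from 1-forms to edges: an inner product cut to one cell is a limit of sums over the
    edges of that cell only, with the coefficient averaged over the two ends. *)
Lemma dot_cell p q p' q' w : dom p -> dom q -> dom p' -> dom q' ->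
  ccvg (fun n => wsum n (fun v => D p v * conjc (D p' v) * cavg (fun x => q x * conjc (q' x)) v) w)
    (dot (mul (ind w) (tensor H p q)) (tensor H p' q')).
Proof.
move=> dp dq dp' dq'; have bq := dom_bborel hX dq; have bq' := dom_bborel hX dq'.
rewrite form_mul_tensor//; last exact: ind_bb.
rewrite dot_tensor//; last by apply: bborelM => //; exact: ind_bb.
have := cform_cell w dp dp' (domM hs hX dq (domJ hs hX dq')).
by congr (ccvg _ _); congr (cform _ _ _ _ _); apply: funext => x; rewrite mulrA.
Qed.

Lemma rnorm_cell_deriv h w : dom h ->
  wsum n (sq h) w @[n --> \oo] --> rnorm (mul (ind w) (der h)) ^+ 2.
Proof.
move=> dh; have d1 := dom_cst hs hX (1 : R[i]).
have -> : (fun n => wsum n (sq h) w) = (fun n =>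
    Re (wsum n (fun v => D h v * conjc (D h v) * cavg (fun x => 1 * conjc 1) v) w)).
  apply: funext => n; rewrite Re_wsum; apply: eq_wsum => v.
  rewrite /cavg conjc1 mulr1 -rnorm_sqrE (_ : (1 + 1) / 2 = 1) ?mulr1//; by field.
have -> : rnorm (mul (ind w) (der h)) ^+ 2 = Re (dot (mul (ind w) (der h)) (der h)).
  by rewrite -dot_ind2 dot_norm.
exact: (dot_cell w dh d1 dh d1).1.
Qed.

(** The 1-form dx1 cut to the cell. It is not normalized: its norm is 2 * 2^-|w|, the width of the
    cell. *)
Definition unit_form w : H := mul (ind w) (der x1).

Lemma sqincr_fst w : sq x1 w = (2 * 2^-1 ^+ size w) ^+ 2.
Proof.
rewrite /sqincr /incr /cembed -rmorphB rnorm_real real_normK ?num_real//.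
by have := incr_fst s w; rewrite /incr => ->; rewrite sqrrN.
Qed.

(** Each refinement halves all increments of the first coordinate and multiplies the number of edges
    by 4, so its energy on any cell is the same at all levels. *)
Lemma wsum_sqincr_fst n w : wsum n (sq x1) w = (2 * 2^-1 ^+ size w) ^+ 2.
Proof.
rewrite (eq_wsum_pre (G' := fun=> (2 * 2^-1 ^+ (size w + n)) ^+ 2)); last first.
  by move=> v sv; rewrite sqincr_fst size_cat sv.
rewrite wsum_cst -[_ *+ (4 ^ n)]mulr_natr natrX exprD mulrA exprMn -mulrA.
have -> : (4 : R) ^+ n = (2 ^+ n) ^+ 2 by rewrite -exprM mulnC exprM; congr (_ ^+ _); ring.
have -> : (2^-1 ^+ n) ^+ 2 * (2 ^+ n) ^+ 2 = 1 :> R by rewrite -!exprMn mulVf// !expr1n.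
by rewrite mulr1.
Qed.

Lemma rnorm_unit_form w : rnorm (unit_form w) = 2 * 2^-1 ^+ size w.
Proof.
have h := @rnorm_cell_deriv _ w dx1.
have e : rnorm (unit_form w) ^+ 2 = (2 * 2^-1 ^+ size w) ^+ 2.
  apply: (cvg_unique _ h) => //.
  by rewrite /=; under eq_fun do rewrite wsum_sqincr_fst; exact: cvg_cst.
by apply/eqP; rewrite -(eqrXn2 (n := 2)) ?rnorm_ge0 ?e//.
Qed.

Lemma unit_form_norm_gt0 w : 0 < rnorm (unit_form w).
Proof. by rewrite rnorm_unit_form mulr_gt0// exprn_gt0. Qed.

Lemma dot_unit_form m (w v : m.-tuple 'I_4) : w != v -> dot (unit_form w) (unit_form v) = 0.
Proof.
by move=> wv; rewrite dot_ind mul_ind_disjoint// dot0r.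
Qed.

Lemma deriv_incr0 h w : dom h -> (forall n, wsum n (sq h) w = 0) -> mul (ind w) (der h) = 0.
Proof.
move=> dh h0; apply: rnorm0_eq0; apply/eqP; rewrite -sqrf_eq0; apply/eqP.
apply: (cvg_unique _ (@rnorm_cell_deriv _ w dh)) => //.
by rewrite /=; under eq_fun do rewrite h0; exact: cvg_cst.
Qed.

Lemma harmonic_fst m : harmonic_at s X m x1.
Proof.
split=> // n _; rewrite !(graph_energyE hs) !wsum_sqincr_fst//.
Qed.

Lemma harmonicZ m k A : harmonic_at s X m A -> harmonic_at s X m (fun x => k * A x).
Proof.
move=> [dA hA]; split; first exact: (domZ hs hX).
have e n : graph_energy s n (fun x => k * A x) = rnorm k ^+ 2 * graph_energy s n A.
  rewrite !(graph_energyE hs) -wsum_mull; apply: eq_wsum => v.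
  by rewrite /sqincr incrZ rnormM exprMn.
by move=> n mn; rewrite !e hA.
Qed.

(** The energy of each m-cell is non-decreasing under refinement, and their total stays constant; so
    none of them changes. *)
Lemma harmonic_cell_energy m (w : m.-tuple 'I_4) A n :
  harmonic_at s X m A -> wsum n (sq A) w = sq A w.
Proof.
move=> [dA hA]; have := hA (m + n)%N (leq_addr _ _).
rewrite !(graph_energyE hs) wsumD !wsum_nil => /eqP; rewrite -subr_eq0 -sumrB.
rewrite psumr_eq0; last by move=> v _; rewrite subr_ge0; exact: sqincr_le_wsum.
by move=> /allP /(_ w (mem_index_enum _)) /=; rewrite subr_eq0 => /eqP.
Qed.

Lemma cincr_fst_cat w v : D x1 (w ++ v) = (2^-1 ^+ size v)%:C * D x1 w.
Proof.
have e u : D x1 u = (incr s (@fstf R) u)%:C by rewrite /incr /cembed rmorphB.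
by rewrite !e -rmorphM; congr (_%:C); rewrite !incr_fst size_cat exprD; ring.
Qed.

Lemma incr_fst_neq0 w : D x1 w != 0.
Proof.
rewrite -normr_eq0 rnormE; apply/eqP => /complexI => /eqP.
by rewrite -sqrf_eq0 -/(sq x1 w) sqincr_fst sqrf_eq0 mulf_eq0 expf_eq0 invr_eq0 !pnatr_eq0 !andbF.
Qed.

(* On an m-cell every function harmonic at scale m is affine in the first
   coordinate. *)
Lemma harmonic_cell_deriv m (w : m.-tuple 'I_4) A : harmonic_at s X m A ->
  mul (ind w) (der A) = (D A w / D x1 w) *: unit_form w.
Proof.
move=> hA; have [dA _] := hA; set be := D A w / D x1 w.
have db : dom (fun x => A x + (- be) * x1 x).
  by apply: (domD hs hX) => //; exact: (domZ hs hX).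
have z : mul (ind w) (der (fun x => A x + (- be) * x1 x)) = 0.
  apply: deriv_incr0 => // n.
  rewrite (eq_wsum_pre (G' := fun v => rnorm (D A v - (2^-1 ^+ n)%:C * D A w) ^+ 2)).
    by rewrite wsum_residual harmonic_cell_energy// subrr.
  move=> v sv; rewrite /sqincr incrD incrZ; congr (rnorm (_ + _) ^+ 2).
  by rewrite cincr_fst_cat sv mulNr mulrCA divfK// incr_fst_neq0.
move: z; rewrite deriv_comb// linearD linearZ /= -/(unit_form w) => /eqP.
by rewrite scaleNr subr_eq0 => /eqP.
Qed.

End Derivation.

(** * Projections onto scale m *)

Section Projection.
Context {R : realType}.
Variables (s : R) (X : set (R * R)).
Hypotheses (hs : 0 < s <= 8^-1) (hX : is_diamond_fractal s X).
Variable Gamma : cfun R -> {measure set (R * R) -> \bar R}.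
Hypothesis hGamma : is_energy_measures s X Gamma.
Variable H : one_forms s X Gamma.
Implicit Types (f g h p q : cfun R) (w v : seq 'I_4) (a b c : H) (k : R[i]) (m n : nat).
Local Notation D := (incr s).
Local Notation dom := (in_domain s X).
Local Notation bb := (bounded_borel X).
Local Notation dot := (form_dot H).
Local Notation mul := (form_mul H).
Local Notation der := (Defs.deriv H).
Local Notation ind := (cell_indicator s X).
Local Notation x1 := (cembed (@fstf R)).
Local Notation e_ := (unit_form H).

Let mX : measurable X. Proof. exact: measurable_fractal hX. Qed.
Let dx1 : dom x1. Proof. exact: dom_fst. Qed.
Let b1 : bb (fun=> 1). Proof. exact: bborel_cst. Qed.

(** The coefficient c_w of a_m on the cell; the division by the squared norm is there because
    [unit_form] is not normalized. *)
Definition coef a w : R[i] := dot a (e_ w) / (rnorm (e_ w) ^+ 2)%:C.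

Let norm_neq0 w : (rnorm (e_ w) ^+ 2)%:C != 0 :> R[i].
Proof.
by rewrite fmorph_eq0 sqrf_eq0 gt_eqF//; exact: (unit_form_norm_gt0 hs hX hGamma).
Qed.

Lemma dot_sum_unit_form m (k : m.-tuple 'I_4 -> R[i]) (v : m.-tuple 'I_4) :
  dot (\sum_(w : m.-tuple 'I_4) k w *: e_ w) (e_ v) = k v * (rnorm (e_ v) ^+ 2)%:C.
Proof.
rewrite dot_suml (bigD1 v)//= big1 ?addr0; first by rewrite dotZl dot_norm.
by move=> w wv; rewrite dotZl (dot_unit_form hs hX hGamma H wv) mulr0.
Qed.

Lemma sum_unit_form_inj m (k k' : m.-tuple 'I_4 -> R[i]) (v : m.-tuple 'I_4) :
  \sum_(w : m.-tuple 'I_4) k w *: e_ w = \sum_(w : m.-tuple 'I_4) k' w *: e_ w -> k v = k' v.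
Proof.
move=> /(congr1 (fun b => dot b (e_ v))); rewrite !dot_sum_unit_form.
by move/mulIf; apply; exact: norm_neq0.
Qed.

Lemma scale_forms_orthogonal m a :
  (forall w : m.-tuple 'I_4, dot a (e_ w) = 0) ->
  forall c, scale_forms m c -> dot a c = 0.
Proof.
move=> h _ [n [A [w [hA ->]]]]; rewrite dot_sumr big1// => i _.
by rewrite (harmonic_cell_deriv hs hX hGamma H (w i) (hA i)) dotZr h mulr0.
Qed.

Lemma scale_forms_sum m (k : m.-tuple 'I_4 -> R[i]) :
  scale_forms m (\sum_(w : m.-tuple 'I_4) k w *: e_ w).
Proof.
exists #|{: m.-tuple 'I_4}|, (fun i => fun x => k (enum_val i) * x1 x), (fun i => enum_val i).
split; first by move=> i; apply: harmonicZ => //; exact: harmonic_fst.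
rewrite (reindex _ (onW_bij _ (@enum_val_bij (m.-tuple 'I_4)))).
by apply: eq_bigr => i _; rewrite derivZ// linearZ.
Qed.

(** The forms [unit_form w] with |w| = m are orthogonal and, by [harmonic_cell_deriv], span the
    forms of scale m. Two candidates for the projection differ by a form of scale m orthogonal to
    all such forms, so the choice made by [xget] is this one. *)
Lemma form_projE m a : form_proj m a = \sum_(w : m.-tuple 'I_4) coef a w *: e_ w.
Proof.
set b := \sum_(w : m.-tuple 'I_4) _.
have ob c : scale_forms m c -> dot (a - b) c = 0.
  apply: scale_forms_orthogonal => w.
  by rewrite dotBl dot_sum_unit_form /coef divfK ?subrr.
have sb : scale_forms m b by exact: scale_forms_sum.
rewrite /form_proj; case: xgetP => [b' _ [sb' ob']|/(_ b) []//].
apply/eqP; rewrite -subr_eq0; apply/eqP; apply: dot_self_eq0.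
have e c : scale_forms m c -> dot (b' - b) c = 0.
  move=> sc; have -> : b' - b = (a - b) - (a - b') by rewrite opprB [RHS]addrC addrA subrK.
  by rewrite dotBl ob// ob'// subrr.
by rewrite dotBr !e// subrr.
Qed.

(** For real p the functions p + i x1 and p + i^3 x1 are conjugate, so they have the same energy
    measure and the two imaginary terms of the polarization cancel. What is left integrates a real
    function. *)
Lemma conj_dot_real_tensor p q w : dom p -> bb q -> real_on X p -> real_on X q ->
  conjc (dot (tensor H p q) (e_ w)) = dot (tensor H p q) (e_ w).
Proof.
move=> dp bq rp rq; have bi := ind_bb hs hX w.
rewrite /unit_form form_mul_tensor//.
have bi1 : bb (fun x => ind w x * 1) by exact: bborelM.
rewrite dot_tensor//; set phi := fun x => q x * _.
have bphi : bb phi by apply: bborelM => //; exact: bborelJ.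
have rphi x : X x -> conjc (phi x) = phi x.
  move=> Xx; rewrite /phi mulr1 ind_conj rmorphM /= ind_conj; congr (_ * _).
  by apply: complexP; rewrite ?ReJ// ImJ rq// oppr0.
have de (k : nat) : dom (fun x => p x + ii ^+ k * x1 x).
  by apply: (domD hs hX) => //; exact: (domZ hs hX).
pose I (k : nat) := cintegral (Gamma (fun x => p x + ii ^+ k * x1 x)) X phi.
have rI (k : nat) : conjc (I k) = I k.
  rewrite /I -cintegralJ//; last exact: (energy_measure_fin hGamma).
  by apply: eq_cintegral.
have I13 : I 1%N = I 3%N.
  rewrite /I /cintegral; have E (f : R * R -> R) : \int[Gamma (fun x => p x + ii ^+ 1 * x1 x)]_(x in X) f x =
      \int[Gamma (fun x => p x + ii ^+ 3 * x1 x)]_(x in X) f x.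
    rewrite /Rintegral; congr fine; apply: eq_measure_integral => A mA _.
    apply: (energy_measure_eq hs hX hGamma) => // v.
    rewrite /sqincr -[in RHS]rnormJ; congr (rnorm _ ^+ 2); rewrite /incr.
    have pl : conjc (p (lpt s v)) = p (lpt s v).
      by apply: complexP; rewrite ?ReJ// ImJ rp ?oppr0//; exact: fractal_lpt.
    have pr : conjc (p (rpt s v)) = p (rpt s v).
      by apply: complexP; rewrite ?ReJ// ImJ rp ?oppr0//; exact: fractal_rpt.
    have i3 : conjc (ii ^+ 3) = ii :> R[i].
      by apply: complexP; rewrite !exprS expr0 /=; ring.
    have conjE (x y z z' : R[i]) (r t : R) : conjc x = x -> conjc y = y -> conjc z = z' ->
        x + z' * r%:C - (y + z' * t%:C) = conjc (x + z * r%:C - (y + z * t%:C)).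
      by move=> hx hy hz; rewrite rmorphB !rmorphD !rmorphM /= hx hy hz !oppr0.
    by rewrite expr1; exact: conjE.
  by rewrite !E.
have -> : cform X Gamma phi p x1 = 4^-1 * (I 0%N + ii * I 1%N + ii ^+ 2 * I 2%N + ii ^+ 3 * I 3%N).
  by rewrite /cform /polarize !big_ord_recl big_ord0 /bump /= expr0 expr1 mul1r addr0 !addrA.
rewrite -I13.
have -> : ii ^+ 2 = -1 :> R[i] by apply: complexP; rewrite !exprS expr0 /=; ring.
have -> : ii ^+ 3 = - ii :> R[i] by apply: complexP; rewrite !exprS expr0 /=; ring.
have -> : I 0%N + ii * I 1%N + -1 * I 2%N + - ii * I 1%N = I 0%N - I 2%N by ring.
have c4 : conjc (4^-1 : R[i]) = 4^-1.
  by rewrite -(rmorph_nat (real_complex R)) -fmorphV conjc_real.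
move: (I 0%N) (I 2%N) (4^-1) (rI 0%N) (rI 2%N) c4 => x y z hx hy hz.
by rewrite rmorphM rmorphB /= hx hy hz.
Qed.

Lemma conj_coef a w : real_form a -> conjc (coef a w) = coef a w.
Proof.
move=> ha; suff h : conjc (dot a (e_ w)) = dot a (e_ w).
  have div (x z : R[i]) : conjc x = x -> conjc z = z -> conjc (x / z) = x / z.
    by move=> hx hz; rewrite rmorphM fmorphV /= hx hz.
  exact: div h (conjc_real _).
apply/eqP; rewrite -subr_eq0; apply/eqP.
have c := ctnB (ctn_conj (ctn_idl (e_ w))) (ctn_idl (e_ w)).
apply: rnorm0_eq0; apply/eqP; rewrite eq_le rnorm_ge0 andbT; apply/ler_addgt0Pr => e e0.
have [d d0 hd] := c a e e0.
have := ha (ball a d%:C) ltac:(by apply: nbhsx_ballx; rewrite ltcR).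
move=> [_ [[n [f [g [hfg ->]]]]]]; rewrite -ball_normE /= rnormE ltcR => /hd.
rewrite dot_suml rmorph_sum -sumrB big1 ?subr0 ?add0r => [/ltW//|i _].
by have [df bg rf rg] := hfg i; rewrite /= conj_dot_real_tensor// subrr.
Qed.

Lemma coef_real a w : real_form a -> coef a w = (Re (coef a w))%:C.
Proof.
move=> /(conj_coef w) h; apply: complexP => //=.
by have := congr1 (@complex.Im R) h; rewrite ImJ; lra.
Qed.

(** The potential is some choice among many. All have the same increment on the cell, since the
    coefficients in the basis of the [unit_form w] are unique; the linear functions with slopes
    [Re (coef a v)] show that a choice exists. *)
Lemma edge_valueE m a x (w : m.-tuple 'I_4) : real_form a -> at_word s x w ->
  edge_value m a x (other_end s x w) = Re (coef a w) * ((other_end s x w).1 - x.1).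
Proof.
move=> ha xw; rewrite /edge_value (edge_wordE hs xw).
set A := potential _; have [hA eA] : (forall v : m.-tuple 'I_4, harmonic_at s X m (cembed (A v))) /\
    form_proj m a = \sum_(v : m.-tuple 'I_4) mul (ind v) (der (cembed (A v))).
  rewrite /A /potential; case: xgetP => [B _ hB //|].
  pose B (v : m.-tuple 'I_4) (z : R * R) : R := Re (coef a v) * z.1.
  have eB (v : m.-tuple 'I_4) : cembed (B v) = fun z => (Re (coef a v))%:C * x1 z.
    by apply: funext => z; rewrite /cembed rmorphM.
  move=> /(_ B) []; split.
    by move=> v; rewrite eB; apply: harmonicZ => //; exact: harmonic_fst.
  rewrite form_projE; apply: eq_bigr => v _.
  by rewrite eB derivZ// linearZ -coef_real.
have := eA; rewrite form_projE.
under [in RHS]eq_bigr do rewrite (harmonic_cell_deriv hs hX hGamma H _ (hA _)).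
move=> /(@sum_unit_form_inj m (coef a) _ w).
have E (B : R * R -> R) : D (cembed B) w = (incr s B w)%:C by rewrite /incr /cembed rmorphB.
rewrite !E -fmorphV -rmorphM => ->; rewrite /=.
have n0 : incr s (@fstf R) w != 0.
  have := incr_fst_neq0 s w; rewrite E; apply: contra => /eqP ->; exact/eqP.
by move: xw => /orP[] /eqP ->; rewrite ?other_lpt ?other_rpt;
  move: n0; rewrite /incr /fstf => n0; field.
Qed.

End Projection.

(** * Leibniz and chain rules, gauge transformation *)

Section Phase.
Context {R : realType}.
Implicit Types (x y t : R).

Lemma mvt_between (f df : R -> R) x y : (forall t, is_derive t (1 : R) f (df t)) ->
  exists c, [/\ `|c - x| <= `|x - y|, `|c - y| <= `|x - y| & f x - f y = df c * (x - y)].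
Proof.
move=> hf; have cf a b : {within `[a, b], continuous f}.
  apply: continuous_subspaceT => t; apply/differentiable_continuous/derivable1_diffP.
  by case: (hf t).
have [xy|/ltW yx] := leP x y.
- have [c] := MVT_segment xy (fun t _ => hf t) (@cf x y).
  rewrite in_itv /= => /andP[xc cy] e; exists c; split.
  + by rewrite distrC !ler0_norm; lra.
  + by rewrite !ler0_norm; lra.
  + by lra.
- have [c] := MVT_segment yx (fun t _ => hf t) (@cf y x).
  rewrite in_itv /= => /andP[yc cx] e; exists c; split => //.
  + by rewrite distrC !ger0_norm; lra.
  + by rewrite !ger0_norm; lra.
Qed.

Lemma cos_dist_le x y : `|cos x - cos y| <= `|x - y|.
Proof.
have [c [_ _ ->]] := mvt_between x y (@is_derive_cos R).
by rewrite normrM normrN ler_piMl// sin_max.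
Qed.

Lemma sin_dist_le x y : `|sin x - sin y| <= `|x - y|.
Proof.
have [c [_ _ ->]] := mvt_between x y (@is_derive_sin R).
by rewrite normrM ler_piMl// cos_max.
Qed.

Definition phase t : R[i] := cos t +i* sin t.

Lemma phaseD x y : phase (x + y) = phase x * phase y.
Proof. by apply: complexP; rewrite /= (cosD, sinD)//; ring. Qed.

Lemma phase0 : phase 0 = 1.
Proof. by rewrite /phase cos0 sin0. Qed.

Lemma phaseJ t : conjc (phase t) = phase (- t).
Proof. by apply: complexP; rewrite ?ReJ ?ImJ /= ?cosN ?sinN. Qed.

Lemma phase_conj t : phase t * conjc (phase t) = 1.
Proof. by rewrite phaseJ -phaseD subrr phase0. Qed.

Lemma rnorm_phase t : rnorm (phase t) = 1.
Proof.
by apply/eqP; rewrite -(eqrXn2 (n := 2)) ?rnorm_ge0// rnorm_sqr /= cos2Dsin2 expr1n.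
Qed.

Lemma phase_dist_le x y : rnorm (phase x - phase y) <= 2 * `|x - y|.
Proof.
apply: le_trans (rnorm_le_ReIm _) _; rewrite !complex_simp /= mulr_natl mulr2n.
by apply: lerD; [exact: cos_dist_le|exact: sin_dist_le].
Qed.

(** By the mean value theorem the increment is the derivative at an intermediate point, which is
    within |x - y| of the average of its end values. A quadratic error is enough: a third increment
    comes from the form it is tested against. *)
Lemma phase_trapezoid x y :
  rnorm (phase x - phase y - ii * ((phase x + phase y) / 2) * (x - y)%:C) <= 2 * (x - y) ^+ 2.
Proof.
have sqE : (x - y) ^+ 2 = `|x - y| * `|x - y| by rewrite -expr2 real_normK ?num_real.
have avg (f : R -> R) c : (forall u v, `|f u - f v| <= `|u - v|) ->
    `|c - x| <= `|x - y| -> `|c - y| <= `|x - y| ->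
    `|f c - (f x + f y) / 2| <= `|x - y|.
  move=> hf cx cy; have -> : f c - (f x + f y) / 2 = ((f c - f x) + (f c - f y)) / 2 by field.
  rewrite normrM [ `|2^-1|]ger0_norm// ler_pdivrMr//; apply: le_trans (ler_normD _ _) _.
  by have := hf c x; have := hf c y; lra.
apply: le_trans (rnorm_le_ReIm _) _; rewrite mulr_natl mulr2n.
have half : (2 : R[i])^-1 = (2^-1)%:C by rewrite fmorphV rmorph_nat.
apply: lerD; rewrite half !complex_simp /= sqE.
- have [c [cx cy e]] := mvt_between x y (@is_derive_cos R).
  have := avg (@sin R) c sin_dist_le cx cy; move: e => /= e.
  move=> h; rewrite [X in `|X| <= _](_ : _ = - (sin c - (sin x + sin y) / 2) * (x - y)).
    by rewrite normrM normrN; apply: ler_wpM2r.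
  by rewrite e; field.
- have [c [cx cy e]] := mvt_between x y (@is_derive_sin R).
  have := avg (@cos R) c cos_dist_le cx cy; move: e => /= e.
  move=> h; rewrite [X in `|X| <= _](_ : _ = (cos c - (cos x + cos y) / 2) * (x - y)).
    by rewrite normrM; apply: ler_wpM2r.
  by rewrite e; field.
Qed.

End Phase.

Section CubicSums.
Context {R : realType}.
Variables (s : R) (X : set (R * R)).
Hypotheses (hs : 0 < s <= 8^-1) (hX : is_diamond_fractal s X).
Implicit Types (f g h p q : cfun R) (w v : seq 'I_4) (m n : nat).
Local Notation D := (incr s).
Local Notation sq := (sqincr s).
Local Notation dom := (in_domain s X).

Let cX : compact X. Proof. by case: hX. Qed.

Lemma cell_uniform u (e : R) : continuous_on X u -> 0 < e ->
  exists N, forall v x y, (N <= size v)%N -> cell s X v x -> cell s X v y ->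
    rnorm (u x - u y) < e.
Proof.
move=> cu e0; have [d d0 hd] := uniformly_continuous cX cu e0.
have [N hN] := @half_expn_small R 5 d d0; exists N => v x y Nv vx vy.
apply: hd; [exact: (cell_sub hX vy)|exact: (cell_sub hX vx)|].
have [_ /close_le] := cell_close hs hX vy vx; apply.
apply: le_trans (ltW hN); rewrite ler_pM2l//.
by apply: ler_wiXn2l; rewrite ?invr_ge0// invf_le1// ler1n.
Qed.

Lemma incr_uniform f (e : R) : continuous_on X f -> 0 < e ->
  exists N, forall v, (N <= size v)%N -> rnorm (D f v) < e.
Proof.
move=> cf e0; have [N hN] := cell_uniform cf e0; exists N => v Nv.
by apply: hN Nv _ _; [exact: cell_lpt|exact: cell_rpt].
Qed.

(** One factor, the increment of [h], tends to 0 uniformly since [h] is uniformly continuous; the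
    other two are absorbed by the energies of [f] and [g], as xy <= x^2 + y^2. *)
Lemma ccvg_wsum_cubic f g h (C : R) (G : seq 'I_4 -> R[i]) : dom f -> dom g -> dom h -> 0 <= C ->
  (forall v, rnorm (G v) <= C * (rnorm (D f v) * rnorm (D g v) * rnorm (D h v))) ->
  ccvg (fun n => wsum n G [::]) 0.
Proof.
move=> df dg dh C0 hG; set K := C * (energy s f + energy s g).
have K0 : 0 <= K by rewrite mulr_ge0// addr_ge0 ?(energy_ge0 hs df) ?(energy_ge0 hs dg).
apply: (ccvg_squeeze (u := fun=> 0) (e := fun n => rnorm (wsum n G [::]))).
- exact: ccvg_cst.
- by apply: nearW => n; rewrite subr0.
apply/cvgrPdist_le => e e0.
have K1 : 0 < K + 1 by lra.
have [N hN] := incr_uniform (dom_continuous dh) (divr_gt0 e0 K1).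
exists N => // n /= Nn; rewrite sub0r normrN ger0_norm ?rnorm_ge0//.
apply: le_trans (rnorm_wsum _ _ _) _.
apply: (@le_trans _ _ (wsum n (fun v => (C * (e / (K + 1))) * (sq f v + sq g v)) [::])).
  apply: le_wsum_pre => v sv; rewrite cat0s; apply: le_trans (hG v) _.
  rewrite -[leRHS]mulrA ler_wpM2l// mulrC; apply: ler_pM; rewrite ?rnorm_ge0 ?mulr_ge0 ?rnorm_ge0//.
    by apply/ltW/hN; rewrite sv.
  rewrite /sqincr; move: (rnorm _) (rnorm _) => x y.
  rewrite -subr_ge0 (_ : _ - _ = ((x - y) ^+ 2 + x ^+ 2 + y ^+ 2) / 2); last by field.
  by rewrite divr_ge0 ?addr_ge0 ?sqr_ge0.
rewrite wsum_mull wsum_add.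
apply: (@le_trans _ _ (C * (e / (K + 1)) * (energy s f + energy s g))).
  rewrite ler_wpM2l//; first by rewrite mulr_ge0// divr_ge0 ?ltW.
  by apply: lerD; [exact: (le_energy hs n df)|exact: (le_energy hs n dg)].
rewrite -mulrA mulrCA -/K -mulrA (mulrC _ K) mulrA.
by rewrite ler_pdivrMr// ler_wpM2l ?ltW//; lra.
Qed.

End CubicSums.

Section Gauge.
Context {R : realType}.
Variables (s : R) (X : set (R * R)).
Hypotheses (hs : 0 < s <= 8^-1) (hX : is_diamond_fractal s X).
Variable Gamma : cfun R -> {measure set (R * R) -> \bar R}.
Hypothesis hGamma : is_energy_measures s X Gamma.
Variable H : one_forms s X Gamma.
Implicit Types (f g h p q : cfun R) (w v : seq 'I_4) (a b c : H) (m n : nat).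
Local Notation D := (incr s).
Local Notation dom := (in_domain s X).
Local Notation bb := (bounded_borel X).
Local Notation dot := (form_dot H).
Local Notation mul := (form_mul H).
Local Notation der := (Defs.deriv H).
Local Notation ind := (cell_indicator s X).
Local Notation x1 := (cembed (@fstf R)).
Local Notation e_ := (unit_form H).
Local Notation avg := (cavg s).

Let dx1 : dom x1. Proof. exact: dom_fst. Qed.
Let b1 : bb (fun=> 1). Proof. exact: bborel_cst. Qed.

Lemma mul_ind_nil a : mul (ind [::]) a = a.
Proof.
rewrite -[RHS]scale1r -(mul_cst hs hX hGamma); apply: (eq_mul hs hX hGamma) => //.
  exact: ind_bb.
by move=> x Xx; apply: ind_in; exists x.
Qed.

Lemma mul_deriv g h : dom g -> bb h -> mul h (der g) = tensor H g h.
Proof.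
move=> dg bh; rewrite /Defs.deriv form_mul_tensor//.
by congr (tensor _ _ _); apply: funext => x; rewrite mulr1.
Qed.

Lemma dot_cvg p q p' q' : dom p -> dom q -> dom p' -> dom q' ->
  ccvg (fun n => wsum n (fun v => D p v * conjc (D p' v) * avg (fun x => q x * conjc (q' x)) v) [::])
    (dot (mul q (der p)) (mul q' (der p'))).
Proof.
move=> dp dq dp' dq'; rewrite !mul_deriv//; try exact: (dom_bborel hX).
rewrite -[tensor H p q]mul_ind_nil; exact: (dot_cell hs hX hGamma).
Qed.

(** The difference of the two sides is itself a combination of forms r dh with r and h of finite
    energy. Orthogonality to all of these suffices, and it is a limit of edge sums. *)
Lemma deriv_relation p p1 q1 p2 q2 : dom p -> dom p1 -> dom q1 -> dom p2 -> dom q2 ->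
  (forall r h, dom r -> dom h -> ccvg (fun n => wsum n (fun v =>
     (D p v * avg (fun x => conjc (r x)) v - (D p1 v * avg (fun x => q1 x * conjc (r x)) v +
        D p2 v * avg (fun x => q2 x * conjc (r x)) v)) * conjc (D h v)) [::]) 0) ->
  der p = mul q1 (der p1) + mul q2 (der p2).
Proof.
move=> dp dp1 dq1 dp2 dq2 small; have d1 := dom_cst hs hX (1 : R[i]).
apply/eqP; rewrite -subr_eq0; apply/eqP.
set b := _ - _.
have der1 g : der g = mul (fun=> 1) (der g) by rewrite (mul_cst hs hX hGamma) scale1r.
have b0 r h : dom r -> dom h -> dot b (mul r (der h)) = 0.
  move=> dr dh; rewrite /b dotBl dotDl.
  apply: ccvg_unique (small r h dr dh).
  rewrite [der p]der1 -[- (_ + _)]mulN1r.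
  have := ccvgD (dot_cvg dp d1 dh dr)
    (ccvgMl (-1) (ccvgD (dot_cvg dp1 dq1 dh dr) (dot_cvg dp2 dq2 dh dr))).
  congr (ccvg _ _); apply: funext => n; rewrite -wsum_add -wsum_mull -wsum_add.
  apply: eq_wsum => v.
  have -> : avg (fun x => 1 * conjc (r x)) v = avg (fun x => conjc (r x)) v.
    by rewrite /cavg !mul1r.
  ring.
apply: dot_self_eq0; rewrite {2}/b dotBr dotDr !b0// [der p]der1 b0//; ring.
Qed.

Lemma dom_bounded_fractal r : dom r ->
  exists2 M : R, 0 <= M & forall v, rnorm (r (lpt s v)) <= M /\ rnorm (r (rpt s v)) <= M.
Proof.
move=> dr; have [M M0 hM] := dom_bounded hX dr; exists M => // v.
by split; apply: hM; [exact: fractal_lpt|exact: fractal_rpt].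
Qed.

(** On an edge the product rule is exact with averages as coefficients. The average of a product
    differs from the product of averages by a quarter of the product of increments; two such terms
    leave half of a product of the increments of f, g, h and r, and the last factor is bounded. *)
Lemma deriv_mul f g : dom f -> dom g ->
  der (fun x => f x * g x) = mul f (der g) + mul g (der f).
Proof.
move=> df dg; apply: deriv_relation => //; first exact: (domM hs hX).
move=> r h dr dh; have [M M0 hM] := dom_bounded_fractal dr.
apply: (ccvg_wsum_cubic hs hX df dg dh M0) => v.
rewrite (_ : _ * conjc (D h v) = - (2^-1)%:C * (D f v * D g v * conjc (D h v)) * conjc (D r v)).
  rewrite !rnormM rnormN !rnormJ rnorm_real ger0_norm ?invr_ge0//.
  have : 2^-1 * rnorm (D r v) <= M.
    by have [hl hr] := hM v; have := rnormB (r (lpt s v)) (r (rpt s v)); rewrite -/(D r v); lra.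
  move=> hM'; rewrite mulrAC ler_wpM2r// ?mulr_ge0 ?rnorm_ge0//.
by rewrite /cavg /incr rmorphB /= fmorphV rmorph_nat; field.
Qed.

(** The gauge factor E_w, with k = c_w and t the first coordinate of the vertex at which it is
    normalized to 1. *)
Definition cphase (k t : R) : cfun R := fun z => phase (k * (z.1 - t)).

Local Arguments cphase : simpl never.

Lemma dom_cphase k t : dom (cphase k t).
Proof.
apply: (dom_lipschitz hs hX (L := 2 * `|k|)) => x y _ _.
apply: le_trans (phase_dist_le _ _) _; rewrite -mulrBr normrM -mulrA ler_pM2l//.
rewrite ler_wpM2l// (_ : _ - t - _ = x.1 - y.1); last by ring.
by rewrite lerDl.
Qed.

Lemma deriv_cphase k t : der (cphase k t) = mul (fun z => (ii * k%:C) * cphase k t z) (der x1).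
Proof.
have dE := dom_cphase k t; have d0 := dom_cst hs hX (0 : R[i]).
(* [deriv_relation] has two terms on its right side; the second is taken to be zero times dx1. *)
rewrite -[RHS]addr0 -[X in _ + X](scale0r (der x1)) -(mul_cst hs hX hGamma).
apply: deriv_relation => //; first exact: (domZ hs hX).
move=> r h dr dh; have [M M0 hM] := dom_bounded_fractal dr.
(* The 3 is 2 + 1: the trapezoid error gives 2 k^2 M, the difference between the average of a
   product and the product of averages gives k^2 M. *)
have C0 : 0 <= 3 * k ^+ 2 * M by rewrite mulr_ge0// mulr_ge0// sqr_ge0.
apply: (ccvg_wsum_cubic hs hX dx1 dx1 dh C0) => v.
set T := D (cphase k t) v - ii * k%:C * ((cphase k t (lpt s v) + cphase k t (rpt s v)) / 2) * D x1 v.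
rewrite (_ : _ * conjc (D h v) = avg (fun x => conjc (r x)) v * T * conjc (D h v)
   - (4^-1)%:C * (ii * k%:C * D x1 v * D (cphase k t) v * conjc (D r v) * conjc (D h v))); last first.
  by rewrite /T /cavg /incr rmorphB /= fmorphV rmorph_nat; field.
have [hl hr] := hM v.
have xE : D x1 v = ((lpt s v).1 - (rpt s v).1)%:C by rewrite /incr /cembed rmorphB.
set d := (lpt s v).1 - (rpt s v).1 in xE.
have thE : k * ((lpt s v).1 - t) - k * ((rpt s v).1 - t) = k * d by rewrite /d; ring.
have hT : rnorm T <= 2 * (k ^+ 2 * (`|d| * `|d|)).
  have := phase_trapezoid (k * ((lpt s v).1 - t)) (k * ((rpt s v).1 - t)).
  rewrite thE exprMn -expr2 real_normK ?num_real//; congr (rnorm _ <= _).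
  by rewrite /T xE /cphase /incr rmorphM; ring.
have hE : rnorm (D (cphase k t) v) <= 2 * (`|k| * `|d|).
  by have := phase_dist_le (k * ((lpt s v).1 - t)) (k * ((rpt s v).1 - t)); rewrite thE normrM.
have hr2 : rnorm (D r v) <= 2 * M.
  by have := rnormB (r (lpt s v)) (r (rpt s v)); rewrite -/(D r v); lra.
have ha : rnorm (avg (fun x => conjc (r x)) v) <= M.
  rewrite /cavg rnormM rnormV rnorm_nat ler_pdivrMr//.
  by apply: le_trans (rnormD _ _) _; rewrite !rnormJ; lra.
move: (avg _ v) T hT ha => A T hT ha; apply: le_trans (rnormB _ _) _.
rewrite !rnormM !rnormJ rnorm_real rnorm_ii rnorm_real xE rnorm_real mul1r ger0_norm ?invr_ge0//.
rewrite [leRHS](_ : _ = M * (2 * (k ^+ 2 * (`|d| * `|d|))) * rnorm (D h v) +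
   4^-1 * (`|k| * `|d| * (2 * (`|k| * `|d|)) * (2 * M) * rnorm (D h v))); last first.
  by rewrite -[k ^+ 2](real_normK (num_real k)); field.
apply: lerD.
  by apply: ler_wpM2r; rewrite ?rnorm_ge0//; apply: ler_pM; rewrite ?rnorm_ge0.
rewrite ler_wpM2l ?invr_ge0//; apply: ler_wpM2r; rewrite ?rnorm_ge0//.
by apply: ler_pM; rewrite ?rnorm_ge0 ?mulr_ge0 ?rnorm_ge0// ler_wpM2l// mulr_ge0.
Qed.

Lemma cphase_conj k t z : cphase k t z * conjc (cphase k t z) = 1.
Proof. exact: phase_conj. Qed.

Definition cov f b : H := der f + ii *: mul f b.

(* On a cell where b is a multiple of dx1, b is exact, and multiplication by
   its phase turns the covariant derivative into the derivative. *)
Lemma cell_gauge f b w k t : dom f -> mul (ind w) b = k%:C *: e_ w ->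
  mul (ind w) (cov f b) =
  mul (fun z => conjc (cphase k t z)) (mul (ind w) (der (fun z => cphase k t z * f z))).
Proof.
move=> df hb; have dE := dom_cphase k t; have dJ := domJ hs hX dE.
have bE := dom_bborel hX dE; have bJ := dom_bborel hX dJ; have bf := dom_bborel hX df.
have bw := ind_bb hs hX w.
have bk : bb (fun z => ii * k%:C * cphase k t z) by exact: bborelZ.
have JE c : mul (fun z => conjc (cphase k t z)) (mul (cphase k t) c) = c.
  rewrite mul_mul// -[RHS]scale1r -(mul_cst hs hX hGamma).
  by congr (mul _ c); apply: funext => z; rewrite mulrC cphase_conj.
have fE c : mul f (mul (cphase k t) c) = mul (cphase k t) (mul f c).
  by rewrite !mul_mul//; congr (mul _ c); apply: funext => z; rewrite mulrC.
suff -> : mul (ind w) (der (fun z => cphase k t z * f z)) = mul (cphase k t) (mul (ind w) (cov f b)).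
  by rewrite JE.
have -> : mul (ind w) (cov f b) = mul (ind w) (der f) + (ii * k%:C) *: mul f (e_ w).
  rewrite /cov linearD; congr (_ + _); rewrite linearZ /=.
  by rewrite mul_ind_comm// hb linearZ /= scalerA.
have -> : mul (cphase k t) (mul (ind w) (der f) + (ii * k%:C) *: mul f (e_ w)) =
    mul (ind w) (mul (cphase k t) (der f)) + (ii * k%:C) *: mul f (mul (ind w) (mul (cphase k t) (der x1))).
  rewrite linearD; congr (_ + _); first by rewrite mul_ind_comm.
  by rewrite linearZ /= [mul (ind w) (mul (cphase k t) _)]mul_ind_comm// fE.
rewrite deriv_mul// deriv_cphase mulZ// linearD; congr (_ + _).
by rewrite mul_ind_comm// !linearZ.
Qed.

End Gauge.

(** * Magnetic forms on cells *)

Section MagneticForm.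
Context {R : realType}.
Variables (s : R) (X : set (R * R)).
Hypotheses (hs : 0 < s <= 8^-1) (hX : is_diamond_fractal s X).
Variable Gamma : cfun R -> {measure set (R * R) -> \bar R}.
Hypothesis hGamma : is_energy_measures s X Gamma.
Variable H : one_forms s X Gamma.
Implicit Types (f g h p q : cfun R) (w v : seq 'I_4) (a b c : H) (m n : nat).
Local Notation D := (incr s).
Local Notation dom := (in_domain s X).
Local Notation bb := (bounded_borel X).
Local Notation dot := (form_dot H).
Local Notation mul := (form_mul H).
Local Notation der := (Defs.deriv H).
Local Notation ind := (cell_indicator s X).
Local Notation x1 := (cembed (@fstf R)).
Local Notation e_ := (unit_form H).

Let dx1 : dom x1. Proof. exact: dom_fst. Qed.

Lemma cov_comb f g (k : R[i]) b : dom f -> dom g ->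
  cov (fun x => f x + k * g x) b = cov f b + k *: cov g b.
Proof.
move=> df dg; rewrite /cov (deriv_comb hs hX hGamma)//.
rewrite (mul_comb hs hX hGamma); [|exact: (dom_bborel hX)|exact: (dom_bborel hX)].
by rewrite !scalerDr !scalerA addrACA mulrC.
Qed.

Lemma dot_polarization a b :
  4^-1 * \sum_(k < 4) ii ^+ k * dot (a + ii ^+ k *: b) (a + ii ^+ k *: b) = dot a b.
Proof.
rewrite !big_ord_recl big_ord0 /bump /= !dotDl !dotDr !dotZl !dotZr.
have i2 : ii * ii = -1 :> R[i] by apply: complexP => /=; ring.
have iJ : conjc ii = - ii :> R[i] by apply: complexP => /=; ring.
have XJ n : conjc (ii ^+ n) = (- ii) ^+ n :> R[i] by rewrite rmorphXn; congr (_ ^+ _).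
rewrite !XJ /= !expr0 !expr1 !exprS expr0 !mulr1.
have -> : - ii * - ii = -1 :> R[i] by rewrite mulrNN.
rewrite !i2; move: i2; set z : R[i] := 0 +i* 1 => i2.
have e2 x : z * (z * x) = - x by rewrite mulrA i2 mulN1r.
move: (dot a a) (dot a b) (dot b a) (dot b b) => A B C E.
rewrite [X in _ * X](_ : _ = 4 * B); first by rewrite mulrA mulVf ?mul1r ?pnatr_eq0.
ring: i2.
Qed.

Lemma magnetic_formE a f g : dom f -> dom g ->
  magnetic_form a f g = dot (cov f a) (cov g a).
Proof.
move=> df dg; rewrite /magnetic_form /polarize -dot_polarization; congr (_ * _).
by apply: eq_bigr => k _; rewrite /magnetic_energy form_norm_dot -/(cov _ a) cov_comb.
Qed.

(** The increments of x1 are equal on all subcells of one level, so the increments of [h] are summed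
    with a constant weight and telescope. This is why only the values of [h] at the two vertices
    survive, as in a graph operator. *)
Lemma dot_deriv_unit h w : dom h -> dot (der h) (e_ w) = D h w * conjc (D x1 w).
Proof.
move=> dh; rewrite /unit_form -dot_ind; [|exact: hs|exact: hX].
have d1 := dom_cst hs hX (1 : R[i]).
apply: (ccvg_unique (dot_cell hs hX hGamma H w dh d1 dx1 d1)).
rewrite (_ : (fun n => _) = fun=> D h w * conjc (D x1 w)); first exact: ccvg_cst.
apply: funext => n.
rewrite (eq_wsum_pre (G' := fun v => D h v * ((2^-1 ^+ n)%:C * conjc (D x1 w)))); last first.
  have conjZ (r : R) (z : R[i]) : conjc (r%:C * z) = r%:C * conjc z.
    by apply: complexP; rewrite !complex_simp /=; ring.
  move=> v sv; rewrite /cavg conjc1 mulr1 cincr_fst_cat sv conjZ.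
  by rewrite (_ : (1 + 1) / 2 = 1) ?mulr1//; field.
rewrite wsum_mulr wsum_incr -[D h w *+ _]mulr_natr natrX rmorphXn fmorphV rmorph_nat.
by rewrite -mulrA; congr (_ * _); rewrite mulrA -exprMn mulfV ?expr1n ?mul1r//.
Qed.

(** The derivation is local since the edge sums over a cell use only values on the cell; the
    multiplication is local since the indicator removes the rest. *)
Lemma eq_cell_cov f g w b : dom f -> dom g -> (forall z, cell s X w z -> f z = g z) ->
  mul (ind w) (cov f b) = mul (ind w) (cov g b).
Proof.
move=> df dg fg; apply/eqP; rewrite -subr_eq0 -linearB; apply/eqP.
have dfg : dom (fun x => f x + -1 * g x) by apply: (domD hs hX) => //; exact: (domZ hs hX).
have -> : cov f b - cov g b = cov (fun x => f x + -1 * g x) b.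
  by rewrite cov_comb// scaleN1r.
rewrite /cov linearD (deriv_incr0 hs hX hGamma)//; last first.
  move=> n; rewrite (eq_wsum_pre (G' := fun=> 0)) ?wsum0// => v _.
  rewrite /sqincr /incr !fg; try (apply: cell_cat_sub hX _ _ _ _; exact: cell_lpt);
    try (apply: cell_cat_sub hX _ _ _ _; exact: cell_rpt).
  by rewrite !mulN1r !subrr rnorm0 expr0n.
rewrite add0r linearZ /= mul_mul; [|exact: ind_bb|exact: (dom_bborel hX)].
rewrite (eq_mul hs hX hGamma (h' := fun=> 0)).
- by rewrite (mul_cst hs hX hGamma) scale0r scaler0.
- by apply: bborelM; [exact: ind_bb|exact: (dom_bborel hX)].
- exact: bborel_cst.
- move=> z Xz; have [wz|wz] := pselect (cell s X w z); last by rewrite (ind_out wz) mul0r.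
  by rewrite fg// mulN1r subrr mulr0.
Qed.

Definition hat (x y : R * R) : R * R -> R := fun z => 1 - (z.1 - x.1) / (y.1 - x.1).

Lemma dom_hat x y : dom (cembed (hat x y)).
Proof.
have -> : cembed (hat x y) = fun z => (1 + x.1 / (y.1 - x.1))%:C + (- (y.1 - x.1)^-1)%:C * x1 z.
  by apply: funext => z; rewrite /cembed -rmorphM -rmorphD; congr (_%:C); rewrite /hat /fstf; ring.
by apply: (domD hs hX); [exact: dom_cst|exact: (domZ hs hX)].
Qed.

Definition test_function (k : R) x y : cfun R := fun z => conjc (cphase k x.1 z) * (hat x y z)%:C.

Lemma dom_test_function k x y : dom (test_function k x y).
Proof.
by apply: (domM hs hX); [apply: (domJ hs hX); exact: dom_cphase|exact: dom_hat].
Qed.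

Lemma test_function_gauge k x y :
  (fun z => cphase k x.1 z * test_function k x y z) = cembed (hat x y).
Proof. by apply: funext => z; rewrite /test_function mulrA cphase_conj mul1r. Qed.

Lemma other_end_fst x w : at_word s x w ->
  (other_end s x w).1 - x.1 != 0 /\ `|(other_end s x w).1 - x.1| = 2 * 2^-1 ^+ size w.
Proof.
have := rpt_sub_lpt s w; have p : 0 < 2 * 2^-1 ^+ size w :> R by rewrite mulr_gt0// exprn_gt0.
move=> e /orP[] /eqP ->; rewrite ?other_lpt ?other_rpt.
  by rewrite e gt_eqF// gtr0_norm.
by rewrite -opprB e oppr_eq0 gt_eqF// normrN gtr0_norm.
Qed.

Lemma cell_deriv_hat x w : at_word s x w ->
  mul (ind w) (der (cembed (hat x (other_end s x w)))) =
  (- ((other_end s x w).1 - x.1)^-1)%:C *: e_ w.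
Proof.
move=> xw; set y := other_end s x w; set k := (_ - _)^-1.
apply/eqP; rewrite -subr_eq0 /unit_form -linearZ -linearB -scaleNr -(deriv_comb hs hX hGamma)//; last first.
  exact: dom_hat.
apply/eqP/(deriv_incr0 hs hX hGamma).
  by apply: (domD hs hX); [exact: dom_hat|exact: (domZ hs hX)].
move=> n; rewrite (eq_wsum_pre (G' := fun=> 0)) ?wsum0// => v _.
rewrite /sqincr [X in rnorm X](_ : _ = 0) ?rnorm0 ?expr0n//.
rewrite /incr /cembed /hat -/k -!rmorphN -!rmorphM -!rmorphD -rmorphB -[RHS](rmorph0 (real_complex R)).
by congr (_%:C); rewrite /fstf; ring.
Qed.

(** In the gauge of [cphase k x.1] both covariant derivatives become derivatives, the unimodular
    factors cancel, and the test function becomes the affine [hat]. The pairing of d(E f) with a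
    multiple of dx1 is evaluated by [dot_deriv_unit]; E is 1 at x and the stated phase at y. *)
Lemma cell_cov_test f b x w k : dom f -> at_word s x w -> mul (ind w) b = k%:C *: e_ w ->
  let y := other_end s x w in
  dot (mul (ind w) (cov f b)) (mul (ind w) (cov (test_function k x y) b)) =
    f x - f y * phase (k * (y.1 - x.1)).
Proof.
move=> df xw hb y; have dt := dom_test_function k x y; have dE := dom_cphase hs hX k x.1.
have bE := dom_bborel hX dE; have bJ := bborelJ bE.
rewrite (cell_gauge hs hX hGamma x.1 df hb) (cell_gauge hs hX hGamma x.1 dt hb).
rewrite test_function_gauge cell_deriv_hat// mul_adjoint// mul_mul//; last exact: bborelJ.
rewrite (_ : (fun z => conjc (conjc _) * _) = fun=> 1); last first.
  by apply: funext => z; rewrite conjcK cphase_conj.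
have dEf : dom (fun z => cphase k x.1 z * f z) by exact: (domM hs hX).
rewrite (mul_cst hs hX hGamma) scale1r dotZr (dot_ind hs hX) {1}/unit_form (mul_ind_idem hs hX) -/(e_ w).
rewrite dot_deriv_unit// conjc_real.
have cx : cphase k x.1 x = 1 by rewrite /cphase subrr mulr0 phase0.
have cy : cphase k x.1 y = phase (k * (y.1 - x.1)) by [].
have := (other_end_fst xw).1; rewrite -/y => n0.
have e u : D x1 u = ((lpt s u).1 - (rpt s u).1)%:C by rewrite /incr /cembed rmorphB.
rewrite e conjc_real mulrCA -rmorphM; move: xw n0; rewrite /y.
move=> /orP[] /eqP xE; rewrite /incr; move: cx cy; rewrite /y xE ?other_lpt ?other_rpt => cx cy n0.
- rewrite (_ : - _^-1 * _ = 1); last by field.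
  by rewrite cx cy mul1r rmorph1 mulr1 [phase _ * _]mulrC.
- rewrite (_ : - _^-1 * _ = -1); last by field.
  by rewrite cx cy mul1r rmorphN1 mulrN1 opprB [phase _ * _]mulrC.
Qed.

(** After the gauge transformation the form is dx1 times the slope of [hat], whose size is the
    inverse of the norm of dx1 on the cell. The bound therefore does not depend on the level. *)
Lemma cell_cov_test_le b x w k : at_word s x w -> mul (ind w) b = k%:C *: e_ w ->
  rnorm (mul (ind w) (cov (test_function k x (other_end s x w)) b)) <= 1.
Proof.
move=> xw hb; have [n0 nE] := other_end_fst xw; set y := other_end s x w in n0 nE *.
have dt := dom_test_function k x y; have dE := dom_cphase hs hX k x.1.
have bJ := bborelJ (dom_bborel hX dE).
rewrite (cell_gauge hs hX hGamma x.1 dt hb) test_function_gauge cell_deriv_hat//.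
apply: le_trans (le_rnorm_mul hs hX hGamma _ bJ ler01 _) _.
  by move=> z _; rewrite rnormJ rnorm_phase.
rewrite mul1r rnormZ rnorm_real (rnorm_unit_form hs hX hGamma) normrN normfV -nE mulVf//.
by rewrite normr_eq0.
Qed.

End MagneticForm.

(** * The fractal measure *)

Section FractalMeasure.
Context {R : realType}.
Variables (s : R) (X : set (R * R)).
Hypotheses (hs : 0 < s <= 8^-1) (hX : is_diamond_fractal s X).
Variable mu : {measure set (R * R) -> \bar R}.
Hypothesis hmu : is_fractal_measure s X mu.
Implicit Types (phi psi : R * R -> R) (w v : seq 'I_4) (m n : nat).
Local Notation one w := (\1_(cell s X w) : R * R -> R).

Let mX : measurable X. Proof. exact: measurable_fractal hX. Qed.

Lemma fractal_measure_fin : (mu X < +oo)%E.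
Proof. by have [-> _ _] := hmu; exact: ltry. Qed.
Let finX := fractal_measure_fin.

Lemma fractal_measure_cell w : mu (cell s X w) = (2 / 4 ^+ size w)%:E.
Proof.
elim: w => [|j w ih].
  by rewrite /cell /= image_id expr0 divr1; have [-> _ _] := hmu.
have -> : cell s X (j :: w) = diamond_map s j @` cell s X w.
  by rewrite /cell -image_comp; apply: eq_imagel.
have [_ _ ->] := hmu; [|exact: measurable_cell|exact: cell_sub].
rewrite ih -EFinM; congr EFin; rewrite /= exprS; field.
by rewrite expf_neq0.
Qed.

Lemma fractal_measure_point0 z : X z -> mu [set z] = 0%E.
Proof.
move=> Xz; apply: (fin_measure_point0 hX Xz finX) => e e0.
have [n hn] := @half_expn_small R 2 e e0; have [w wz] := cell_cover hX n Xz.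
apply: le_trans (ltW hn); apply: (@le_trans _ _ (fine (mu (cell s X w)))).
  have mw : measurable (cell s X w) by exact: measurable_cell.
  have le1 : (mu [set z] <= mu (cell s X w))%E.
    by apply: le_measure; rewrite ?in_setE//; [exact: measurable_point|move=> _ ->].
  have fw : mu (cell s X w) \is a fin_num by rewrite fractal_measure_cell.
  by apply: fine_le => //; rewrite ge0_fin_numE//; apply: le_lt_trans le1 _; rewrite fractal_measure_cell ltry.
rewrite fractal_measure_cell /= size_tuple ler_pM2l// -exprVn.
by apply: lerXn2r; rewrite ?nnegrE ?invr_ge0// lef_pV2 ?posrE// ler_nat.
Qed.

Lemma eq_Rintegral_off m phi psi : rbounded X phi -> rbounded X psi ->
  (forall x, X x -> ~ vertices s m x -> phi x = psi x) ->
  \int[mu]_(x in X) phi x = \int[mu]_(x in X) psi x.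
Proof.
move=> rphi rpsi h; apply/eqP; rewrite -subr_eq0; apply/eqP.
rewrite -RintegralB//; [|exact: rbounded_integrable|exact: rbounded_integrable].
have [v0 mv] := vertices_null hs hX m fractal_measure_point0.
apply: (Rintegral_null mX finX mv v0); first exact: rboundedB.
by move=> x Xx nx; rewrite h// subrr.
Qed.

Lemma rbounded_cell w phi : rbounded X phi -> rbounded X (fun x => one w x * phi x).
Proof. by apply: rboundedM; apply: rbounded_indic; exact: measurable_cell. Qed.

Lemma Rintegral_cell_cst w (c : R) : \int[mu]_(x in X) (one w x * c) = c * (2 / 4 ^+ size w).
Proof.
have mw : measurable (cell s X w) by exact: measurable_cell.
under eq_Rintegral do rewrite mulrC.
rewrite RintegralZl//; last by apply: rbounded_integrable => //; exact: rbounded_indic.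
rewrite /Rintegral integral_indic// setIidl; last exact: cell_sub.
by rewrite fractal_measure_cell.
Qed.

Lemma cell_split w x : cell s X w x -> exists j, cell s X (rcons w j) x.
Proof.
move=> [y Xy <-]; have [[j z] /= Xz ->] := fractal_preimage hX Xy.
by exists j; exists z => //; rewrite word_map_rcons.
Qed.

(** Subcells overlap only in vertices of the next level, and these are null because the mass of a
    cell tends to 0. *)
Lemma Rintegral_cell_split w phi : rbounded X phi ->
  \int[mu]_(x in X) (one w x * phi x) =
  \sum_(j < 4) \int[mu]_(x in X) (one (rcons w j) x * phi x).
Proof.
move=> rphi; rewrite (eq_Rintegral_off (m := (size w).+1)
    (psi := fun x => \sum_(j < 4) one (rcons w j) x * phi x)).
- have ri v : mu.-integrable X (EFin \o (fun x => one v x * phi x)).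
    by apply: rbounded_integrable => //; exact: rbounded_cell.
  rewrite !big_ord_recl big_ord0 addr0.
  under eq_Rintegral do rewrite !big_ord_recl big_ord0 addr0.
  by rewrite !RintegralD//; do ?[apply: rbounded_integrable => //; do ?apply: rboundedD => //; exact: rbounded_cell].
- exact: rbounded_cell.
- rewrite (_ : (fun x => _) = fun x => one (rcons w ord0) x * phi x +
     (one (rcons w (lift ord0 ord0)) x * phi x + (one (rcons w (lift ord0 (lift ord0 ord0))) x * phi x +
     one (rcons w (lift ord0 (lift ord0 (lift ord0 ord0)))) x * phi x))); last first.
    by apply: funext => x; rewrite !big_ord_recl big_ord0 addr0.
  by do ?apply: rboundedD => //; exact: rbounded_cell.
move=> x Xx nx; rewrite -mulr_suml; congr (_ * _).
have [wx|wx] := pselect (cell s X w x).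
  have [j jx] := cell_split wx; rewrite (bigD1 j)//= big1 ?addr0.
    by rewrite !indicE !mem_set.
  move=> k kj; rewrite indicE memNset// => kx; apply: nx.
  apply: (@cell_overlap_vertices _ s X hs hX _ (rcons_tuple (in_tuple w) k) (rcons_tuple (in_tuple w) j)) => //.
  apply: contra kj => /eqP /(congr1 val) /= e.
  by apply/eqP; have := congr1 (last ord0) e; rewrite !last_rcons.
rewrite indicE memNset// big1// => j _; rewrite indicE memNset// => jx; apply: wx.
by move: jx; rewrite -cats1; exact: cell_cat_sub.
Qed.

(** The middle of the range of the first coordinate on the cell, whose width is 2 * 2^-|w|. *)
Definition mid w : R := (lpt s w).1 + 2^-1 ^+ size w.

Lemma mid_rcons w j : mid (rcons w j) - mid w = hsign j / 2 * 2^-1 ^+ size w.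
Proof.
have := word_map_fst s w (diamond_map s j (-1, 0)) (-1, 0).
rewrite -word_map_rcons -/(lpt s _) -/(lpt s w) diamond_mapE /= /mid size_rcons exprS => h.
have -> : (lpt s (rcons w j)).1 = (lpt s w).1 + ((-1 + hsign j) / 2 - -1) * 2^-1 ^+ size w by lra.
by field.
Qed.

Let J w := \int[mu]_(x in X) (one w x * (x.1 - mid w)).

Let r1 (c : R) : rbounded X (fun x => x.1 - c).
Proof.
apply: rboundedB => //; last exact: rbounded_cst.
by apply: (dom_rbounded hX); exact: (dom_fst hs hX).
Qed.

(** The midpoints of the four subcells lie symmetrically about that of the cell and the subcells
    have equal mass, so recentring the first moments costs nothing in total. *)
Let J_split w : J w = \sum_(j < 4) J (rcons w j).
Proof.
rewrite /J Rintegral_cell_split//.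
have E j : \int[mu]_(x in X) (one (rcons w j) x * (x.1 - mid w)) =
    J (rcons w j) + (mid (rcons w j) - mid w) * (2 / 4 ^+ (size w).+1).
  rewrite -(size_rcons w j) -Rintegral_cell_cst /J -RintegralD//.
  - by apply: eq_Rintegral => x _; ring.
  - by apply: rbounded_integrable => //; exact: rbounded_cell.
  - by apply: rbounded_integrable => //; apply: rbounded_cell; exact: rbounded_cst.
under eq_bigr do rewrite E mid_rcons.
rewrite big_split /= -!mulr_suml [X in _ + X](_ : _ = 0) ?addr0//.
by rewrite !big_ord_recl big_ord0 /hsign /=; ring.
Qed.

Let J_wsum n w : J w = wsum n J w.
Proof. by elim: n w => [//|n ih] w; rewrite /= J_split; apply: eq_bigr => j _. Qed.

Let J_le w : `|J w| <= 2^-1 ^+ size w * (2 / 4 ^+ size w).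
Proof.
have p0 : 0 <= 2^-1 ^+ size w :> R by rewrite exprn_ge0// invr_ge0.
rewrite -Rintegral_cell_cst; apply: le_norm_Rintegral => //.
- exact: rbounded_cell.
- by apply: rbounded_cell; exact: rbounded_cst.
move=> x Xx; rewrite normrM indicE.
have [wx|wx] := pselect (cell s X w x); last by rewrite memNset// normr0 !mul0r.
rewrite mem_set// normr1 !mul1r; have /andP[] := cell_fst_range hs hX wx.
by have := rpt_sub_lpt s w; rewrite /mid ler_norml => ? ? ?; apply/andP; split; lra.
Qed.

(* Refining the partition n times gains a factor 2^-n for the first moments. *)
Let J0 w : J w = 0.
Proof.
apply/normr0_eq0/eqP; rewrite eq_le normr_ge0 andbT.
apply: (@ler_half_expn _ _ _ (2 / 4 ^+ size w)) => n; rewrite add0r (J_wsum n).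
rewrite wsum_tuple; apply: le_trans (ler_norm_sum _ _ _) _.
rewrite -(wsum_tuple _ (fun v => `|J v|)).
apply: (@le_trans _ _ (wsum n (fun=> (2 / 4 ^+ (size w + n)) * 2^-1 ^+ n) w)).
  apply: le_wsum_pre => v sv; apply: le_trans (J_le _) _; rewrite size_cat sv mulrC.
  rewrite ler_pM2l ?divr_gt0 ?exprn_gt0// exprD ger_pMl ?exprn_gt0// ?invr_gt0//.
  by rewrite exprn_ile1// ?invr_ge0// invf_le1// ler1n.
rewrite wsum_cst -[_ *+ (4 ^ n)]mulr_natr natrX exprD le_eqVlt; apply/orP; left; apply/eqP.
by field; rewrite !expf_neq0.
Qed.

(** [hat] is 1/2 plus a multiple of x1 minus the midpoint, whose moment vanishes by [J0]; half of
    the mass 2/4^m remains. *)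
Lemma Rintegral_cell_hat w x : at_word s x w ->
  \int[mu]_(z in X) (one w z * hat x (other_end s x w) z) = (4 ^+ size w)^-1.
Proof.
move=> xw; have [n0 _] := other_end_fst xw; set y := other_end s x w in n0 *.
have p0 : 0 < 2^-1 ^+ size w :> R by rewrite exprn_gt0// invr_gt0.
have e z : hat x y z = 2^-1 + - (y.1 - x.1)^-1 * (z.1 - mid w).
  have : x.1 + y.1 = 2 * mid w.
    have := rpt_sub_lpt s w; rewrite /mid /y.
    by move: xw => /orP[] /eqP ->; rewrite ?other_lpt ?other_rpt; lra.
  move=> h; have -> : mid w = (x.1 + y.1) / 2 by rewrite h; field.
  by rewrite /hat; field.
transitivity (\int[mu]_(z in X) (one w z * 2^-1 + (- (y.1 - x.1)^-1) * (one w z * (z.1 - mid w)))).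
  by apply: eq_Rintegral => z _; rewrite e; ring.
rewrite RintegralD//; last 2 first.
- by apply: rbounded_integrable => //; apply: rbounded_cell; exact: rbounded_cst.
- apply: rbounded_integrable => //; apply: rboundedM; first exact: rbounded_cst.
  exact: rbounded_cell.
rewrite RintegralZl//; last by apply: rbounded_integrable => //; exact: rbounded_cell.
rewrite -/(J w) J0 mulr0 addr0 Rintegral_cell_cst; field.
by rewrite expf_neq0.
Qed.

End FractalMeasure.

(** * Perturbation on a cell, gluing of the test function, size of the coefficients *)

Section EdgeEstimate.
Context {R : realType}.
Variables (s : R) (X : set (R * R)).
Hypotheses (hs : 0 < s <= 8^-1) (hX : is_diamond_fractal s X).
Variable Gamma : cfun R -> {measure set (R * R) -> \bar R}.
Hypothesis hGamma : is_energy_measures s X Gamma.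
Variable H : one_forms s X Gamma.
Implicit Types (f g h u : cfun R) (w v : seq 'I_4) (a b c : H) (m n : nat).
Local Notation dom := (in_domain s X).
Local Notation bb := (bounded_borel X).
Local Notation dot := (form_dot H).
Local Notation mul := (form_mul H).
Local Notation ind := (cell_indicator s X).
Local Notation e_ := (unit_form H).

Lemma covB f a b : cov f a - cov f b = ii *: mul f (a - b).
Proof. by rewrite /cov linearB scalerBr /= opprD addrACA subrr add0r. Qed.

Lemma cov0 b : cov (fun=> 0) b = 0.
Proof.
have d0 := dom_cst hs hX (0 : R[i]).
have := cov_comb hs hX hGamma (-1) b d0 d0; rewrite scaleN1r subrr => <-.
by congr (cov _ b); apply: funext => x; rewrite mulr0 addr0.
Qed.

Lemma le_rnorm_mul_cell f w c (M : R) : bb f -> 0 <= M ->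
  (forall x, cell s X w x -> rnorm (f x) <= M) ->
  rnorm (mul f (mul (ind w) c)) <= M * rnorm (mul (ind w) c).
Proof.
move=> bf M0 hM; have bw := ind_bb hs hX w.
rewrite -[in leLHS](mul_ind_idem hs hX) mul_mul//.
apply: (le_rnorm_mul hs hX hGamma) => //; first exact: bborelM.
move=> x Xx; have [wx|wx] := pselect (cell s X w x).
  by rewrite (ind_in wx) mulr1 hM.
by rewrite (ind_out wx) mulr0 rnorm0.
Qed.

(** The form is changed from a to b in one argument at a time. Each change is i times multiplication
    of 1_w(a - b) by [g] or [f]; the remaining factor is bounded by the norm of [cov f a] and by 1,
    respectively. *)
Lemma cell_perturb f g a b w (M : R) : bb f -> bb g -> 0 <= M ->
  (forall x, X x -> rnorm (f x) <= M) -> (forall x, cell s X w x -> rnorm (g x) <= 1) ->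
  rnorm (mul (ind w) (cov g b)) <= 1 ->
  rnorm (dot (mul (ind w) (cov f a)) (mul (ind w) (cov g a)) -
         dot (mul (ind w) (cov f b)) (mul (ind w) (cov g b)))
  <= (rnorm (cov f a) + M) * rnorm (mul (ind w) (a - b)).
Proof.
move=> bf bg M0 hM h1 hQ; set d := mul (ind w) (a - b).
have E h : bb h -> mul (ind w) (cov h a) = mul (ind w) (cov h b) + ii *: mul h d.
  move=> bh; apply/eqP; rewrite -subr_eq0 opprD addrA subr_eq0 -linearB covB linearZ /=.
  by rewrite mul_ind_comm.
have -> : dot (mul (ind w) (cov f a)) (mul (ind w) (cov g a)) -
    dot (mul (ind w) (cov f b)) (mul (ind w) (cov g b)) =
    dot (mul (ind w) (cov f a)) (ii *: mul g d) + dot (ii *: mul f d) (mul (ind w) (cov g b)).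
  by rewrite (E g bg) dotDr (E f bf) !dotDl; ring.
have nZ c : rnorm (ii *: c) = rnorm c by rewrite rnormZ rnorm_ii mul1r.
apply: le_trans (rnormD _ _) _; rewrite mulrDl.
apply: lerD; apply: le_trans (dot_CauchySchwarz _ _) _; rewrite nZ.
  apply: ler_pM; rewrite ?rnorm_ge0//; first exact: (rnorm_mul_ind hs hX hGamma).
  by rewrite -[leRHS]mul1r; exact: le_rnorm_mul_cell.
rewrite -[leRHS]mulr1; apply: ler_pM; rewrite ?rnorm_ge0//.
by apply: le_rnorm_mul_cell => // x wx; apply: hM; exact: (cell_sub hX wx).
Qed.

Lemma hat_cell x w z : at_word s x w -> cell s X w z -> 0 <= hat x (other_end s x w) z <= 1.
Proof.
move=> xw wz; have [n0 _] := other_end_fst xw.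
have /andP[] := cell_fst_range hs hX wz; rewrite /hat; move: n0.
have := rpt_sub_lpt s w; have : 0 < 2 * 2^-1 ^+ size w :> R by rewrite mulr_gt0// exprn_gt0.
move: (2 * _) => t t0 e; move: xw => /orP[] /eqP ->; rewrite ?other_lpt ?other_rpt => n0 h1 h2.
  rewrite e subr_ge0 ler_pdivrMr// mul1r gerBl divr_ge0 ?andbT ?(ltW t0)//; lra.
rewrite -[X in _ / X]opprB e invrN mulrN -mulNr subr_ge0 ler_pdivrMr// mul1r gerBl.
by rewrite divr_ge0 ?andbT ?(ltW t0)//; lra.
Qed.

Lemma test_function_cell k x w z : at_word s x w -> cell s X w z ->
  rnorm (test_function k x (other_end s x w) z) <= 1.
Proof.
move=> xw wz; have /andP[h0 h1] := hat_cell xw wz.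
by rewrite rnormM rnormJ rnorm_phase mul1r rnorm_real ger0_norm.
Qed.

Definition piece (k : seq 'I_4 -> R) x w : cfun R :=
  if at_word s x w then test_function (k w) x (other_end s x w) else fun=> 0.

(** The phase is 1 at x and [hat] vanishes at the other end. The end values thus do not depend on
    the coefficients [k], and pieces of neighbouring cells agree where they meet. *)
Lemma piece_endpoint k x w z : z = lpt s w \/ z = rpt s w -> piece k x w z = (z == x)%:R.
Proof.
rewrite /piece; case: ifP => [xw|]; last first.
  rewrite /at_word => /negbT; rewrite negb_or => /andP[nl nr].
  by case=> ->; rewrite eq_sym; [rewrite (negbTE nl)|rewrite (negbTE nr)].
have [n0 _] := other_end_fst xw; set y := other_end s x w in n0 *.
have tx : test_function (k w) x y x = 1.
  by rewrite /test_function /cphase /hat !subrr mulr0 mul0r subr0 phase0 conjc1 mul1r.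
have ty : test_function (k w) x y y = 0.
  by rewrite /test_function /hat mulfV// subrr mulr0.
have yx : (y == x) = false by apply/eqP => e; move: n0; rewrite e subrr eqxx.
have lr := lpt_neq_rpt (s := s) (w := w).
move: tx ty yx; rewrite /y; move: xw => /orP[] /eqP ->; rewrite ?other_lpt ?other_rpt => tx ty yx.
  by case=> ->; rewrite ?tx ?ty ?eqxx ?yx.
by case=> ->; rewrite ?tx ?ty ?eqxx ?yx.
Qed.

Lemma vertices0_endpoint w z : vertices s 0 z -> cell s X w z -> z = lpt s w \/ z = rpt s w.
Proof.
move=> z0 [y Xy e]; have ly := fractal_lens hs hX Xy.
have [ye|ye] : y = (-1, 0) \/ y = (1, 0).
- by apply: (word_map_end hs (w := w) ly); rewrite e.
- by left; rewrite -e ye.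
- by right; rewrite -e ye.
Qed.

(** Since [x] lies outside V_0, the pieces vanish at the points of V_0, which are end points of
    every cell that contains them. The glued function is then admissible in the weak formulation. *)
Lemma piece_glue m (k : seq 'I_4 -> R) x : ~ vertices s 0 x ->
  exists2 g, in_domain0 s X g &
    forall (w : m.-tuple 'I_4) z, cell s X w z -> g z = piece k x w z.
Proof.
move=> x0.
have dG (w : m.-tuple 'I_4) : dom (piece k x w).
  by rewrite /piece; case: ifP => _; [exact: dom_test_function|exact: dom_cst].
have [w v z wz vz|g dg gG] := dom_paste_exists hs hX dG.
  have [->//|wv] := eqVneq w v.
  have sz : size w = size v by rewrite !size_tuple.
  rewrite (piece_endpoint k x (cell_meet hs hX sz wv wz vz)).
  rewrite (piece_endpoint k x (cell_meet hs hX (esym sz) _ vz wz))//.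
  by rewrite eq_sym.
exists g => //; split=> // z z0.
have Xz : X z by case: z0 => ->; [exact: fractal_l hs hX|exact: fractal_r hs hX].
have [w wz] := cell_cover hX m Xz.
rewrite (gG w)// piece_endpoint; last exact: vertices0_endpoint.
by case: eqP => // e; case: x0; rewrite -e.
Qed.

Lemma magnetic_form_pieces m (k : seq 'I_4 -> R) x f g a : dom f -> dom g ->
  (forall (w : m.-tuple 'I_4) z, cell s X w z -> g z = piece k x w z) ->
  magnetic_form a f g = \sum_(w : m.-tuple 'I_4 | at_word s x w)
    dot (mul (ind w) (cov f a)) (mul (ind w) (cov (test_function (k w) x (other_end s x w)) a)).
Proof.
move=> df dg gG; rewrite (magnetic_formE hs hX hGamma)// -[cov f a](sum_mul_ind hs hX hGamma m).
rewrite dot_suml [RHS]big_mkcond; apply: eq_bigr => w _.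
rewrite -(dot_ind2 hs hX) (sum_mul_ind hs hX hGamma).
have dG : dom (piece k x w).
  by rewrite /piece; case: ifP => _; [exact: dom_test_function|exact: dom_cst].
rewrite (eq_cell_cov hs hX hGamma a dg dG); last by move=> z /gG.
by rewrite /piece; case: ifP => // _; rewrite cov0 linear0 dot0r.
Qed.

Lemma cell_form_proj m a (w : m.-tuple 'I_4) : real_form a ->
  mul (ind w) (form_proj m a) = (Re (coef a w))%:C *: e_ w.
Proof.
move=> ha; rewrite (form_projE hs hX hGamma) linear_sum (bigD1 w)//= big1 ?addr0.
  by rewrite linearZ /= -(coef_real hs hX hGamma)// /unit_form mul_ind_idem.
move=> v vw; rewrite linearZ /= /unit_form (mul_ind_disjoint hs hX hGamma) ?scaler0//.
by rewrite eq_sym.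
Qed.

(** Cauchy-Schwarz on the cell; the factor is the norm of [unit_form w]. *)
Lemma coef_bound a w : rnorm (coef a w) * (2 * 2^-1 ^+ size w) <= rnorm (mul (ind w) a).
Proof.
have p0 := unit_form_norm_gt0 hs hX hGamma H w.
rewrite -(rnorm_unit_form hs hX hGamma H) /coef rnormM rnormV rnorm_real ger0_norm ?sqr_ge0//.
rewrite expr2 invfM mulrA mulfVK ?gt_eqF// ler_pdivrMr//.
have -> : dot a (e_ w) = dot (mul (ind w) a) (e_ w).
  by rewrite /unit_form (dot_ind hs hX) (mul_ind_idem hs hX).
exact: dot_CauchySchwarz.
Qed.

Lemma rnorm_cell_unit_form w v : rnorm (mul (ind w) (e_ v)) <= 2 * 2^-1 ^+ size w.
Proof.
rewrite /unit_form (mul_ind_comm hs hX); last exact: ind_bb.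
rewrite -(rnorm_unit_form hs hX hGamma H); exact: (rnorm_mul_ind hs hX hGamma).
Qed.

(** Here v is the n-cell containing the cell of [w]. The form a - a_n is estimated on the larger
    cell v, while a_n is a fixed finite combination whose every term has norm at most 2 * 2^-|w| on
    the cell of [w]. *)
Lemma coef_refine n a w : (n <= size w)%N ->
  exists v : n.-tuple 'I_4, rnorm (coef a w) * (2 * 2^-1 ^+ size w) <=
    rnorm (mul (ind v) (a - form_proj n a)) +
    (\sum_(v : n.-tuple 'I_4) rnorm (coef a v)) * (2 * 2^-1 ^+ size w).
Proof.
move=> nw; have sv : size (take n w) == n by rewrite size_take_min (minn_idPl nw).
exists (Tuple sv) => /=; apply: le_trans (coef_bound _ _) _.
rewrite -{1}(subrK (form_proj n a) a) linearD /=; apply: le_trans (rnormD _ _) _; apply: lerD.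
  have -> : mul (ind w) (a - form_proj n a) = mul (ind w) (mul (ind (take n w)) (a - form_proj n a)).
    rewrite mul_mul; [|exact: ind_bb|exact: ind_bb]; congr (mul _ _); apply: funext => x.
    have [wx|wx] := pselect (cell s X w x); last by rewrite (ind_out wx) mul0r.
    rewrite (ind_in wx) mul1r ind_in//; move: wx; rewrite -{1}(cat_take_drop n w).
    exact: (cell_cat_sub hX).
  exact: (rnorm_mul_ind hs hX hGamma).
rewrite (form_projE hs hX hGamma) linear_sum mulr_suml; apply: le_trans (rnorm_sum _ _ _) _.
apply: ler_sum => v _; rewrite linearZ /= rnormZ; apply: ler_wpM2l; rewrite ?rnorm_ge0//.
exact: rnorm_cell_unit_form.
Qed.

End EdgeEstimate.

(** * Means of the image function over cells *)

Section Means.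
Context {R : realType}.
Variables (s : R) (X : set (R * R)).
Hypotheses (hs : 0 < s <= 8^-1) (hX : is_diamond_fractal s X).
Variable mu : {measure set (R * R) -> \bar R}.
Hypothesis hmu : is_fractal_measure s X mu.
Implicit Types (f g h u : cfun R) (w v : seq 'I_4) (m n : nat).
Local Notation dom := (in_domain s X).
Local Notation bb := (bounded_borel X).
Local Notation ind := (cell_indicator s X).

Let cX : compact X. Proof. by case: hX. Qed.
Let mX : measurable X. Proof. exact: measurable_fractal hX. Qed.
Let finX : (mu X < +oo)%E. Proof. exact: fractal_measure_fin hmu. Qed.

Lemma eq_cintegral_off m f g : bb f -> bb g ->
  (forall x, X x -> ~ vertices s m x -> f x = g x) -> cintegral mu X f = cintegral mu X g.
Proof.
move=> /bounded_borelP[f1 f2] /bounded_borelP[g1 g2] h; rewrite /cintegral.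
by congr (_ +i* _); apply: (eq_Rintegral_off hs hX hmu (m := m)) => // x Xx nx; rewrite h.
Qed.

Lemma le_rnorm_cintegral f (psi : R * R -> R) : bb f -> rbounded X psi ->
  (forall x, X x -> rnorm (f x) <= psi x) ->
  rnorm (cintegral mu X f) <= 2 * \int[mu]_(x in X) psi x.
Proof.
move=> /bounded_borelP[f1 f2] rpsi h; apply: le_trans (rnorm_le_ReIm _) _.
rewrite mulr_natl mulr2n; apply: lerD; apply: le_norm_Rintegral => // x Xx.
  exact: le_trans (normRe_le _) (h x Xx).
exact: le_trans (normIm_le _) (h x Xx).
Qed.

Lemma test_functionJ (k : R) (x y z : R * R) :
  conjc (test_function k x y z) = cphase k x.1 z * (hat x y z)%:C.
Proof. by rewrite /test_function; apply: complexP; rewrite !complex_simp /=; ring. Qed.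

Lemma cintegral_pieces m (k : seq 'I_4 -> R) x u g : continuous_on X u -> dom g ->
  (forall (w : m.-tuple 'I_4) z, cell s X w z -> g z = piece s k x w z) ->
  cintegral mu X (fun z => - u z * conjc (g z)) =
  - \sum_(w : m.-tuple 'I_4 | at_word s x w)
      cintegral mu X (fun z => ind w z * (u z * conjc (test_function (k w) x (other_end s x w) z))).
Proof.
move=> cu dg gG; have bu := bounded_borel_continuous cX cu; have bg := dom_bborel hX dg.
have bt w : bb (fun z => ind w z * (u z * conjc (test_function (k w) x (other_end s x w) z))).
  apply: bborelM => //; first exact: ind_bb.
  by apply: bborelM => //; apply: bborelJ => //; apply: (dom_bborel hX); exact: dom_test_function.
have bug : bb (fun z => u z * conjc (g z)) by apply: bborelM => //; exact: bborelJ.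
have -> : cintegral mu X (fun z => - u z * conjc (g z)) = - cintegral mu X (fun z => u z * conjc (g z)).
  rewrite -mulN1r -cintegralZ//; apply: eq_cintegral => z _; ring.
congr (- _); rewrite -cintegral_sum//; apply: (eq_cintegral_off (m := m)) => //.
  by apply: bborel_sum => // w _.
move=> z Xz nz; have [w wz] := cell_cover hX m Xz.
rewrite (gG _ _ wz) big_mkcond (bigD1 w isT) big1 ?Monoid.mulm1.
  by rewrite /piece; case: ifP => _; rewrite ?conjc0 ?mulr0// (ind_in wz) mul1r.
move=> v /andP[_ vw]; case: ifP => // _; rewrite ind_out ?mul0r// => vz.
by apply: nz; exact: (cell_overlap_vertices hs hX vw vz wz).
Qed.

(** Since 4^m times the integral of [hat] over the cell is exactly 1, only the deviation from [u x]
    is left. The constant 4 is the mass 2/4^m, scaled by 4^m, times the 2 lost in treating real and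
    imaginary parts separately. *)
Lemma cell_mean u x w k (eta : R) : continuous_on X u -> at_word s x w -> 0 <= eta ->
  (forall z, cell s X w z -> rnorm (u z * cphase k x.1 z - u x) <= eta) ->
  rnorm (4 ^+ size w *
    cintegral mu X (fun z => ind w z * (u z * conjc (test_function k x (other_end s x w) z))) - u x)
  <= 4 * eta.
Proof.
move=> cu xw eta0 hu; set y := other_end s x w.
have bu := bounded_borel_continuous cX cu; have bw := ind_bb hs hX w.
have bE := dom_bborel hX (dom_cphase hs hX k x.1).
have bh := dom_bborel hX (dom_hat hs hX x y).
pose r z := u z * cphase k x.1 z + -1 * u x.
have br : bb r by apply: bborelD => //; [exact: bborelM|exact: bborel_cst].
have b1 : bb (fun z => ind w z * (r z * cembed (hat x y) z)) by do 2?apply: bborelM.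
have b2 : bb (fun z => ind w z * cembed (hat x y) z) by apply: bborelM.
have -> : cintegral mu X (fun z => ind w z * (u z * conjc (test_function k x y z))) =
    cintegral mu X (fun z => ind w z * (r z * cembed (hat x y) z)) + u x * (4 ^+ size w)^-1%:C.
  rewrite -(Rintegral_cell_hat hs hX hmu xw) -cintegral_cembed//.
  rewrite (_ : cembed (fun z => \1_(cell s X w) z * _) = fun z => ind w z * cembed (hat x y) z); last first.
    by apply: funext => z; rewrite indE /cembed rmorphM.
  rewrite -cintegralZ// -cintegralD//; last exact: bborelZ.
  by apply: eq_cintegral => z _; rewrite test_functionJ /r /cembed; ring.
have p4 : 0 < 4 ^+ size w :> R by rewrite exprn_gt0.
have -> : (4 : R[i]) ^+ size w = (4 ^+ size w)%:C by rewrite rmorphXn rmorph_nat.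
rewrite mulrDr mulrCA -rmorphM mulfV ?gt_eqF// rmorph1 mulr1 addrK rnormM rnorm_real gtr0_norm//.
have := le_rnorm_cintegral (psi := fun z => (\1_(cell s X w) z : R) * eta) b1.
rewrite (Rintegral_cell_cst hs hX hmu) => le.
apply: (@le_trans _ _ (4 ^+ size w * (2 * (eta * (2 / 4 ^+ size w))))); last first.
  by rewrite le_eqVlt; apply/orP; left; apply/eqP; field; rewrite gt_eqF.
rewrite ler_pM2l//; apply: le.
  by apply: (rbounded_cell hs hX); exact: rbounded_cst.
move=> z Xz; rewrite indE rnormM rnorm_real ger0_norm ?indicE//.
have [wz|wz] := pselect (cell s X w z); last by rewrite memNset// !mul0r.
rewrite mem_set// !mul1r rnormM rnorm_real -[leRHS]mulr1; apply: ler_pM; rewrite ?rnorm_ge0//.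
  by rewrite /r mulN1r hu.
by have /andP[h0 h1] := hat_cell hs hX xw wz; rewrite ger0_norm.
Qed.

End Means.

(** * Convergence *)

Section Convergence.
Context {R : realType}.
Variables (s : R) (X : set (R * R)).
Hypotheses (hs : 0 < s <= 8^-1) (hX : is_diamond_fractal s X).
Variable mu : {measure set (R * R) -> \bar R}.
Hypothesis hmu : is_fractal_measure s X mu.
Variable Gamma : cfun R -> {measure set (R * R) -> \bar R}.
Hypothesis hGamma : is_energy_measures s X Gamma.
Variable H : one_forms s X Gamma.
Implicit Types (f g h u : cfun R) (w v : seq 'I_4) (a b c : H) (m n : nat).
Local Notation dot := (form_dot H).
Local Notation mul := (form_mul H).
Local Notation ind := (cell_indicator s X).

Let cX : compact X. Proof. by case: hX. Qed.

Lemma graph_magnetic_opE m a f x : real_form a ->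
  graph_magnetic_op m a f x = - (degree s m x)%:R^-1 * \sum_(w : m.-tuple 'I_4 | at_word s x w)
    (f x - f (other_end s x w) * phase (Re (coef a w) * ((other_end s x w).1 - x.1))).
Proof.
move=> ha; rewrite /graph_magnetic_op mulN1r; congr (_ * _).
rewrite (adj_sum hs); apply: eq_bigr => w xw.
by rewrite -(edge_valueE hs hX hGamma ha xw).
Qed.

(** The number of cells at x equals the degree, so the normalized graph operator is an average over
    cells. The bound for one cell, [eps] from replacing a by a_m and [eta] from replacing u by its
    value at x, survives the averaging. *)
Lemma magnetic_op_vertex_estimate m a f u x (M eps eta : R) : real_form a -> magnetic_op mu a f u ->
  vertices s m x -> ~ vertices s 0 x -> 0 <= M -> 0 <= eta ->
  (forall z, X z -> rnorm (f z) <= M) ->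
  (forall w : m.-tuple 'I_4, 4 ^+ m * rnorm (mul (ind w) (a - form_proj m a)) <= eps) ->
  (forall (w : m.-tuple 'I_4) z, at_word s x w -> cell s X w z ->
     rnorm (u z * cphase (Re (coef a w)) x.1 z - u x) <= eta) ->
  rnorm (4 ^+ m * graph_magnetic_op m a f x - u x) <= (rnorm (cov f a) + M) * eps + 4 * eta.
Proof.
move=> ha [df cu hfu] xm x0 M0 eta0 hM heps heta.
pose k w := Re (coef a w).
have [g [dg g0] gG] := piece_glue hs hX m k x0.
have p4 : 0 < 4 ^+ m :> R by rewrite exprn_gt0.
have p4C : (4 : R[i]) ^+ m = (4 ^+ m)%:C by rewrite rmorphXn rmorph_nat.
pose N := degree s m x; have NE : N = (\sum_(w : m.-tuple 'I_4 | at_word s x w) 1)%N by exact: degreeE.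
have N0 : (0 < N)%N.
  by have [w xw] := (verticesP s m x).1 xm; rewrite NE (bigD1 w).
have N1 : (N%:R : R[i]) != 0 by rewrite pnatr_eq0 -lt0n.
have NC (A : pzSemiRingType) (c : A) : \sum_(w : m.-tuple 'I_4 | at_word s x w) c = c * N%:R.
  by rewrite NE natr_sum mulr_sumr; apply: eq_bigr => w _; rewrite mulr1.
pose S (w : m.-tuple 'I_4) := f x - f (other_end s x w) * phase (k w * ((other_end s x w).1 - x.1)).
pose T (w : m.-tuple 'I_4) := dot (mul (ind w) (cov f a))
  (mul (ind w) (cov (test_function (k w) x (other_end s x w)) a)).
pose I (w : m.-tuple 'I_4) := cintegral mu X
  (fun z => ind w z * (u z * conjc (test_function (k w) x (other_end s x w) z))).
have TI : \sum_(w : m.-tuple 'I_4 | at_word s x w) T w = - \sum_(w : m.-tuple 'I_4 | at_word s x w) I w.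
  rewrite -(magnetic_form_pieces hs hX hGamma a df dg gG) hfu//.
  exact: (cintegral_pieces hs hX hmu cu dg gG).
have hT (w : m.-tuple 'I_4) : at_word s x w ->
    4 ^+ m * rnorm (T w - S w) <= (rnorm (cov f a) + M) * eps.
  move=> xw; have hb := cell_form_proj hs hX hGamma w ha; rewrite -/(k w) in hb.
  rewrite /S -(cell_cov_test hs hX hGamma df xw hb).
  have dt := dom_test_function hs hX (k w) x (other_end s x w).
  have := cell_perturb hs hX hGamma a (dom_bborel hX df) (dom_bborel hX dt) M0 hM
    (fun z => test_function_cell hs hX (k w) xw) (cell_cov_test_le hs hX hGamma xw hb).
  move=> h; apply: le_trans (ler_wpM2l (ltW p4) h) _; rewrite mulrCA.
  by apply: ler_wpM2l; rewrite ?addr_ge0 ?rnorm_ge0.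
have hI (w : m.-tuple 'I_4) : at_word s x w -> rnorm (4 ^+ m * I w - u x) <= 4 * eta.
  move=> xw; have := cell_mean hs hX hmu cu xw eta0 (fun z => heta w z xw).
  by rewrite size_tuple.
have -> : graph_magnetic_op m a f x = - N%:R^-1 * \sum_(w : m.-tuple 'I_4 | at_word s x w) S w.
  exact: graph_magnetic_opE.
clearbody S T I.
(* By [TI] the sums of [I] and of [T] cancel, and summing [u x] over the [N] cells gives [N] copies
   of it; the identity turns the difference into an average of errors of single cells. *)
have -> : 4 ^+ m * (- N%:R^-1 * \sum_(w : m.-tuple 'I_4 | at_word s x w) S w) - u x =
    N%:R^-1 * \sum_(w : m.-tuple 'I_4 | at_word s x w) ((4 ^+ m * I w - u x) + 4 ^+ m * (T w - S w)).
  rewrite big_split /= big_split /= -!mulr_sumr sumrB TI NC.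
  by field.
rewrite rnormM rnormV rnorm_nat mulrC ler_pdivrMr ?ltr0n//.
apply: le_trans (rnorm_sum _ _ _) _.
apply: (@le_trans _ _ (\sum_(w : m.-tuple 'I_4 | at_word s x w)
    ((rnorm (cov f a) + M) * eps + 4 * eta))); last first.
  by rewrite NC.
apply: ler_sum => w xw; apply: le_trans (rnormD _ _) _; rewrite addrC; apply: lerD; last exact: hI.
by rewrite rnormM p4C rnorm_real gtr0_norm// hT.
Qed.

Definition residual m a (w : m.-tuple 'I_4) : R :=
  4 ^+ m * rnorm (mul (ind w) (a - form_proj m a)).

(** The set is bounded by 4^m times the norm of a - a_m, so its [sup] really is an upper bound. *)
Lemma residual_le_sup m a (w : m.-tuple 'I_4) :
  residual a w <= sup [set residual a w | w in [set: m.-tuple 'I_4]].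
Proof.
apply: ub_le_sup; last by exists w.
exists (4 ^+ m * rnorm (a - form_proj m a)) => _ [v _ <-].
by rewrite ler_wpM2l ?exprn_ge0//; exact: (rnorm_mul_ind hs hX hGamma).
Qed.

(** A level n with residuals at most e/2 is fixed first (the factor 4^n >= 1 is discarded). The
    coefficients of a_n then have a fixed sum, and 2^-m makes their share at most e/2 for large
    m. *)
Lemma coef_vanish a (e : R) :
  sup [set residual a w | w in [set: m.-tuple 'I_4]] @[m --> \oo] --> (0 : R) -> 0 < e ->
  exists N, forall m (w : m.-tuple 'I_4), (N <= m)%N ->
    rnorm (coef a w) * (2 * 2^-1 ^+ m) <= e.
Proof.
move=> hconv e0; have e2 : 0 < e / 2 by rewrite divr_gt0.
have /cvgrPdist_le /(_ _ e2) [n _ hn] := hconv.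
have hn' (v : n.-tuple 'I_4) : rnorm (mul (ind v) (a - form_proj n a)) <= e / 2.
  have := hn n (leqnn n); rewrite sub0r normrN => h.
  apply: le_trans (le_trans (le_trans (residual_le_sup a v) (ler_norm _)) h).
  by rewrite ler_peMl ?rnorm_ge0// exprn_ege1// ler1n.
set K := \sum_(v : n.-tuple 'I_4) rnorm (coef a v).
have [N hN] := half_expn_small (K * 2) e2; exists (maxn n N) => m w.
rewrite geq_max => /andP[nm Nm].
have [|v] := coef_refine hs hX hGamma (n := n) a (w := w); first by rewrite size_tuple.
rewrite size_tuple => h; apply: le_trans h _; rewrite [leRHS]splitr; apply: lerD => //.
have K0 : 0 <= K * 2 by rewrite mulr_ge0// sumr_ge0// => v' _; exact: rnorm_ge0.
rewrite -/K mulrA; apply: le_trans (ltW hN); apply: ler_wpM2l => //.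
by apply: ler_wiXn2l; rewrite ?invr_ge0// invf_le1// ler1n.
Qed.

(** On the cell the angle is at most |c_w| times its width 2 * 2^-m, which [coef_vanish] makes
    small; the rest is uniform continuity of [u]. *)
Lemma phase_modulation_small a u (e : R) : continuous_on X u ->
  sup [set residual a w | w in [set: m.-tuple 'I_4]] @[m --> \oo] --> (0 : R) -> 0 < e ->
  exists N, forall m x (w : m.-tuple 'I_4) z, (N <= m)%N -> at_word s x w -> cell s X w z ->
    rnorm (u z * cphase (Re (coef a w)) x.1 z - u x) <= e.
Proof.
move=> cu hconv e0; have [M M0 hM] := continuous_on_bounded cX cu.
have e2 : 0 < e / 2 by rewrite divr_gt0.
have e4 : 0 < e / 4 / (M + 1) by rewrite !divr_gt0// ltr_wpDl.
have [N1 h1] := cell_uniform hs hX cu e2; have [N2 h2] := coef_vanish hconv e4.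
exists (maxn N1 N2) => m x w z; rewrite geq_max => /andP[l1 l2] xw wz.
have wx : cell s X w x.
  by move: xw => /orP[] /eqP ->; [exact: (cell_lpt hs hX)|exact: (cell_rpt hs hX)].
have Xz := cell_sub hX wz; set k := Re _.
rewrite (_ : _ - u x = u z * (cphase k x.1 z - 1) + (u z - u x)); last by ring.
apply: le_trans (rnormD _ _) _; rewrite [leRHS]splitr; apply: lerD; last first.
  by apply/ltW/(h1 w) => //; rewrite size_tuple.
rewrite rnormM /cphase -phase0; set th := k * _.
have hth : `|th| <= e / 4 / (M + 1).
  apply: le_trans (h2 m w l2); rewrite /th normrM.
  have [hz _] := cell_close hs hX wz wx; rewrite size_tuple in hz.
  by apply: ler_pM => //; exact: normRe_le.
apply: (@le_trans _ _ (M * (2 * (e / 4 / (M + 1))))).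
  apply: ler_pM; rewrite ?rnorm_ge0 ?hM//.
  by apply: le_trans (phase_dist_le _ _) _; rewrite subr0 ler_wpM2l.
have M1 : 0 < M + 1 by rewrite ltr_wpDl.
rewrite (_ : M * _ = e / 2 * (M / (M + 1))); last by field; rewrite gt_eqF.
by rewrite ger_pMr// ler_pdivrMr// mul1r lerDl.
Qed.

End Convergence.

Theorem theorem3p6 (R : realType) (s : R) (hs : 0 < s <= 8^-1)
    (X : set (R * R)) (hX : is_diamond_fractal s X)
    (mu : {measure set (R * R) -> \bar R}) (hmu : is_fractal_measure s X mu)
    (Gamma : cfun R -> {measure set (R * R) -> \bar R})
    (hGamma : is_energy_measures s X Gamma)
    (H : one_forms s X Gamma) (a : H) (ha : real_form a)
    (hconv : sup [set 4 ^+ m * rnorm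
                        (form_mul H (cell_indicator s X w) (a - form_proj m a))
                   | w in [set: m.-tuple 'I_4]] @[m --> \oo] --> (0 : R))
    (f u : cfun R) (hf : magnetic_op mu a f u) :
  sup [set rnorm (4 ^+ m * graph_magnetic_op m a f x - u x)
        | x in vertices s m `\` vertices s 0] @[m --> \oo] --> (0 : R).
Proof.
have [df cu _] := hf; have [M M0 hM] := dom_bounded hX df.
set K := rnorm (cov f a) + M; have K0 : 0 <= K by rewrite addr_ge0 ?rnorm_ge0.
have K1 : 0 < K + 1 by rewrite ltr_wpDl.
apply/cvgrPdist_le => e e0.
have e2 : 0 < e / 2 / (K + 1) by rewrite !divr_gt0.
(* The vertex estimate multiplies this error by 4, which leaves e/2 for the term with [K]. *)
have e8 : 0 < e / 8 by rewrite divr_gt0.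
have /cvgrPdist_le /(_ _ e2) [N1 _ h1] := hconv.
have [N2 h2] := phase_modulation_small hs hX hGamma cu hconv e8.
exists (maxn N1 N2) => // m /=; rewrite geq_max => /andP[l1 l2].
set E := (X in sup X).
have hE y : E y -> 0 <= y <= e.
  move=> [x [xm x0] <-]; rewrite rnorm_ge0 /=.
  have res (w : m.-tuple 'I_4) :
      4 ^+ m * rnorm (form_mul H (cell_indicator s X w) (a - form_proj m a)) <= e / 2 / (K + 1).
    have := h1 m l1; rewrite sub0r normrN => h; apply: le_trans h.
    exact: le_trans (residual_le_sup hs hX hGamma a w) (ler_norm _).
  have := magnetic_op_vertex_estimate hs hX hmu hGamma ha hf xm x0 M0 (ltW e8) hM res
    (fun w z xw wz => h2 m x w z l2 xw wz).
  move=> h; apply: le_trans h _; rewrite -/K.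
  have : K * (e / 2 / (K + 1)) <= e / 2.
    by rewrite mulrCA ger_pMr ?divr_gt0// ler_pdivrMr// mul1r lerDl.
  by lra.
rewrite sub0r normrN.
(* At m = 0 there is no vertex outside V_0, and the [sup] of the empty set is 0. *)
have [->|/set0P[y Ey]] := eqVneq E set0; first by rewrite sup0 normr0 ltW.
have ubE : ubound E e by move=> z /hE /andP[].
rewrite ger0_norm; first by apply: ge_sup => //; exists y.
apply: le_trans (ub_le_sup _ Ey); first by have /andP[] := hE _ Ey.
by exists e.
Qed.
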